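(* Let $q>2$ and $L>1$. There exist constants $c,c_0,c_1,c_2>0$ that depend only on $q$ and $L$ for which the following holds. Let $\sigma>0$, let $X$ be distributed according to $\mu$ on $\mathcal{X}$, and let $\mathcal{F}\subset L_2(\mu)$ be a locally compact class of functions such that $\|f\|_{L_q}\le L\|f\|_{L_2}$ for every $f\in\mathrm{span}(\mathcal{F})$. Assume further that $Y=f_0(X)+W$ for some $f_0\in\mathcal{F}$ and some random variable $W$ that is mean-zero, independent of $X$, and satisfies $\|W\|_{L_2}\le\sigma$ (so that $f^*=f_0$). Let $$r^*(f^* )=\max\{\lambda_{\mathbb{Q}}(c_1,c_2,f^* ),\ \lambda_{\mathbb{M}}(c_1/\sigma,c_2,f^* ),\ r_E(c_1,f^* ),\ \overline{r}_{\mathbb{M}}(c_1,f^* )\}$$ and fix $r\ge2r^*(f^* )$. Then there exists a procedure that, based on the data $\mathcal{D}_N=(X_i,Y_i)_{i=1}^N$ and the values of $L$, $q$, $\sigma$ and $r$ (and not on the unknown distribution of $(X,Y)$), selects a function $\widehat f\in\mathcal{F}$ such that, with probability at least $$1-\exp\bigl(-c_0N\min\{1,\sigma^{-2}r^2\}\bigr),$$ one has $$\|\widehat f-f_0\|_{L_2}\le c\,r\quad\text{and}\quad\mathbb{E}\bigl((\widehat f(X)-Y)^2\,\big|\,\mathcal{D}_N\bigr)\le\mathbb{E}(f_0(X)-Y)^2+(c\,r)^2 .$$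
   Context: Setting. $X$ takes values in a measurable space $\mathcal{X}$ and has law $\mu$; $(X_i,Y_i)_{i=1}^N$ are independent copies of $(X,Y)$, and $(X,Y)$ is independent of $\mathcal{D}_N=(X_i,Y_i)_{i=1}^N$. The law of $(X,Y)$ is unknown. $\mathcal{F}$ is a class of real functions on $\mathcal{X}$ (not assumed convex). A procedure is a map $(\mathcal{X}\times\mathbb{R})^N\to\mathcal{F}$; it may depend on $\mathcal{F}$, $N$ and the listed parameters only. $f^*=\mathrm{argmin}_{f\in\mathcal{F}}\mathbb{E}(f(X)-Y)^2$. Norms: $\|f\|_{L_q}=(\mathbb{E}|f(X)|^q)^{1/q}$; conditional on the data, $\|\widehat f-f_0\|_{L_2}^2=\mathbb{E}((\widehat f(X)-f_0(X))^2|\mathcal{D}_N)$. Complexity parameters. $D=\{f:\|f\|_{L_2(\mu)}\le1\}$. For a class $V$ and a function $h$, $\mathrm{star}(V,h)=\{\lambda v+(1-\lambda)h: 0\le\lambda\le1,\ v\in V\}$. For $h\in\mathcal{F}$, $r>0$, $\mathcal{F}_{h,r}=\mathrm{star}(\mathcal{F}-h,0)\cap rD$. For $H\subset L_2(\mu)$ and $\varepsilon>0$, $\mathcal{M}(H,\varepsilon D)$ is the maximal cardinality of a subset of $H$ whose distinct points are at $L_2(\mu)$ distance at least $\varepsilon$. $(\varepsilon_i)_{i=1}^N$ are independent symmetric $\{-1,1\}$-valued random variables independent of $(X_i,Y_i)_{i=1}^N$. For $\kappa,\eta>0$ and $h\in\mathcal{F}$: $$\lambda_{\mathbb{Q}}(\kappa,\eta,h)=\inf\{r:\log\mathcal{M}(\mathcal{F}_{h,r},\eta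 rD)\le\kappa^2N\},$$ $$\lambda_{\mathbb{M}}(\kappa,\eta,h)=\inf\{r:\log\mathcal{M}(\mathcal{F}_{h,r},\eta rD)\le\kappa^2Nr^2\},$$ $$r_E(\kappa,h)=\inf\Bigl\{r:\mathbb{E}\sup_{u\in\mathcal{F}_{h,r}}\Bigl|\tfrac1{\sqrt N}\sum_{i=1}^N\varepsilon_iu(X_i)\Bigr|\le\kappa\sqrt N\,r\Bigr\},$$ $$\overline{r}_{\mathbb{M}}(\kappa,h)=\inf\Bigl\{r:\mathbb{E}\sup_{u\in\mathcal{F}_{h,r}}\Bigl|\tfrac1{\sqrt N}\sum_{i=1}^N\varepsilon_iu(X_i)(h(X_i)-Y_i)\Bigr|\le\kappa\sqrt N\,r^2\Bigr\}.$$ *)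

(* Defs.v *)
From HB Require Import structures.
From mathcomp Require Import all_boot all_order all_algebra.
From mathcomp Require Import all_classical all_reals all_analysis.
From mathcomp Require Import measurable_realfun.

Set Implicit Arguments.
Unset Strict Implicit.
Unset Printing Implicit Defensive.

Import Order.TTheory GRing.Theory Num.Theory.
Import numFieldNormedType.Exports.

Local Open Scope classical_set_scope.
Local Open Scope ring_scope.

Section measures.
Context {d : measure_display} {R : realType}.

Lemma tuple_cons_measurable (T : measurableType d) n :
  measurable_fun [set: T * n.-tuple T]
    (fun x : T * n.-tuple T => [the n.+1.-tuple T of x.1 :: x.2]).
Proof. by apply: measurable_cons; [exact: measurable_fst|exact: measurable_snd]. Qed.

Definition tuple_cons (T : measurableType d) n (x : T * n.-tuple T) :
  n.+1.-tuple T := [the n.+1.-tuple T of x.1 :: x.2].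

HB.instance Definition _ (T : measurableType d) n :=
  @isMeasurableFun.Build _ _ _ _ (@tuple_cons T n)
    (@tuple_cons_measurable T n).

Fixpoint iid_law (T : measurableType d) (P : probability T R) (n : nat) :
    probability (n.-tuple T) R :=
  if n is m.+1
  then distribution (P \x iid_law P m)%E (@tuple_cons T m)
  else dirac [tuple].

Lemma iid_lawE (T : measurableType d) (P : probability T R) n
    (B : 'I_n -> set T) :
  (forall i, measurable (B i)) ->
  iid_law P n [set w | forall i, B i (tnth w i)] = (\prod_(i < n) P (B i))%E.
Proof.
elim: n B => [|n IH] B mB.
  rewrite big_ord0 /= diracE mem_set //=. by case.
rewrite big_ord_recl -IH // /= /distribution /= /pushforward.
rewrite -product_measure1E //.
  congr (product_measure1 _ _ _); apply/seteqP; split => -[x w] /=.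
    move=> h; split; first by have := h ord0; rewrite (tnth_nth x).
    by move=> i; have := h (lift ord0 i); rewrite !(tnth_nth x).
  move=> [h0 h] i; case: (unliftP ord0 i) => [j|] ->.
    by have := h j; rewrite !(tnth_nth x).
  by rewrite (tnth_nth x).
rewrite (_ : [set _ | _] = \big[setI/setT]_(i < n) ((fun w : n.-tuple T => tnth w i) @^-1` (B (lift ord0 i)))).
  apply: bigsetI_measurable => i _. rewrite -[X in measurable X]setTI. by apply: measurable_tnth.
apply/seteqP; split => w /=.
  by move=> h; rewrite -bigcap_seq /= => i _; exact: h.
rewrite -bigcap_seq /= => h i. by apply: h => /=; rewrite mem_index_enum.
Qed.

(* Coincides with [\int[mu]_x f x] when [f >= 0] is measurable; a supremum over
   an uncountable class need not be measurable, and on such functions the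
   library integral is only a lower integral. *)
Definition outer_expectation (T : measurableType d)
    (mu : {measure set T -> \bar R}) (f : T -> \bar R) : \bar R :=
  ereal_inf [set (\int[mu]_x g x)%E | g in
    [set g : T -> \bar R | measurable_fun [set: T] g /\
                           forall x, (0 <= g x)%E /\ (f x <= g x)%E]].

End measures.

Section L2.
Context {d : measure_display} {T : measurableType d} {R : realType}.
Variable mu : probability T R.

Definition Lqnorm (q : R) (f : T -> R) : \bar R := 'N[mu]_(q%:E)[EFin \o f]%E.

(* Functions, not almost-everywhere classes: the topology below is that of a
   pseudometric, which need not separate points. *)
Definition L2space : Type := LfunType mu (lee1n 2).

HB.instance Definition _ := Choice.on L2space.

Definition L2ball (f : L2space) (e : R) : set L2space :=
  [set g : L2space | (Lqnorm 2%R (f \- g)%R < e%:E)%E].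

Definition L2ent : set_system (L2space * L2space) := entourage_ L2ball.

HB.instance Definition _ := hasNbhs.Build L2space (nbhs_ L2ent).

Let L2ball_center f (e : R) : 0 < e -> L2ball f e f.
Proof.
move=> e0; rewrite /L2ball /= /Lqnorm (_ : _ \o _ = cst 0%E).
  by rewrite Lnorm0 ?lte_fin// eqe pnatr_eq0.
by apply/funext => x /=; rewrite subrr.
Qed.

Let L2ball_sym f g (e : R) : L2ball f e g -> L2ball g e f.
Proof.
rewrite /L2ball /= /Lqnorm -oppe_Lnorm; congr (Lnorm _ _ _ < _)%E.
by apply/funext => x /=; rewrite opprB.
Qed.

Let L2ball_triangle f g h (e1 e2 : R) :
  L2ball f e1 g -> L2ball g e2 h -> L2ball f (e1 + e2) h.
Proof.
rewrite /L2ball /= /Lqnorm => fg gh.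
rewrite (_ : (f \- h) = (f \- g) \+ (g \- h)); last first.
  by apply/funext => x /=; rewrite addrA subrK.
apply: (le_lt_trans (eminkowski _ _ _ (lee1n 2))).
- by apply: measurable_funB.
- by apply: measurable_funB.
- exact: (lteD fg gh).
Qed.

HB.instance Definition _ := Nbhs_isPseudoMetric.Build R L2space
  erefl L2ball_center L2ball_sym L2ball_triangle erefl.

End L2.

(* [F] is a locally compact space for its subspace topology; the library's
   [locally_compact] only asks for precompact traces in the ambient space. *)
Definition L2_locally_compact {d : measure_display} {T : measurableType d}
    {R : realType} (mu : probability T R) (F : set (T -> R)) : Prop :=
  forall f : L2space mu, F f ->
  exists K : set (L2space mu), [/\ K `<=` [set g : L2space mu | F g],
    within [set g : L2space mu | F g] (nbhs f) K & compact K].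

Arguments Lqnorm {d T R} mu q%_R f%_R.

Section classes.
Context {T : Type} {R : realType}.

Definition linear_span (F : set (T -> R)) : set (T -> R) :=
  [set f | exists n (a : 'I_n -> R) (g : 'I_n -> T -> R),
    (forall i, F (g i)) /\ f = (fun x => \sum_(i < n) a i * g i x)].

Definition star (V : set (T -> R)) (h : T -> R) : set (T -> R) :=
  [set u | exists (l : R) (v : T -> R),
    [/\ 0 <= l <= 1, V v & u = (fun x => l * v x + (1 - l) * h x)]].

End classes.

Section complexity.
Context {d : measure_display} {T : measurableType d} {R : realType}.
Variables (mu : probability T R) (N : nat) (F : set (T -> R)).

Definition local_class (h : T -> R) (r : R) : set (T -> R) :=
  star [set f \- h | f in F] (cst 0) `&` [set u | (Lqnorm mu 2 u <= r%:E)%E].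

(* Maximal cardinality of an [e]-separated subset of [H], for [e > 0];
   it is [+oo] when there are arbitrarily large ones. *)
Definition packing (H : set (T -> R)) (e : R) : \bar R :=
  ereal_sup [set n%:R%:E | n in [set n : nat | exists v : 'I_n -> T -> R,
    (forall i, H (v i)) /\
    (forall i j, i != j -> (e%:E <= Lqnorm mu 2 (v i \- v j))%E)]].

(* [E sup_(v in H) |N^(-1/2) \sum_i eps_i v(Z_i)|], the pairs [(Z_i, eps_i)]
   being i.i.d. with law [P \x (uniform law on {-1, 1})]; the sign [eps_i] is
   encoded as [(-1) ^+ b] with [b] a fair boolean. *)
Definition rademacher_sup {d'} {Z : measurableType d'} (P : probability Z R)
    (H : set (Z -> R)) : \bar R :=
  outer_expectation (iid_law (P \x bernoulli_prob (2^-1 : R))%E N)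
    (fun w => ereal_sup
      [set `|(Num.sqrt N%:R)^-1 *
             \sum_(i < N) (-1) ^+ (tnth w i).2 * v (tnth w i).1|%:E | v in H]).

Definition lambda_Q (kappa eta : R) (h : T -> R) : \bar R :=
  ereal_inf [set r%:E | r in [set r : R | 0 < r /\
    (lne (packing (local_class h r) (eta * r)) <= (kappa ^+ 2 * N%:R)%:E)%E]].

Definition lambda_M (kappa eta : R) (h : T -> R) : \bar R :=
  ereal_inf [set r%:E | r in [set r : R | 0 < r /\
    (lne (packing (local_class h r) (eta * r))
       <= (kappa ^+ 2 * N%:R * r ^+ 2)%:E)%E]].

Definition r_E (kappa : R) (h : T -> R) : \bar R :=
  ereal_inf [set r%:E | r in [set r : R | 0 < r /\
    (rademacher_sup mu (local_class h r)
       <= (kappa * Num.sqrt N%:R * r)%:E)%E]].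

(* [PXY] is the law of [(X, Y)], with first marginal [mu]. *)
Definition r_M (PXY : probability (T * R)%type R) (kappa : R) (h : T -> R) : \bar R :=
  ereal_inf [set r%:E | r in [set r : R | 0 < r /\
    (rademacher_sup PXY
       [set (fun z : T * R => u z.1 * (h z.1 - z.2))%R | u in local_class h r]
       <= (kappa * Num.sqrt N%:R * r ^+ 2)%:E)%E]].

Definition r_star (PXY : probability (T * R)%type R) (c1 c2 sigma : R)
    (h : T -> R) : \bar R :=
  maxe (maxe (lambda_Q c1 c2 h) (lambda_M (c1 / sigma) c2 h))
       (maxe (r_E c1 h) (r_M PXY c1 h)).

End complexity.

Section random_elements.
Context {dO : measure_display} {Omega : measurableType dO} {R : realType}.
Variable P : probability Omega R.

Section pairs.
Context {d1 d2 : measure_display}.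
Context {T1 : measurableType d1} {T2 : measurableType d2}.
Variables (X : {RV P >-> T1}) (Y : {RV P >-> T2}).

Definition RV_pair (w : Omega) : T1 * T2 := (X w, Y w).

Lemma RV_pair_measurable : measurable_fun [set: Omega] RV_pair.
Proof. exact: measurable_fun_pair. Qed.

HB.instance Definition _ := @isMeasurableFun.Build _ _ _ _ RV_pair
  RV_pair_measurable.

Definition independent : Prop :=
  forall (A : set T1) (B : set T2), measurable A -> measurable B ->
    P (X @^-1` A `&` Y @^-1` B) = (P (X @^-1` A) * P (Y @^-1` B))%E.

End pairs.

Section families.
Context {d : measure_display} {T : measurableType d}.

Definition same_law (X Y : {RV P >-> T}) : Prop :=
  forall A : set T, measurable A -> distribution P X A = distribution P Y A.

Definition mutually_independent (I : finType) (Z : I -> {RV P >-> T}) : Prop :=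
  forall (J : pred I) (B : I -> set T),
    (forall i, J i -> measurable (B i)) ->
    P (\bigcap_(i in [set i | J i]) (Z i @^-1` B i)) =
    (\prod_(i | J i) P (Z i @^-1` B i))%E.

End families.

Section regression.
Context {d : measure_display} {T : measurableType d}.
Variables (X : {RV P >-> T}) (Y : {RV P >-> R}).

(* Joint independence with the index [None] standing for [(X, Y)]: the sample
   points are independent of one another and the sample is independent of
   [(X, Y)]. *)
Definition iid_sample (N : nat) (D : 'I_N -> {RV P >-> (T * R)%type}) : Prop :=
  (forall i, same_law (D i) (RV_pair X Y)) /\
  mutually_independent (fun i : option 'I_N =>
    if i is Some j then D j else (RV_pair X Y : {RV P >-> (T * R)%type})).

(* At a fixed [f]. For [f] selected from a sample independent of [(X, Y)], this
   is [E((f(X) - Y)^2 | sample)]. *)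
Definition risk (f : T -> R) : \bar R := 'E_P[(fun w => (f (X w) - Y w) ^+ 2)%R]%E.

Definition risk_minimizer (F : set (T -> R)) (f : T -> R) : Prop :=
  F f /\ forall g, F g -> (risk f <= risk g)%E.

End regression.

End random_elements.

Definition sample_value {dO d : measure_display} {Omega : measurableType dO}
    {T : measurableType d} {R : realType} {P : probability Omega R} {N : nat}
    (D : 'I_N -> {RV P >-> (T * R)%type}) (w : Omega) : N.-tuple (T * R)%type :=
  [tuple D i w | i < N].

(* Main.v *)
(* The procedure is a median-of-means tournament.  Cut the sample into [n]
   blocks of size [m], of the order of [max(1, sigma^2 / r^2)], and select an
   [f] whose total loss on more than half of the blocks is at most that of any
   given competitor plus [m r^2 / 4].  With [v = f - f^*], the excess loss of [f]
   on a block is [sum v^2 + 2 sum v (f^* - Y)].  On an event of probability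
   [1 - exp(-c0 N min(1, r^2 / sigma^2))], for every [v] in the localized class
   at once, on more than half of the blocks the multiplier sum is small and, when
   [v] has norm [r], the quadratic sum is at least [m r^2 / 4].  By star-shape
   any [f] at distance [rho >= r] reduces to the case of norm [r], and the
   quadratic term, growing like [(rho / r)^2], beats the linear one.  Hence [f^*]
   is accepted and nothing accepted is farther than [2 r].

   The number of bad blocks changes by at most one with each block, so it
   concentrates by bounded differences; its mean is bounded by symmetrization
   and contraction through [r_E] and [rbar_M].  The packing numbers serve only
   to show that [N min(1, r^2 / sigma^2)] is large unless the whole of [F] lies
   within [2 r] of [f^*].

   Suprema over [F] need not be measurable.  Throughout, a supremum of a process
   is replaced by its measurable majorants, and an inequality between expected
   suprema by the transformation of a majorant of one process into a majorant of
   the other. *)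

Require Import Defs.
From HB Require Import structures.
From mathcomp Require Import all_boot all_order all_algebra.
From mathcomp Require Import all_classical all_reals all_analysis.
From mathcomp Require Import measurable_realfun.
From mathcomp Require Import ring lra zify.

Import Order.TTheory GRing.Theory Num.Theory.
Import numFieldNormedType.Exports.

Set Implicit Arguments.
Unset Strict Implicit.
Unset Printing Implicit Defensive.

Local Open Scope classical_set_scope.
Local Open Scope ring_scope.

(** * Measure-preserving maps and i.i.d. laws *)

(** With [q] barely above [2], the square of [v] may have no variance, so the quadratic sum is
    bounded below by that of [min ((v / r)^2, M^2)]. For [v] of norm [r], norm equivalence keeps at
    least half of the second moment after truncation. The truncated square is also Lipschitz, which
    is what lets contraction pass to the linear process of [r_E].

    Bad blocks are not counted directly: an indicator is not Lipschitz. Each is replaced by a ramp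
    of the block sum, whose centred version can be symmetrized. Its mean is at most [1 / 16] and the
    centred total is kept below [n / 8], so that fewer than a quarter of the blocks are bad for each
    of the two processes, and more than half are good for both.

    The tolerance [m r^2 / 4] has two origins that agree: on a good block it is the truncated mean
    [1 / 2] less a deviation [1 / 4], and it is also twice the multiplier bound [m r^2 / 8]. At
    distance [k r] the excess loss thus exceeds [k (k - 1)] tolerances, which rules out [k > 2];
    hence [c = 2].

    The main obstacle is bounded differences: a measurable majorant of a supremum does not inherit
    them, so the usual martingale argument cannot be applied to the majorant. *)

Definition measure_preserving {R : realType} {d1 d2 : measure_display}
    {T1 : measurableType d1} {T2 : measurableType d2}
    (P1 : probability T1 R) (P2 : probability T2 R) (f : T1 -> T2) : Prop :=
  measurable_fun [set: T1] f /\
  forall A, measurable A -> P1 (f @^-1` A) = P2 A.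

Section measure_preserving.
Context {R : realType}.

Lemma preserving_integral {d1 d2} {T1 : measurableType d1}
    {T2 : measurableType d2} (P1 : probability T1 R) (P2 : probability T2 R)
    (f : T1 -> T2) (g : T2 -> \bar R) :
  measure_preserving P1 P2 f -> measurable_fun [set: T2] g ->
  (forall y, (0 <= g y)%E) ->
  (\int[P2]_y g y = \int[P1]_x g (f x))%E.
Proof.
move=> [mf fP] mg g0.
pose F : {mfun T1 >-> T2} :=
  HB.pack f (isMeasurableFun.Build _ _ _ _ f mf).
rewrite -[RHS](ge0_integral_distribution (P := P1) F mg g0).
by apply: eq_measure_integral => A mA _; apply/esym; exact: fP.
Qed.

Lemma preserving_fst {d1 d2} {T1 : measurableType d1} {T2 : measurableType d2}
    (P1 : probability T1 R) (P2 : probability T2 R) :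
  measure_preserving (P1 \x P2)%E P1 fst.
Proof.
split=> // A mA.
rewrite (_ : fst @^-1` A = A `*` setT); last first.
  by apply/seteqP; split=> -[x y] //= [].
rewrite [LHS](product_measure1E _ _ mA measurableT).
rewrite -[RHS]mule1; congr (_ * _)%E; exact: probability_setT.
Qed.

Lemma preserving_prod {d1 d2 d3 d4} {T1 : measurableType d1}
    {T2 : measurableType d2} {T3 : measurableType d3} {T4 : measurableType d4}
    (P1 : probability T1 R) (P2 : probability T2 R)
    (P3 : probability T3 R) (P4 : probability T4 R)
    (f : T1 -> T3) (g : T2 -> T4) :
  measure_preserving P1 P3 f -> measure_preserving P2 P4 g ->
  measure_preserving (P1 \x P2)%E (P3 \x P4)%E (fun x => (f x.1, g x.2)).
Proof.
move=> [mf fP] [mg gP].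
have mfg : measurable_fun [set: T1 * T2] (fun x => (f x.1, g x.2)).
  by apply: measurable_fun_pair; exact: measurableT_comp.
split=> // A mA.
pose F : {mfun (T1 * T2)%type >-> (T3 * T4)%type} :=
  HB.pack (fun x : T1 * T2 => (f x.1, g x.2))
    (isMeasurableFun.Build _ _ _ _ _ mfg).
apply/esym.
apply: (@product_measure_unique _ _ _ _ R P3 P4 (distribution (P1 \x P2)%E F)) => //.
move=> B C mB mC; have := fP _ mB; have := gP _ mC => gPC fPB.
have mfB : measurable (f @^-1` B) by rewrite -[X in measurable X]setTI; exact: mf.
have mgC : measurable (g @^-1` C) by rewrite -[X in measurable X]setTI; exact: mg.
transitivity (P1 (f @^-1` B) * P2 (g @^-1` C))%E.
  exact: (product_measure1E _ _ mfB mgC).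
by congr (_ * _)%E.
Qed.

Context {d : measure_display} {T : measurableType d}.

Lemma measurable_rectangle n (B : 'I_n -> set T) :
  (forall i, measurable (B i)) ->
  measurable [set w : n.-tuple T | forall i, B i (tnth w i)].
Proof.
move=> mB.
rewrite (_ : [set _ | _] = \big[setI/setT]_(i < n)
    ((fun w : n.-tuple T => tnth w i) @^-1` (B i))).
  apply: bigsetI_measurable => i _; rewrite -[X in measurable X]setTI.
  exact: measurable_tnth.
apply/seteqP; split => w /=.
  by move=> h; rewrite -bigcap_seq /= => i _; exact: h.
by rewrite -bigcap_seq /= => h i; apply: h => /=; rewrite mem_index_enum.
Qed.

(** Boxes are stable under intersection and generate the product sigma-algebra, so they determine a
    law. Through [preserving_iid], both regrouping into blocks and sampling only have to be checked
    on boxes. *)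
Lemma iid_law_unique (P : probability T R) n (Q : probability (n.-tuple T) R) :
  (forall B : 'I_n -> set T, (forall i, measurable (B i)) ->
    Q [set w | forall i, B i (tnth w i)] = (\prod_(i < n) P (B i))%E) ->
  forall A, measurable A -> Q A = iid_law P n A.
Proof.
move=> QE A mA.
pose G : set (set (n.-tuple T)) :=
  [set X | exists2 B : 'I_n -> set T, (forall i, measurable (B i)) &
    X = [set w | forall i, B i (tnth w i)]].
have GT : G setT.
  exists (fun=> setT) => [_|]; first exact: measurableT.
  by apply/seteqP; split.
have mG X : G X -> measurable X.
  by move=> [B mB ->]; exact: measurable_rectangle.
apply: (measure_unique G (fun=> setT)) => //.
- apply/seteqP; split; last first.
    by apply: smallest_sub => //; exact: sigma_algebra_measurable.
  apply: smallest_sub; first exact: smallest_sigma_algebra.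
  move=> X; rewrite -bigcup_seq => -[/= i _ [Y mY <-]].
  apply: sub_sigma_algebra.
  exists (fun j => if j == i then Y else setT) => [j|].
    by case: ifP.
  rewrite setTI; apply/seteqP; split => w /=.
    by move=> Yw j; case: eqP => [->|].
  by move=> /(_ i); rewrite eqxx.
- move=> X Y [B mB ->] [C mC ->].
  exists (fun i => B i `&` C i) => [i|]; first exact: measurableI.
  apply/seteqP; split => w /=; first by move=> [Bw Cw] i.
  by move=> BCw; split => i; case: (BCw i).
- by apply/seteqP; split => // x _; exists 0%N.
- by move=> X [B mB ->]; exact: etrans (QE _ mB) (esym (iid_lawE _ mB)).
- move=> _; apply: (@le_lt_trans _ _ 1%E); last exact: ltry.
  exact: probability_le1.
Qed.

Lemma preserving_iid {d'} {S : measurableType d'} (Q : probability S R)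
    (P : probability T R) n (f : S -> n.-tuple T) :
  measurable_fun [set: S] f ->
  (forall B : 'I_n -> set T, (forall i, measurable (B i)) ->
    Q [set w | forall i, B i (tnth (f w) i)] = (\prod_(i < n) P (B i))%E) ->
  measure_preserving Q (iid_law P n) f.
Proof.
move=> mf QE; split=> // A mA.
pose F : {mfun S >-> n.-tuple T} :=
  HB.pack f (isMeasurableFun.Build _ _ _ _ f mf).
exact: (@iid_law_unique P n (distribution Q F)).
Qed.

Lemma preserving_cons (P : probability T R) n :
  measure_preserving (P \x iid_law P n)%E (iid_law P n.+1) (@tuple_cons _ T n).
Proof. by split=> //; exact: tuple_cons_measurable. Qed.

Lemma preserving_uncons (P : probability T R) n :
  measure_preserving (iid_law P n.+1) (P \x iid_law P n)%E
    (fun w => (thead w, [tuple of behead w])).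
Proof.
have mf : measurable_fun [set: n.+1.-tuple T]
    (fun w => (thead w, [tuple of behead w])).
  by apply: measurable_fun_pair; [exact: measurable_tnth|
    exact: measurable_behead].
split=> // A mA.
rewrite /= /distribution /pushforward /=; congr product_measure1.
apply/seteqP; split => -[x w] /=; rewrite theadE; congr A; congr pair;
  exact: val_inj.
Qed.

End measure_preserving.

(** * Comparison of processes through measurable majorants *)

Section integral_facts.
Context {R : realType} {d : measure_display} {B : measurableType d}.
Local Open Scope ereal_scope.

Lemma le_integral_ge0 (mu : {measure set B -> \bar R}) (f g : B -> \bar R) :
  mu.-integrable setT f -> measurable_fun [set: B] g -> (forall x, 0 <= g x) ->
  (forall x, f x <= g x) -> \int[mu]_x f x <= \int[mu]_x g x.
Proof.
move=> intf mg g0 fg; have [goo|] := ltP (\int[mu]_x g x) +oo; last first.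
  by rewrite leye_eq => /eqP ->; rewrite leey.
apply: le_integral => //; apply/integrableP; split=> //.
by under eq_integral do rewrite gee0_abs//.
Qed.

Lemma integral_prob_cst (P : probability B R) (r : \bar R) :
  \int[P]_x r = r.
Proof. by rewrite (integral_cst P measurableT) [X in _ * X](probability_setT P) mule1. Qed.

Lemma integrable_prob_cst (P : probability B R) (r : R) :
  P.-integrable setT (fun=> r%:E).
Proof. exact: finite_measure_integrable_cst. Qed.

Definition rademacher (Q : probability B R) : probability (B * bool)%type R :=
  (Q \x bernoulli_prob (2^-1 : R))%E.

Lemma integral_rademacher (Q : probability B R) (G : B * bool -> \bar R) :
  measurable_fun [set: B * bool] G -> (forall w, 0 <= G w) ->
  \int[rademacher Q]_w G w =
  (2^-1)%:E * \int[Q]_b G (b, true) + (2^-1)%:E * \int[Q]_b G (b, false).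
Proof.
move=> mG G0.
rewrite /rademacher fubini_tonelli2// integral_bernoulli_prob; last 2 first.
- by apply/andP; split; lra.
- by move=> s; apply: integral_ge0.
by congr (_ + _); rewrite /fubini_G; congr (_%:E * _) => //=; rewrite /unstable.onem; lra.
Qed.

End integral_facts.

Section domination.
Context {R : realType} {U : Type} (u0 : U).

(* Stands for [E sup_u (A u + f1 u) <= E sup_u (A u + f2 u)], for every offset
   [A] vanishing at [u0].  The offset is what makes the relation tensorize, the
   other coordinates being absorbed in it; the parameter space [E] keeps the
   majorants jointly measurable when one coordinate is treated at a time. *)
Definition dominated {d1 d2} {B1 : measurableType d1} {B2 : measurableType d2}
    (Q1 : probability B1 R) (f1 : U -> B1 -> R)
    (Q2 : probability B2 R) (f2 : U -> B2 -> R) : Prop :=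
  forall dE (E : measurableType dE) (A : E -> U -> R) (G : E * B2 -> \bar R),
    (forall e, A e u0 = 0) -> measurable_fun [set: E * B2] G ->
    (forall e w u, ((A e u + f2 u w)%:E <= G (e, w))%E) ->
  exists H : E * B1 -> \bar R,
    [/\ measurable_fun [set: E * B1] H,
        forall e b u, ((A e u + f1 u b)%:E <= H (e, b))%E &
        forall e, (\int[Q1]_b H (e, b) <= \int[Q2]_w G (e, w))%E].

(** This is the purpose of the marked point [u0], later the zero function: since processes and
    offsets vanish there, majorants are nonnegative, and Tonelli's theorem applies to them without
    any integrability. *)
Lemma majorant_ge0 {dE d} {E : measurableType dE} {B : measurableType d}
    (A : E -> U -> R) (G : E * B -> \bar R) (f : U -> B -> R) :
  (forall e, A e u0 = 0) -> (forall b, f u0 b = 0) ->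
  (forall e w u, ((A e u + f u w)%:E <= G (e, w))%E) ->
  forall e, (0 <= G e)%E.
Proof.
move=> A0 f0 AG [e w]; apply: le_trans (AG e w u0).
by rewrite A0 f0 addr0.
Qed.

Lemma measurable_section {dE d dC} {E : measurableType dE}
    {B : measurableType d} {C : measurableType dC} (G : E * B -> C) :
  measurable_fun setT G -> forall e, measurable_fun setT (fun w => G (e, w)).
Proof. by move=> mG e; apply: measurableT_comp. Qed.

Section maps.
Context {d1 d2 d3 : measure_display} {B1 : measurableType d1}
  {B2 : measurableType d2} {B3 : measurableType d3}.
Variables (Q1 : probability B1 R) (Q2 : probability B2 R)
  (Q3 : probability B3 R).

Lemma dominated_trans f1 f2 f3 :
  dominated Q1 f1 Q2 f2 -> dominated Q2 f2 Q3 f3 -> dominated Q1 f1 Q3 f3.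
Proof.
move=> d12 d23 dE E A G A0 mG AG.
have [H [mH AH HG]] := d23 _ _ _ _ A0 mG AG.
have [K [mK AK KH]] := d12 _ _ _ _ A0 mH AH.
by exists K; split=> // e; exact: le_trans (KH e) (HG e).
Qed.

Lemma dominated_preserving (f : U -> B2 -> R) (T : B1 -> B2) :
  (forall b, f u0 b = 0) -> measure_preserving Q1 Q2 T ->
  dominated Q1 (fun u b => f u (T b)) Q2 f.
Proof.
move=> f0 T12 dE E A G A0 mG AG; have [mT _] := T12.
exists (fun x => G (x.1, T x.2)); split.
- apply: (measurableT_comp mG); apply: measurable_fun_pair => //.
  exact: measurableT_comp.
- by move=> e b u; exact: AG.
- move=> e /=; rewrite (preserving_integral T12 (measurable_section mG e))//.
  by move=> w; exact: majorant_ge0 AG _.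
Qed.

Lemma dominated_scale (k : R) f1 f2 : 0 < k ->
  (forall b, f1 u0 b = 0) -> (forall b, f2 u0 b = 0) ->
  dominated Q1 f1 Q2 f2 ->
  dominated Q1 (fun u b => k * f1 u b) Q2 (fun u b => k * f2 u b).
Proof.
move=> k0 f10 f20 d12 dE E A G A0 mG AG.
have kE : (0 <= k%:E)%E by rewrite lee_fin ltW.
have kV : (0 <= (k^-1)%:E)%E by rewrite lee_fin invr_ge0 ltW.
have kK (x : \bar R) : (k%:E * ((k^-1)%:E * x) = x)%E.
  by rewrite muleA -EFinM divff ?gt_eqF// mul1e.
have G0 : forall e, (0 <= G e)%E.
  by apply: (@majorant_ge0 _ _ _ _ _ _ (fun u b => k * f2 u b) A0 _ AG) => b;
    rewrite f20 mulr0.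
have A0' e : k^-1 * A e u0 = 0 by rewrite A0 mulr0.
have mG' : measurable_fun setT (fun x => (k^-1)%:E * G x)%E.
  exact: measurable_funeM.
have AG' e w u : ((k^-1 * A e u + f2 u w)%:E <= (k^-1)%:E * G (e, w))%E.
  rewrite -[f2 u w](mulKf (lt0r_neq0 k0)) -mulrDr EFinM.
  exact: lee_wpmul2l.
have [H [mH AH HG]] := d12 _ _ _ _ A0' mG' AG'.
have H0 e b : (0 <= H (e, b))%E.
  by apply: le_trans (AH e b u0); rewrite A0' f10 addr0.
exists (fun x => k%:E * H x)%E; split.
- exact: measurable_funeM.
- move=> e b u; rewrite -[A e u](mulVKf (lt0r_neq0 k0)) -mulrDr EFinM.
  exact: lee_wpmul2l.
- move=> e; rewrite ge0_integralZl//; last exact: measurable_section.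
  rewrite -[leRHS]kK; apply: lee_wpmul2l => //; apply: le_trans (HG e) _.
  by rewrite ge0_integralZl//; exact: measurable_section.
Qed.

End maps.

Section products.
Context {d1 d2 d3 d4 : measure_display} {B1 : measurableType d1}
  {B2 : measurableType d2} {B3 : measurableType d3} {B4 : measurableType d4}.
Variables (Q1 : probability B1 R) (Q2 : probability B2 R)
  (Q3 : probability B3 R) (Q4 : probability B4 R).

(** One factor is replaced at a time. First [Q4] becomes [Q2], with the [B3] coordinate moved into
    the parameter and [f3] into the offset; then [Q3] becomes [Q1], with [B2] and [f2] in these
    roles. The intermediate majorant [K] is jointly measurable because the first step was carried
    out with a parameter. *)
Lemma dominated_prod (f1 : U -> B1 -> R) (f2 : U -> B2 -> R)
    (f3 : U -> B3 -> R) (f4 : U -> B4 -> R) :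
  (forall b, f1 u0 b = 0) -> (forall b, f2 u0 b = 0) ->
  (forall b, f3 u0 b = 0) -> (forall b, f4 u0 b = 0) ->
  dominated Q1 f1 Q3 f3 -> dominated Q2 f2 Q4 f4 ->
  dominated (Q1 \x Q2)%E (fun u b => f1 u b.1 + f2 u b.2)
            (Q3 \x Q4)%E (fun u b => f3 u b.1 + f4 u b.2).
Proof.
move=> f10 f20 f30 f40 d13 d24 dE E A G A0 mG AG.
have G0 : forall e, (0 <= G e)%E.
  by apply: (@majorant_ge0 _ _ _ _ _ _ (fun u b => f3 u b.1 + f4 u b.2) A0 _ AG)
    => b; rewrite f30 f40 addr0.
have [||e w u|K [mK AK KG]] := d24 _ (E * B3)%type
  (fun e u => A e.1 u + f3 u e.2) (fun x => G (x.1.1, (x.1.2, x.2))).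
- by move=> e; rewrite A0 f30 addr0.
- apply: (measurableT_comp mG); apply: measurable_fun_pair => /=.
    exact: measurableT_comp.
  by apply: measurable_fun_pair => //; exact: measurableT_comp.
- by rewrite -addrA; exact: AG.
have K0 x : (0 <= K x)%E.
  by case: x => e b; apply: le_trans (AK e b u0); rewrite A0 f30 f20 !addr0.
have [||e w u|H [mH AH HK]] := d13 _ (E * B2)%type
  (fun e u => A e.1 u + f2 u e.2) (fun x => K ((x.1.1, x.2), x.1.2)).
- by move=> e; rewrite A0 f20 addr0.
- apply: (measurableT_comp mK); apply: measurable_fun_pair => /=.
    by apply: measurable_fun_pair => //; exact: measurableT_comp.
  exact: measurableT_comp.
- by rewrite addrAC; exact: AK.
have H0 x : (0 <= H x)%E.
  by case: x => e b; apply: le_trans (AH e b u0); rewrite A0 f10 f20 !addr0.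
have mHe e : measurable_fun setT (fun b : B1 * B2 => H ((e, b.2), b.1)).
  apply: (measurableT_comp mH); apply: measurable_fun_pair => //=.
  exact: measurable_fun_pair.
have mKe e : measurable_fun setT (fun b : B3 * B2 => K ((e, b.1), b.2)).
  apply: (measurableT_comp mK); apply: measurable_fun_pair => //=.
  exact: measurable_fun_pair.
have mGe e : measurable_fun setT (fun b : B3 * B4 => G (e, b)).
  exact: measurable_section.
exists (fun x => H ((x.1, x.2.2), x.2.1)); split.
- apply: (measurableT_comp mH); apply: measurable_fun_pair => /=.
    by apply: measurable_fun_pair => //; exact: measurableT_comp.
  exact: measurableT_comp.
- by move=> e b u; rewrite addrCA addrC -addrA [f2 u _ + _]addrC addrA addrAC; exact: AH.
- move=> e.
  rewrite (fubini_tonelli2 _ (mHe e))// (fubini_tonelli1 _ (mGe e))//.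
  apply: (@le_trans _ _ (\int[Q2]_y \int[Q3]_x K ((e, x), y))%E).
    apply: ge0_le_integral => //.
    + by move=> y _; apply: integral_ge0.
    + exact: (measurable_fun_fubini_tonelli_G _ (mHe e)).
    + exact: (measurable_fun_fubini_tonelli_G _ (mKe e)).
    + by move=> y _; exact: HK (e, y).
  rewrite -(fubini_tonelli _ (mKe e))//.
  apply: ge0_le_integral => //.
  + by move=> y _; apply: integral_ge0.
  + exact: (measurable_fun_fubini_tonelli_F _ (mKe e)).
  + exact: (measurable_fun_fubini_tonelli_F _ (mGe e)).
  + by move=> y _; exact: KG (e, y).
Qed.

End products.

Definition tuple_sum {B : Type} (f : U -> B -> R) n (u : U) (w : n.-tuple B) : R :=
  \sum_(i < n) f u (tnth w i).

Lemma tuple_sum0 {B : Type} (f : U -> B -> R) n (w : n.-tuple B) :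
  (forall b, f u0 b = 0) -> tuple_sum f u0 w = 0.
Proof. by move=> f0; rewrite /tuple_sum big1. Qed.

Lemma tuple_sumS {B : Type} (f : U -> B -> R) n u (w : n.+1.-tuple B) :
  tuple_sum f u w = f u (thead w) + tuple_sum f u [tuple of behead w].
Proof.
rewrite /tuple_sum big_ord_recl; congr (_ + _).
by apply: eq_bigr => i _; rewrite [in LHS](tuple_eta w) tnthS.
Qed.

Lemma tuple_sum_cons {d} {B : measurableType d} (f : U -> B -> R) n u
    (x : B * n.-tuple B) :
  tuple_sum f u (tuple_cons x) = f u x.1 + tuple_sum f u x.2.
Proof.
rewrite tuple_sumS /= theadE; congr (_ + tuple_sum _ _ _).
exact: val_inj.
Qed.

Lemma dominated_iid {d1 d2} {B1 : measurableType d1} {B2 : measurableType d2}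
    (Q1 : probability B1 R) (Q2 : probability B2 R)
    (f1 : U -> B1 -> R) (f2 : U -> B2 -> R) n :
  (forall b, f1 u0 b = 0) -> (forall b, f2 u0 b = 0) ->
  dominated Q1 f1 Q2 f2 ->
  dominated (iid_law Q1 n) (tuple_sum f1 (n:=n))
            (iid_law Q2 n) (tuple_sum f2 (n:=n)).
Proof.
move=> f10 f20 d12; elim: n => [|n IH].
  move=> dE E A G A0 mG AG.
  have sum0 (B : Type) (f : U -> B -> R) u (w : 0.-tuple B) : tuple_sum f u w = 0.
    by rewrite /tuple_sum big_ord0.
  exists (fun x => G (x.1, [tuple])); split.
  - by apply: (measurableT_comp mG); exact: measurable_fun_pair.
  - by move=> e b u; have := AG e [tuple] u; rewrite !sum0.
  - move=> e /=; rewrite integral_prob_cst.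
    rewrite (_ : (fun w => G (e, w)) = cst (G (e, [tuple]))); last first.
      by apply/funext => w; rewrite (tuple0 w).
    by rewrite integral_prob_cst.
pose g1 u (b : B1 * n.-tuple B1) := f1 u b.1 + tuple_sum f1 u b.2.
pose g2 u (b : B2 * n.-tuple B2) := f2 u b.1 + tuple_sum f2 u b.2.
have uncons : dominated (iid_law Q1 n.+1) (tuple_sum f1 (n:=n.+1))
    (Q1 \x iid_law Q1 n)%E g1.
  have := @dominated_preserving _ _ _ _ _ _ g1 _ _ (preserving_uncons Q1 n).
  rewrite (_ : (fun u b => _) = tuple_sum f1 (n:=n.+1)); last first.
    by apply/funext => u; apply/funext => w; rewrite tuple_sumS.
  by apply => b; rewrite /g1 f10 add0r tuple_sum0.
have cons : dominated (Q2 \x iid_law Q2 n)%E g2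
    (iid_law Q2 n.+1) (tuple_sum f2 (n:=n.+1)).
  have := @dominated_preserving _ _ _ _ _ _ (tuple_sum f2 (n:=n.+1)) _ _
    (preserving_cons Q2 n).
  rewrite (_ : (fun u b => _) = g2); last first.
    by apply/funext => u; apply/funext => x; rewrite tuple_sum_cons.
  by apply => b; exact: tuple_sum0.
apply: dominated_trans uncons (dominated_trans _ cons).
by apply: dominated_prod => // b; exact: tuple_sum0.
Qed.

End domination.

(** * Symmetrization, contraction and removal of signs *)

Definition signed {R : realType} {U B : Type} (f : U -> B -> R) (u : U)
    (w : B * bool) : R :=
  (-1) ^+ w.2 * f u w.1.

Section rademacher_domination.
Context {R : realType} {U : Type} (u0 : U).
Context {d : measure_display} {B : measurableType d} (Q : probability B R).
Implicit Types f : U -> B -> R.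

Lemma measurable_funS_bool {dE} {E : measurableType dE}
    (g h : E * B -> \bar R) :
  measurable_fun setT g -> measurable_fun setT h ->
  measurable_fun setT
    (fun x : E * (B * bool) => if x.2.2 then g (x.1, x.2.1) else h (x.1, x.2.1)).
Proof.
have mx : measurable_fun setT (fun x : E * (B * bool) => (x.1, x.2.1)).
  by apply: measurable_fun_pair => //; exact: measurableT_comp.
move=> mg mh; apply: measurable_fun_ifT.
- exact: measurableT_comp.
- exact: measurableT_comp mx.
- exact: measurableT_comp mx.
Qed.

Lemma measurable_fix_bool {dE} {E : measurableType dE}
    (G : E * (B * bool) -> \bar R) (s : bool) :
  measurable_fun setT G ->
  measurable_fun setT (fun x : E * B => G (x.1, (x.2, s))).
Proof.
move=> mG; apply: (measurableT_comp mG); apply: measurable_fun_pair => //.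
exact: measurable_fun_pair.
Qed.

(** No ghost sample is drawn: [A + f - E f] is the half sum of [A + 2 f] and [A - 2 E f]. The first
    lies below [G] at the positive sign; the second, being the mean of [A - 2 f], lies below the
    integral of [G] at the negative sign. The two halves together integrate to exactly the integral
    of [G]. *)
Lemma dominated_symmetrize f :
  (forall u, Q.-integrable setT (EFin \o f u)) -> (forall b, f u0 b = 0) ->
  dominated u0 Q (fun u b => f u b - \int[Q]_x f u x)%R
    (rademacher Q) (signed (fun u b => 2 * f u b)).
Proof.
move=> intf f0 dE E A G A0 mG AG.
have G0 : forall e, (0 <= G e)%E.
  by apply: (@majorant_ge0 _ _ u0 _ _ _ _ A _ (signed (fun u b => 2 * f u b)))
    => // b; rewrite /signed f0 !mulr0.
have h0 : (0 <= (2^-1 : R)%:E)%E by rewrite lee_fin invr_ge0.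
have mGs s := measurable_fix_bool s mG.
have mGes e s : measurable_fun setT (fun b => G (e, (b, s))).
  exact: (measurable_section (mGs s) e).
pose J e := (\int[Q]_b G (e, (b, true)))%E.
have mJ : measurable_fun setT J.
  exact: (measurable_fun_fubini_tonelli_F _ (mGs true)).
have J0 e : (0 <= J e)%E by exact: integral_ge0.
exists (fun x => (2^-1)%:E * G (x.1, (x.2, false)) + (2^-1)%:E * J x.1)%E; split.
- apply: emeasurable_funD; first exact: measurable_funeM.
  by apply: measurable_funeM; exact: measurableT_comp.
- move=> e b u /=.
  have fE : (\int[Q]_x (f u x)%:E)%E = (\int[Q]_x f u x)%R%:E.
    by rewrite /Rintegral fineK//; apply: integrable_fin_num (intf u).
  have -> : A e u + (f u b - \int[Q]_x f u x) =
      2^-1 * (A e u + 2 * f u b) + 2^-1 * (A e u - 2 * \int[Q]_x f u x)%R by lra.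
  rewrite EFinD; apply: leeD.
    rewrite EFinM; apply: lee_wpmul2l => //.
    by have := AG e (b, false) u; rewrite /signed /= expr0 mul1r.
  rewrite EFinM; apply: lee_wpmul2l => //.
  have intA : Q.-integrable setT (fun x => ((A e u)%:E - 2%:E * (f u x)%:E)%E).
    apply: integrableB => //; first exact: integrable_prob_cst.
    exact: (integrableZl measurableT 2 (intf u)).
  have -> : (A e u - 2 * \int[Q]_x f u x)%:E =
      (\int[Q]_x ((A e u)%:E - 2%:E * (f u x)%:E))%E.
    rewrite integralB//; last 2 first.
    - exact: integrable_prob_cst.
    - exact: (integrableZl measurableT 2 (intf u)).
    by rewrite integral_prob_cst integralZl ?fE//; exact: intf.
  apply: le_integral_ge0 => // b'.
  have := AG e (b', true) u.
  by rewrite /signed /= expr1 mulN1r.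
- move=> e; rewrite integral_rademacher//; last exact: measurable_section.
  rewrite /= ge0_integralD//; last 3 first.
  + by move=> x _; exact: mule_ge0.
  + exact: measurable_funeM.
  + by move=> x _; exact: mule_ge0.
  by rewrite integral_prob_cst ge0_integralZl// addeC.
Qed.

(** Let [a] and [c] be the values of the majorant at the two signs. From [A + f <= a] and
    [A - f <= c], the number [f] is within [mid - A] of [(a - c) / 2]; as [phi] is 1-Lipschitz,
    [phi f] is within [mid - A] of [dev]. So [mid + dev] and [mid - dev] are majorants for the two
    signs, and [dev] cancels in their average. The formula is explicit in [a] and [c], hence
    measurable, and selects no near-maximizers. *)
Lemma dominated_contraction f (phi : R -> R) :
  measurable_fun setT phi -> (forall x y, `|phi x - phi y| <= `|x - y|) ->
  phi 0 = 0 -> (forall b, f u0 b = 0) ->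
  dominated u0 (rademacher Q) (signed (fun u b => phi (f u b)))
    (rademacher Q) (signed f).
Proof.
move=> mphi lip phi0 f0 dE E A G A0 mG AG.
have G0 : forall e, (0 <= G e)%E.
  by apply: (@majorant_ge0 _ _ u0 _ _ _ _ A _ (signed f)) => // b;
    rewrite /signed f0 mulr0.
pose a (x : E * B) := G (x.1, (x.2, false)).
pose c (x : E * B) := G (x.1, (x.2, true)).
pose mid x := ((2^-1)%:E * (a x + c x))%E.
(* Where [a] or [c] is infinite, [fine] gives the default [0]; this is harmless because [mid] is
   then [+oo] and dominates whatever [dev] is. *)
pose dev x := (phi (2^-1 * (fine (a x) - fine (c x)))).
have ma : measurable_fun setT a by exact: measurable_fix_bool.
have mc : measurable_fun setT c by exact: measurable_fix_bool.
have mmid : measurable_fun setT mid.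
  by apply: measurable_funeM; exact: emeasurable_funD.
have mdev : measurable_fun setT dev.
  have mfine (g : E * B -> \bar R) : measurable_fun setT g ->
      measurable_fun setT (fun x => fine (g x)).
    by move=> mg; apply: (measurableT_comp _ mg); exact: fine_measurable.
  have mac : measurable_fun setT (fun x => fine (a x) - fine (c x)).
    by apply: measurable_funB; exact: mfine.
  exact: (measurableT_comp mphi (measurableT_comp (mulrl_measurable _) mac)).
pose H (x : E * (B * bool)) := (if x.2.2 then mid (x.1, x.2.1) - (dev (x.1, x.2.1))%:E
  else mid (x.1, x.2.1) + (dev (x.1, x.2.1))%:E)%E.
have mH : measurable_fun setT H.
  apply: (@measurable_funS_bool _ _ (fun x => mid x - (dev x)%:E)%E
    (fun x => mid x + (dev x)%:E)%E).
  - by apply: emeasurable_funB => //; exact/measurable_EFinP.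
  - by apply: emeasurable_funD => //; exact/measurable_EFinP.
have AH e w u : ((A e u + signed (fun u b => phi (f u b)) u w)%:E <= H (e, w))%E.
  case: w => b s.
  have Aa : ((A e u + f u b)%:E <= a (e, b))%E.
    by have := AG e (b, false) u; rewrite /signed /= expr0 mul1r.
  have Ac : ((A e u - f u b)%:E <= c (e, b))%E.
    by have := AG e (b, true) u; rewrite /signed /= expr1 mulN1r.
  have a0 : (0 <= a (e, b))%E by exact: G0.
  have c0 : (0 <= c (e, b))%E by exact: G0.
  rewrite /H /mid /dev /signed /=.
  move: (a _) (c _) Aa Ac a0 c0 => [x| |] [y| |] //=; last first.
  - by move=> _ _ _ _; case: s; rewrite gt0_muley ?lte_fin ?invr_gt0// addye// leey.
  - by move=> _ _ _ _; case: s; rewrite gt0_muley ?lte_fin ?invr_gt0// addye// leey.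
  - by move=> _ _ _ _; case: s; rewrite gt0_muley ?lte_fin ?invr_gt0// addye// leey.
  rewrite !lee_fin => Ax Ay _ _.
  have := lip (f u b) (2^-1 * (x - y)); rewrite ler_norml => /andP[].
  have := ler_norm (f u b - 2^-1 * (x - y)).
  have [|] := lerP 0 (f u b - 2^-1 * (x - y)) => h.
    by rewrite (ger0_norm h) => _ p q; case: s; rewrite ?expr0 ?expr1 lee_fin; lra.
  by rewrite (ltr0_norm h) => _ p q; case: s; rewrite ?expr0 ?expr1 lee_fin; lra.
exists H; split => // e.
have H0 w : (0 <= H (e, w))%E.
  apply: le_trans (AH e w u0).
  by rewrite A0 /signed f0 phi0 mulr0 addr0.
have mHe := measurable_section mH e.
have mHs s : measurable_fun setT (fun b => H (e, (b, s))).
  by apply: (measurableT_comp mHe); exact: measurable_fun_pair.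
have mGs s : measurable_fun setT (fun b => G (e, (b, s))).
  by apply: (measurableT_comp (measurable_section mG e)); exact: measurable_fun_pair.
rewrite !integral_rademacher//; last exact: measurable_section.
rewrite -!ge0_muleDr; try exact: integral_ge0.
apply: lee_wpmul2l; first by rewrite lee_fin invr_ge0.
rewrite -!ge0_integralD//.
apply: ge0_le_integral => //.
- by move=> b _; exact: adde_ge0.
- exact: emeasurable_funD.
- exact: emeasurable_funD.
move=> b _; rewrite /H /= /mid.
have := G0 (e, (b, true)); have := G0 (e, (b, false)).
rewrite -/(a (e, b)) -/(c (e, b)).
move: (dev _) (a _) (c _) => D [x| |] [y| |] //= _ _; rewrite ?leey// lee_fin; lra.
Qed.

(** Given its sign, the signed process is [f] or [- f], and each has a majorant of the right
    integral. This removes the sign carried by a whole block, once its points have symmetric signs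
    of their own. *)
Lemma dominated_signed f {d'} {C : measurableType d'} (P : probability C R)
    (g : U -> C -> R) :
  (forall b, f u0 b = 0) -> (forall b, g u0 b = 0) ->
  dominated u0 Q f P g -> dominated u0 Q (fun u b => - f u b) P g ->
  dominated u0 (rademacher Q) (signed f) P g.
Proof.
move=> f0 g0 dp dn dE E A G A0 mG AG.
have [H [mH AH HG]] := dp _ _ _ _ A0 mG AG.
have [K [mK AK KG]] := dn _ _ _ _ A0 mG AG.
pose L (x : E * (B * bool)) := if x.2.2 then K (x.1, x.2.1) else H (x.1, x.2.1).
have mL : measurable_fun setT L by exact: measurable_funS_bool.
have AL e w u : ((A e u + signed f u w)%:E <= L (e, w))%E.
  by case: w => b []; rewrite /L /signed /= ?expr0 ?expr1 ?mul1r ?mulN1r.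
exists L; split => // e; rewrite integral_rademacher; last 2 first.
- exact: measurable_section.
- move=> w; apply: le_trans (AL e w u0).
  by rewrite A0 /signed f0 mulr0 addr0.
have G0 w : (0 <= G (e, w))%E.
  by apply: le_trans (AG e w u0); rewrite A0 g0 addr0.
have half (x : \bar R) : (0 <= x)%E -> ((2^-1)%:E * x + (2^-1)%:E * x = x)%E.
  move=> x0; rewrite -ge0_muleDl ?lee_fin ?invr_ge0// -EFinD -[RHS]mul1e.
  by congr (_%:E * _)%E; lra.
rewrite -[leRHS]half; last exact: integral_ge0.
apply: leeD; apply: lee_wpmul2l; rewrite ?lee_fin ?invr_ge0//.
- exact: KG.
- exact: HG.
Qed.

End rademacher_domination.

(** * Cutting a sample into independent blocks *)

Section blocks.
Context {R : realType} {d : measure_display} {Z : measurableType d}.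

Definition blocks (N n m l : nat) (e : (n * m + l)%N = N) (z : N.-tuple Z) :
    n.-tuple (m.-tuple Z) :=
  [tuple [tuple tnth z (cast_ord e (lshift l (mxvec_index j i))) | i < m]
    | j < n].

(** The law is computed in this direction, because a box pulls back along [unblock] to a product of
    boxes. [blocks] then undoes it and forgets the [l] leftover points. [mxvec_index] numbers the
    pairs (block, position). *)
Definition unblock (n m l : nat) (x : n.-tuple (m.-tuple Z) * l.-tuple Z) :
    (n * m + l).-tuple Z :=
  [tuple match fintype.split k with
    | inl k => let ji := enum_val (cast_ord (esym (mxvec_cast n m)) k) in
               tnth (tnth x.1 ji.1) ji.2
    | inr k => tnth x.2 k
    end | k < n * m + l].

Lemma tnth_unblock_l n m l (x : n.-tuple (m.-tuple Z) * l.-tuple Z) j i :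
  tnth (unblock x) (lshift l (mxvec_index j i)) = tnth (tnth x.1 j) i.
Proof.
rewrite tnth_mktuple; case: split_ordP => [k /lshift_inj <-|k /esym/eqP]; last first.
  by rewrite eq_rlshift.
by rewrite cast_ordK enum_rankK.
Qed.

Lemma tnth_unblock_r n m l (x : n.-tuple (m.-tuple Z) * l.-tuple Z) k :
  tnth (unblock x) (rshift (n * m) k) = tnth x.2 k.
Proof.
rewrite tnth_mktuple; case: split_ordP => [i /esym/eqP|i /rshift_inj <-//].
by rewrite eq_lrshift.
Qed.

Lemma blocksK n m l (x : n.-tuple (m.-tuple Z) * l.-tuple Z) :
  blocks erefl (unblock x) = x.1.
Proof.
apply: eq_from_tnth => j; rewrite tnth_mktuple; apply: eq_from_tnth => i.
by rewrite tnth_mktuple cast_ord_id tnth_unblock_l.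
Qed.

Lemma big_mxvec_index (S : Type) (idx : S) (op : Monoid.com_law idx) n m
    (F : 'I_(n * m) -> S) :
  \big[op/idx]_(k < n * m) F k =
  \big[op/idx]_(j < n) \big[op/idx]_(i < m) F (mxvec_index j i).
Proof.
rewrite pair_big /= (reindex _ (curry_mxvec_bij n m)) /=.
by apply: eq_bigr => -[j i] _.
Qed.

Lemma measurable_unblock n m l :
  measurable_fun [set: n.-tuple (m.-tuple Z) * l.-tuple Z] (@unblock n m l).
Proof.
apply/measurable_fun_tnthP => k.
case: (split_ordP k) => [k' ->|k' ->].
  case/mxvec_indexP: k' => j i.
  rewrite (_ : _ \o _ = (fun t => tnth t i) \o ((fun t => tnth t j) \o fst)).
    apply: measurableT_comp; first exact: measurable_tnth.
    by apply: measurableT_comp => //; exact: measurable_tnth.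
  by apply/funext => x /=; rewrite tnth_unblock_l.
rewrite (_ : _ \o _ = (fun t => tnth t k') \o snd).
  by apply: measurableT_comp => //; exact: measurable_tnth.
by apply/funext => x /=; rewrite tnth_unblock_r.
Qed.

Lemma measurable_blocks (N n m l : nat) (e : (n * m + l)%N = N) :
  measurable_fun [set: N.-tuple Z] (blocks e).
Proof.
apply/measurable_fun_tnthP => j; apply/measurable_fun_tnthP => i.
rewrite (_ : _ \o _ = fun t => tnth t (cast_ord e (lshift l (mxvec_index j i)))).
  exact: measurable_tnth.
by apply/funext => x /=; rewrite !tnth_mktuple.
Qed.

Variable P : probability Z R.

Lemma preserving_unblock n m l :
  measure_preserving (iid_law (iid_law P m) n \x iid_law P l)%E
    (iid_law P (n * m + l)) (@unblock n m l).
Proof.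
apply: preserving_iid => [|B mB]; first exact: measurable_unblock.
pose C j : set (m.-tuple Z) :=
  [set t | forall i, B (lshift l (mxvec_index j i)) (tnth t i)].
have mC j : measurable (C j).
  exact: (@measurable_rectangle _ _ _ (fun i => B (lshift l (mxvec_index j i)))).
pose D : set (n.-tuple (m.-tuple Z)) := [set b | forall j, C j (tnth b j)].
have mD : measurable D by exact: measurable_rectangle.
pose D' : set (l.-tuple Z) :=
  [set t | forall k, B (rshift (n * m) k) (tnth t k)].
have mD' : measurable D'.
  exact: (@measurable_rectangle _ _ _ (fun k => B (rshift (n * m) k))).
rewrite (_ : [set _ | _] = D `*` D'); last first.
  apply/seteqP; split => x /=.
    move=> Bx; split => [j i|k].
      by have := Bx (lshift l (mxvec_index j i)); rewrite tnth_unblock_l.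
    by have := Bx (rshift (n * m) k); rewrite tnth_unblock_r.
  move=> [Dx D'x] k; case: (split_ordP k) => [k' ->|k' ->].
    by case/mxvec_indexP: k' => j i; rewrite tnth_unblock_l; exact: Dx.
  by rewrite tnth_unblock_r; exact: D'x.
rewrite [LHS](product_measure1E _ _ mD mD') big_split_ord; congr (_ * _)%E.
  apply: etrans (iid_lawE _ mC) _; rewrite big_mxvec_index.
  by apply: eq_bigr => j _; exact: iid_lawE.
exact: iid_lawE.
Qed.

Lemma preserving_blocks (N n m l : nat) (e : (n * m + l)%N = N) :
  measure_preserving (iid_law P N) (iid_law (iid_law P m) n) (blocks e).
Proof.
split=> [|A mA]; first exact: measurable_blocks.
case: _ / e; have [_ PQ] := preserving_unblock n m l.
rewrite -PQ; last by rewrite -[X in measurable X]setTI; exact: measurable_blocks.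
have [_ <-//] := preserving_fst (iid_law (iid_law P m) n) (iid_law P l).
congr product_measure1; apply/seteqP; split => x /=; rewrite blocksK//.
Qed.

End blocks.

(** * Discarding the leftover sample points *)

Section drop.
Context {R : realType} {U : Type} (u0 : U).

(** Jensen's inequality in terms of majorants: adding [f] to an offset cannot lower the expected
    supremum. Signed processes have this property since their two signs average to zero. *)
Definition dominates0 {d} {B : measurableType d} (Q : probability B R)
    (f : U -> B -> R) : Prop :=
  forall (A : U -> R) (G : B -> \bar R), A u0 = 0 -> measurable_fun setT G ->
    (forall u w, ((A u + f u w)%:E <= G w)%E) ->
    forall u, ((A u)%:E <= \int[Q]_w G w)%E.

Lemma dominates0_signed {d} {B : measurableType d} (Q : probability B R)
    (f : U -> B -> R) :
  (forall b, f u0 b = 0) -> dominates0 (rademacher Q) (signed f).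
Proof.
move=> f0 A G A0 mG AG u.
have G0 w : (0 <= G w)%E.
  by apply: le_trans (AG u0 w); rewrite A0 /signed f0 mulr0 addr0.
have mGs s : measurable_fun setT (fun b => G (b, s)).
  by apply: (measurableT_comp mG); exact: measurable_fun_pair.
rewrite integral_rademacher// -!ge0_integralZl ?lee_fin ?invr_ge0//.
rewrite -ge0_integralD//; last 4 first.
- by move=> x _; apply: mule_ge0 => //; rewrite lee_fin invr_ge0.
- exact: measurable_funeM.
- by move=> x _; apply: mule_ge0 => //; rewrite lee_fin invr_ge0.
- exact: measurable_funeM.
rewrite -[leLHS](integral_prob_cst Q).
apply: le_integral_ge0 => //.
- exact: integrable_prob_cst.
- by apply: emeasurable_funD; exact: measurable_funeM.
- by move=> x; apply: adde_ge0; apply: mule_ge0 => //; rewrite lee_fin invr_ge0.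
move=> b; have -> : A u = 2^-1 * (A u - f u b) + 2^-1 * (A u + f u b) by lra.
rewrite EFinD; apply: leeD; rewrite EFinM; apply: lee_wpmul2l;
  rewrite ?lee_fin ?invr_ge0//.
- by have := AG u (b, true); rewrite /signed /= expr1 mulN1r.
- by have := AG u (b, false); rewrite /signed /= expr0 mul1r.
Qed.

Lemma dominates0_prod {d1 d2} {B1 : measurableType d1} {B2 : measurableType d2}
    (Q1 : probability B1 R) (Q2 : probability B2 R)
    (f1 : U -> B1 -> R) (f2 : U -> B2 -> R) :
  (forall b, f1 u0 b = 0) -> (forall b, f2 u0 b = 0) ->
  dominates0 Q1 f1 -> dominates0 Q2 f2 ->
  dominates0 (Q1 \x Q2)%E (fun u b => f1 u b.1 + f2 u b.2).
Proof.
move=> f10 f20 d1' d2' A G A0 mG AG u.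
have G0 w : (0 <= G w)%E.
  by apply: le_trans (AG u0 w); rewrite A0 f10 f20 !addr0.
rewrite (fubini_tonelli1 _ mG)//.
apply: d1' => //; first exact: (measurable_fun_fubini_tonelli_F _ mG).
move=> v w; apply: (d2' (fun u => A u + f1 u w)).
- by rewrite A0 f10 addr0.
- exact: measurable_section.
- by move=> u' w'; rewrite -addrA; exact: AG.
Qed.

Lemma dominates0_iid {d} {B : measurableType d} (Q : probability B R)
    (f : U -> B -> R) n :
  (forall b, f u0 b = 0) -> dominates0 Q f ->
  dominates0 (iid_law Q n) (tuple_sum f (n:=n)).
Proof.
move=> f0 df; elim: n => [|n IH] A G A0 mG AG u.
  rewrite (_ : G = cst (G [tuple])); last by apply/funext => w; rewrite (tuple0 w).
  rewrite integral_prob_cst.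
  by have := AG u [tuple]; rewrite /tuple_sum big_ord0 addr0.
have G0 w : (0 <= G w)%E.
  by apply: le_trans (AG u0 w); rewrite A0 (tuple_sum0 _ f0) addr0.
rewrite (preserving_integral (preserving_cons Q n))//.
apply: (@dominates0_prod _ _ _ _ Q (iid_law Q n) f (tuple_sum f (n:=n))) => //.
- by move=> b; exact: (tuple_sum0 _ f0).
- by apply: (measurableT_comp mG); exact: tuple_cons_measurable.
by move=> v x; have := AG v (tuple_cons x); rewrite tuple_sum_cons.
Qed.

Lemma dominated_drop {d1 d2} {B1 : measurableType d1} {B2 : measurableType d2}
    (Q1 : probability B1 R) (Q2 : probability B2 R)
    (f1 : U -> B1 -> R) (f2 : U -> B2 -> R) :
  (forall b, f1 u0 b = 0) -> (forall b, f2 u0 b = 0) ->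
  dominates0 Q2 f2 ->
  dominated u0 Q1 f1 (Q1 \x Q2)%E (fun u b => f1 u b.1 + f2 u b.2).
Proof.
move=> f10 f20 df2 dE E A G A0 mG AG.
have G0 e w : (0 <= G (e, w))%E.
  by apply: le_trans (AG e w u0); rewrite A0 f10 f20 !addr0.
have mG' : measurable_fun setT (fun x : (E * B1) * B2 => G (x.1.1, (x.1.2, x.2))).
  apply: (measurableT_comp mG); apply: measurable_fun_pair => /=.
    exact: measurableT_comp.
  by apply: measurable_fun_pair => //; exact: measurableT_comp.
exists (fun x => \int[Q2]_w G (x.1, (x.2, w)))%E; split.
- exact: (measurable_fun_fubini_tonelli_F _ mG').
- move=> e b u.
  apply: (df2 (fun u => A e u + f1 u b)).
  + by rewrite A0 f10 addr0.
  + exact: (measurable_section mG' (e, b)).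
  + by move=> v w; rewrite -addrA; exact: AG.
- by move=> e; rewrite (fubini_tonelli1 _ (measurable_section mG e)).
Qed.

(** Needed because the block size rarely divides [N], whereas the complexity parameters speak of all
    [N] points: the [l] leftover terms are added on the right by [dominated_drop]. *)
Lemma dominated_blocks {d} {B : measurableType d} (Q : probability B R)
    (f : U -> B -> R) (N n m l : nat) :
  (n * m + l)%N = N -> (forall b, f u0 b = 0) -> dominates0 Q f ->
  dominated u0 (iid_law (iid_law Q m) n)
    (tuple_sum (tuple_sum f (n:=m)) (n:=n)) (iid_law Q N) (tuple_sum f (n:=N)).
Proof.
move=> <- f0 df.
have s0 k (w : k.-tuple B) : tuple_sum f u0 w = 0 by exact: tuple_sum0.
have ss0 (w : n.-tuple (m.-tuple B)) :
    tuple_sum (tuple_sum f (n:=m)) u0 w = 0.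
  by apply: tuple_sum0; exact: s0.
have drop := dominated_drop (iid_law (iid_law Q m) n) ss0 (s0 l)
  (@dominates0_iid _ _ Q f l f0 df).
apply: dominated_trans drop _.
have := dominated_preserving (s0 (n * m + l)%N) (preserving_unblock Q n m l).
congr (dominated _ _ _ _ _); apply/funext => u; apply/funext => x.
rewrite /tuple_sum big_split_ord big_mxvec_index /=; congr (_ + _).
  apply: eq_bigr => j _; apply: eq_bigr => i _.
  by rewrite tnth_unblock_l.
by apply: eq_bigr => i _; rewrite tnth_unblock_r.
Qed.

End drop.

(** * Bounded differences for functions with a measurable majorant *)

Section exponential_moment.
Context {R : realType}.

(** Obtained by squaring [exp (x / 2) <= 1 / (1 - x / 2)]. After clearing the denominator, the sign
    of the remainder is that of [(1 - 4 x) + x (1 + x)], whence the range [x <= 1 / 4]. *)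
Lemma expR_le_quadratic (x : R) : x <= 1 / 4 -> expR x <= 1 + x + x ^+ 2.
Proof.
move=> x4.
have h0 : 0 < 1 - x / 2 by lra.
have e2 : expR (x / 2) <= (1 - x / 2)^-1.
  have -> : expR (x / 2) = (expR (- (x / 2)))^-1 by rewrite expRN invrK.
  rewrite lef_pV2 ?posrE ?expR_gt0//.
  by have := expR_ge1Dx (- (x / 2)); lra.
have -> : expR x = expR (x / 2) ^+ 2.
  by rewrite -expRM_natl; congr expR; lra.
apply: (@le_trans _ _ ((1 - x / 2)^-1 ^+ 2)).
  by rewrite lerXn2r ?nnegrE ?expR_ge0// invr_ge0 ltW.
rewrite exprVn -[leLHS]div1r ler_pdivrMr ?exprn_gt0//.
have -> : (1 + x + x ^+ 2) * (1 - x / 2) ^+ 2 =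
  1 + x ^+ 2 / 4 * ((1 - 4 * x) + x * (1 + x)) by field.
have [x0|x0] := lerP 0 x.
  by rewrite lerDl mulr_ge0 ?divr_ge0 ?sqr_ge0// addr_ge0 ?mulr_ge0//; lra.
rewrite lerDl mulr_ge0 ?divr_ge0 ?sqr_ge0//.
have -> : 1 - 4 * x + x * (1 + x) = 1 - 3 * x + x ^+ 2 by ring.
by rewrite addr_ge0 ?sqr_ge0//; lra.
Qed.

Lemma sqr_le_expR (x : R) : 0 <= x -> x ^+ 2 <= 2 * expR x.
Proof.
move=> x0; have := expR_ge1Dxn 1 x0.
by rewrite (_ : 2`!%:R = 2 :> R)// => h; lra.
Qed.

Lemma mul_expRN_le (x : R) : x * expR (- x) <= 1 - expR (- x).
Proof.
have := expR_ge1Dx x; have := expR_gt0 (- x); have := expRxMexpNx_1 x.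
move: (expR x) (expR (- x)) => a b ab b0 h.
have : (1 + x) * b <= a * b by rewrite ler_pM2r.
lra.
Qed.

Context {d : measure_display} {B : measurableType d} (Q : probability B R).

Lemma bounded_integrable (f : B -> R) (K : R) :
  measurable_fun setT f -> (forall b, `|f b| <= K) ->
  Q.-integrable setT (EFin \o f).
Proof.
move=> mf fK; apply: measurable_bounded_integrable => //.
  by rewrite [X in (X < _)%E](probability_setT Q) ltry.
exists K; split; first by rewrite num_real.
by move=> M KM b _; apply: le_trans (fK b) (ltW KM).
Qed.

Lemma integrable_add (f g : B -> R) : Q.-integrable setT (EFin \o f) ->
  Q.-integrable setT (EFin \o g) ->
  Q.-integrable setT (EFin \o (fun b => f b + g b)).
Proof. by move=> intf intg; exact: (integrableD measurableT intf intg). Qed.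

Lemma integrable_scale (k : R) (f : B -> R) : Q.-integrable setT (EFin \o f) ->
  Q.-integrable setT (EFin \o (fun b => k * f b)).
Proof. by move=> intf; exact: (integrableZl measurableT k intf). Qed.

Lemma integrable_cst (r : R) : Q.-integrable setT (EFin \o (fun=> r)).
Proof. exact: integrable_prob_cst. Qed.

Lemma EFin_Rintegral (f : B -> R) : Q.-integrable setT (EFin \o f) ->
  (\int[Q]_b f b)%R%:E = (\int[Q]_b (f b)%:E)%E.
Proof. by move=> intf; rewrite /Rintegral fineK//; exact: integrable_fin_num. Qed.

Lemma Rintegral_prob_cst (r : R) : (\int[Q]_b r)%R = r.
Proof. by rewrite /Rintegral integral_prob_cst. Qed.

Lemma measurable_Rintegral {dE} {E : measurableType dE} (g : E * B -> R) :
  measurable_fun setT g -> (forall x, 0 <= g x) ->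
  measurable_fun setT (fun e => \int[Q]_b g (e, b))%R.
Proof.
move=> mg g0.
have := @measurable_fun_fubini_tonelli_F _ _ _ _ _ Q (EFin \o g).
move=> /(_ _ _)/= mF.
apply: (measurableT_comp (@fine_measurable R setT measurableT)).
apply: mF; first exact/measurable_EFinP.
by move=> x; rewrite lee_fin.
Qed.

(* Tilting [Q] by [expR (- g)] brings the mean of [g] below
   [- ln (\int expR (- g))], the reference level from which the truncated
   exponential moment is expanded. *)
Lemma integral_expR_min (g : B -> R) (K lam : R) :
  measurable_fun setT g -> (forall b, 0 <= g b <= K) -> 0 <= lam <= 1 / 4 ->
  let w := (\int[Q]_b expR (- g b))%R in
  let t := (\int[Q]_b (expR (- g b) * g b))%R / w in
  0 < w /\
  (\int[Q]_b expR (lam * Num.min (g b) (1 + t)) <=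
    expR (lam * \int[Q]_b g b + 3 * lam ^+ 2))%R.
Proof.
move=> mg g0K /andP[lam0 lam4] w t.
have mexp : measurable_fun setT (fun b => expR (- g b)).
  by apply: measurableT_comp => //; exact: measurableT_comp.
have exp1 b : `|expR (- g b)| <= 1.
  by rewrite ger0_norm ?expR_ge0// expR_le1; have /andP[] := g0K b; lra.
have intexp : Q.-integrable setT (EFin \o (fun b => expR (- g b))).
  exact: bounded_integrable mexp exp1.
have intg : Q.-integrable setT (EFin \o g).
  apply: (@bounded_integrable _ K) => // b.
  by have /andP[h1 h2] := g0K b; rewrite ger0_norm.
have w0 : 0 < w.
  apply: (@lt_le_trans _ _ (expR (- K))); first exact: expR_gt0.
  rewrite -[leLHS]Rintegral_prob_cst; apply: le_Rintegral => //.
  - exact: integrable_prob_cst.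
  - by move=> b _; rewrite ler_expR lerN2; have /andP[] := g0K b.
split=> //.
pose gam := - ln w.
have egam : expR gam = w^-1 by rewrite expRN lnK.
have gamw : expR gam * w = 1 by rewrite egam mulVf ?gt_eqF.
have intge : Q.-integrable setT (EFin \o (fun b => expR (- g b) * g b)).
  apply: (@bounded_integrable _ K); first exact: measurable_funM.
  move=> b; rewrite normrM -[K]mul1r; apply: ler_pM => //.
  by have /andP[h1 h2] := g0K b; rewrite ger0_norm.
(* Integrate [x e^(-x) <= 1 - e^(-x)] at [x = g - gam]: since [e^(gam - g)] has mean one, the right
   side has mean zero. *)
have tgam : t <= gam.
  rewrite /t ler_pdivrMr//.
  suff: (\int[Q]_b (expR (- g b) * g b) <=
      \int[Q]_b (w + (gam - 1) * expR (- g b)))%R.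
    rewrite RintegralD//; last 2 first.
    - exact: integrable_prob_cst.
    - exact: integrable_scale.
    rewrite Rintegral_prob_cst RintegralZl// -/w; lra.
  apply: le_Rintegral => //.
    by apply: integrable_add; [exact: integrable_cst|exact: integrable_scale].
  move=> b _; have := mul_expRN_le (g b - gam).
  have -> : expR (- (g b - gam)) = w^-1 * expR (- g b).
    by rewrite opprB expRD egam.
  move=> h.
  have : w * ((g b - gam) * (w^-1 * expR (- g b))) <=
      w * (1 - w^-1 * expR (- g b)) by rewrite ler_pM2l.
  have -> : w * ((g b - gam) * (w^-1 * expR (- g b))) = (g b - gam) * expR (- g b).
    by field; rewrite gt_eqF.
  have -> : w * (1 - w^-1 * expR (- g b)) = w - expR (- g b).
    by field; rewrite gt_eqF.
  lra.
(* With [f = g - gam] and [V = min (f, 1)], this is [exp (lam gam)] times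
   [1 + lam f + lam^2 (1 + 2 exp (- f))]. It comes from [V^2 <= 1] when [V >= 0] and
   [V^2 <= 2 exp (- f)] when [V < 0]. As [exp (- f)] has mean one, the quadratic part integrates to
   [3 lam^2]. *)
pose bound b := expR (lam * gam) * ((1 - lam * gam + lam ^+ 2) +
  (lam * g b + 2 * lam ^+ 2 * expR gam * expR (- g b))).
have le_bound b : expR (lam * Num.min (g b) (1 + t)) <= bound b.
  pose f := g b - gam; pose V := Num.min f 1.
  have V1 : V <= 1 by rewrite ge_min lexx orbT.
  have Vf : V <= f by rewrite ge_min lexx.
  have -> : bound b = expR (lam * gam) *
      (1 + lam * f + lam ^+ 2 * (1 + 2 * expR (- f))).
    by rewrite /bound /f opprB expRD; ring.
  apply: (@le_trans _ _ (expR (lam * gam) * expR (lam * V))).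
    rewrite -expRD ler_expR -mulrDr ler_wpM2l//.
    rewrite ge_min /V; have [_|_] := leP f 1; apply/orP.
      by left; rewrite /f addrC subrK.
    by right; rewrite addrC lerD2r.
  rewrite ler_pM2l ?expR_gt0//.
  apply: le_trans (expR_le_quadratic _) _.
    by apply: le_trans (ler_wpM2l lam0 V1) _; rewrite mulr1.
  have := ler_wpM2l lam0 Vf.
  suff : (lam * V) ^+ 2 <= lam ^+ 2 * (1 + 2 * expR (- f)) by lra.
  rewrite exprMn ler_wpM2l ?sqr_ge0//.
  have [f0|f0] := lerP 0 V.
    apply: (@le_trans _ _ 1); first by rewrite expr_le1.
    by have := expR_ge0 (- f); lra.
  have Ve : V = f.
    by move: f0; rewrite /V /Num.min; case: ifP => // _; lra.
  rewrite Ve -[f ^+ 2]sqrrN; apply: le_trans (sqr_le_expR _) _; lra.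
have intb : Q.-integrable setT (EFin \o bound).
  apply: integrable_scale; apply: integrable_add; first exact: integrable_cst.
  by apply: integrable_add; exact: integrable_scale.
apply: (@le_trans _ _ (\int[Q]_b bound b)%R).
  apply: le_Rintegral => //.
  apply: (@bounded_integrable _ (expR (lam * K))).
    apply: measurableT_comp => //.
    apply: (measurableT_comp (mulrl_measurable _)).
    exact: measurable_minr.
  move=> b; rewrite ger0_norm ?expR_ge0// ler_expR ler_wpM2l// ge_min.
  by have /andP[_ ->] := g0K b.
have int2 : Q.-integrable setT (EFin \o
    (fun b => lam * g b + 2 * lam ^+ 2 * expR gam * expR (- g b))).
  by apply: integrable_add; exact: integrable_scale.
rewrite /bound RintegralZl//; last first.
  by apply: integrable_add; first exact: integrable_cst.
rewrite RintegralD//; last exact: integrable_prob_cst.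
rewrite Rintegral_prob_cst RintegralD//; last 2 first.
- exact: integrable_scale.
- exact: integrable_scale.
rewrite !RintegralZl// -/w -mulrA gamw mulr1.
have -> : lam * (\int[Q]_b g b)%R + 3 * lam ^+ 2 =
    lam * gam + (lam * ((\int[Q]_b g b)%R - gam) + 3 * lam ^+ 2) by ring.
rewrite [leRHS]expRD ler_pM2l ?expR_gt0//; apply: le_trans (expR_ge1Dx _).
lra.
Qed.

End exponential_moment.

Section bounded_fubini.
Context {R : realType}.

Lemma Rintegral_itv {d} {B : measurableType d} (Q : probability B R)
    (f : B -> R) (K : R) :
  measurable_fun setT f -> (forall b, 0 <= f b <= K) ->
  0 <= (\int[Q]_b f b)%R <= K.
Proof.
move=> mf fK; apply/andP; split.
  by apply: Rintegral_ge0 => b _; have /andP[] := fK b.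
rewrite -[leRHS](Rintegral_prob_cst Q); apply: le_Rintegral => //.
- apply: (@bounded_integrable _ _ _ _ _ K) => // b.
  by have /andP[f0 f1] := fK b; rewrite ger0_norm.
- exact: integrable_prob_cst.
- by move=> b _; have /andP[] := fK b.
Qed.

Context {d1 d2 : measure_display} {B1 : measurableType d1}
  {B2 : measurableType d2}.
Variables (Q1 : probability B1 R) (Q2 : probability B2 R).

Lemma itv_integrable {d} {B : measurableType d} (Q : probability B R)
    (f : B -> R) (K : R) :
  measurable_fun setT f -> (forall b, 0 <= f b <= K) ->
  Q.-integrable setT (EFin \o f).
Proof.
move=> mf fK; apply: (@bounded_integrable _ _ _ _ _ K) => // b.
by have /andP[f0 f1] := fK b; rewrite ger0_norm.
Qed.

Lemma Rintegral_fubini (f : B1 * B2 -> R) (K : R) :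
  measurable_fun setT f -> (forall b, 0 <= f b <= K) ->
  (\int[(Q1 \x Q2)%E]_b f b = \int[Q1]_x \int[Q2]_y f (x, y))%R /\
  (\int[Q1]_x \int[Q2]_y f (x, y) = \int[Q2]_y \int[Q1]_x f (x, y))%R.
Proof.
move=> mf fK.
have m1 x : measurable_fun setT (fun y => f (x, y)) by exact: measurableT_comp.
have m2 y : measurable_fun setT (fun x => f (x, y)) by exact: measurableT_comp.
have mF1 : measurable_fun setT (fun x => \int[Q2]_y f (x, y))%R.
  by apply: measurable_Rintegral => // b; have /andP[] := fK b.
have mF2 : measurable_fun setT (fun y => \int[Q1]_x f (x, y))%R.
  apply: (@measurable_Rintegral _ _ _ Q1 _ _ (fun b => f (b.2, b.1))).
    by apply: (measurableT_comp mf); exact: measurable_fun_pair.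
  by move=> b; have /andP[] := fK (b.2, b.1).
have iF1 : Q1.-integrable setT (EFin \o (fun x => \int[Q2]_y f (x, y))%R).
  by apply: (@itv_integrable _ _ _ _ K) => // x; apply: Rintegral_itv.
have iF2 : Q2.-integrable setT (EFin \o (fun y => \int[Q1]_x f (x, y))%R).
  by apply: (@itv_integrable _ _ _ _ K) => // y; apply: Rintegral_itv.
have mEf : measurable_fun setT (fun b => (f b)%:E) by exact/measurable_EFinP.
have f0 b : (0 <= (f b)%:E)%E by rewrite lee_fin; have /andP[] := fK b.
have E1 : (\int[Q1]_x (\int[Q2]_y f (x, y))%R%:E =
    \int[Q1]_x \int[Q2]_y (f (x, y))%:E)%E.
  apply: eq_integral => x _; rewrite EFin_Rintegral//.
  exact: (@itv_integrable _ _ _ _ K).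
have E2 : (\int[Q2]_y (\int[Q1]_x f (x, y))%R%:E =
    \int[Q2]_y \int[Q1]_x (f (x, y))%:E)%E.
  apply: eq_integral => x _; rewrite EFin_Rintegral//.
  exact: (@itv_integrable _ _ _ _ K).
split; apply: EFin_inj.
  have intf := @itv_integrable _ _ (Q1 \x Q2)%E f K mf fK.
  by rewrite (EFin_Rintegral intf) (EFin_Rintegral iF1) E1 (fubini_tonelli1 _ mEf f0).
by rewrite !EFin_Rintegral// E1 E2 (fubini_tonelli _ mEf f0).
Qed.

End bounded_fubini.

Section bounded_differences.
Context {R : realType} {d : measure_display} {B : measurableType d}.

Definition unit_differences n (Z : n.-tuple B -> R) : Prop :=
  forall i w w', (forall j, j != i -> tnth w j = tnth w' j) -> Z w <= Z w' + 1.

Variable Q : probability B R.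

(* McDiarmid's inequality for a function [Z] that need not be measurable: only
   a measurable majorant [G] of [Z] is integrated.  [E] is a space of
   parameters, there to make the induction on [n] go through; at each step [G]
   is replaced by [Gmin], which is still a majorant because [Z] has unit
   differences, and whose integral oscillates little in the first coordinate. *)
Lemma majorant_expR (K lam : R) n : 0 <= lam <= 1 / 4 ->
  forall dE (E : measurableType dE) (G : E * n.-tuple B -> R)
    (Z : E -> n.-tuple B -> R),
  measurable_fun setT G -> (forall x, 0 <= G x <= K) ->
  (forall e w, Z e w <= G (e, w)) -> (forall e, unit_differences (Z e)) ->
  exists H : E * n.-tuple B -> \bar R,
    [/\ measurable_fun setT H,
        forall e w, ((expR (lam * Z e w))%:E <= H (e, w))%E &
        forall e, (\int[iid_law Q n]_w H (e, w) <=
          (expR (lam * \int[iid_law Q n]_w G (e, w) + 3 * lam ^+ 2 * n%:R))%:E)%E].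
Proof.
move=> lam14; have /andP[lam0 lam4] := lam14.
elim: n => [|n IH] dE E G Z mG GK ZG dZ.
  exists (fun x => (expR (lam * G x))%:E); split.
  - apply/measurable_EFinP; apply: measurableT_comp => //.
    exact: (measurableT_comp (mulrl_measurable _)).
  - by move=> e w; rewrite lee_fin ler_expR ler_wpM2l.
  - move=> e; rewrite (_ : (fun w => (expR (lam * G (e, w)))%:E) =
        fun=> (expR (lam * G (e, [tuple])))%:E); last first.
      by apply/funext => w; rewrite (tuple0 w).
    rewrite (_ : (fun w => G (e, w)) = fun=> G (e, [tuple])); last first.
      by apply/funext => w; rewrite (tuple0 w).
    by rewrite integral_prob_cst Rintegral_prob_cst mulr0 addr0.
have mcons := @tuple_cons_measurable d B n.
pose Gc (x : (E * B) * n.-tuple B) := G (x.1.1, tuple_cons (x.1.2, x.2)).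
have mGc : measurable_fun setT Gc.
  apply: (measurableT_comp mG); apply: measurable_fun_pair => /=.
    exact: measurableT_comp.
  apply: (measurableT_comp mcons); apply: measurable_fun_pair => //.
  exact: measurableT_comp.
pose g (x : E * B) := (\int[iid_law Q n]_w Gc (x, w))%R.
have mg : measurable_fun setT g.
  by apply: measurable_Rintegral => // x; have /andP[] := GK (x.1.1, tuple_cons (x.1.2, x.2)).
have mGcx x : measurable_fun setT (fun w => Gc (x, w)) by exact: measurableT_comp.
have gK x : 0 <= g x <= K by apply: Rintegral_itv => // w; exact: GK.
pose wt e := (\int[Q]_y expR (- g (e, y)))%R.
pose num (x : E * n.-tuple B) :=
  (\int[Q]_y (expR (- g (x.1, y)) * Gc ((x.1, y), x.2)))%R.
(* Changing the first coordinate of [Z] to any [y] costs at most [1], so [1] plus any weighted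
   average of [G] over [y] is again a majorant. The weights are proportional to [exp (- g)], the
   tilt of [integral_expR_min]. *)
pose Gmin (x : (E * B) * n.-tuple B) :=
  Num.min (Gc x) (1 + num (x.1.1, x.2) / wt x.1.1).
have mge e : measurable_fun setT (fun y => g (e, y)) by exact: measurableT_comp.
have mexp : measurable_fun setT (fun x => expR (- g x)).
  by apply: measurableT_comp => //; exact: measurableT_comp.
have wgt (e : E) := @integral_expR_min _ _ _ Q (fun y => g (e, y)) K lam
  (mge e) (fun y => gK (e, y)) lam14.
have wt0 e : 0 < wt e by have [] := wgt e.
have mnumi : measurable_fun setT (fun x : (E * n.-tuple B) * B =>
    expR (- g (x.1.1, x.2)) * Gc ((x.1.1, x.2), x.1.2)).
  apply: measurable_funM.
    apply: (measurableT_comp mexp); apply: measurable_fun_pair => //.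
    exact: measurableT_comp.
  apply: (measurableT_comp mGc); apply: measurable_fun_pair => /=.
    by apply: measurable_fun_pair => //; exact: measurableT_comp.
  exact: measurableT_comp.
have numiK e y w : 0 <= expR (- g (e, y)) * Gc ((e, y), w) <= K.
  have /andP[G0 G1] := GK (e, tuple_cons (y, w)); apply/andP; split.
    by rewrite mulr_ge0 ?expR_ge0.
  rewrite -[K]mul1r; apply: ler_pM; rewrite ?expR_ge0//.
  by rewrite expR_le1 oppr_le0; have /andP[] := gK (e, y).
have mnumie e w : measurable_fun setT
    (fun y => expR (- g (e, y)) * Gc ((e, y), w)).
  exact: (measurable_section mnumi (e, w)).
have intexp e : Q.-integrable setT (EFin \o (fun y => expR (- g (e, y)))).
  apply: (@itv_integrable _ _ _ _ _ 1).
    exact: (measurable_section mexp e).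
  by move=> y; rewrite expR_ge0 expR_le1 oppr_le0; have /andP[] := gK (e, y).
have mnum : measurable_fun setT num.
  by apply: measurable_Rintegral mnumi _ => x; have /andP[] := numiK x.1.1 x.2 x.1.2.
have num0 x : 0 <= num x.
  by apply: Rintegral_ge0 => y _; have /andP[] := numiK x.1 y x.2.
have mwt : measurable_fun setT wt.
  exact: (@measurable_Rintegral _ _ _ Q _ _ _ mexp (fun x => expR_ge0 _)).
have mGmin : measurable_fun setT Gmin.
  apply: measurable_minr => //; apply: measurable_funD => //.
  apply: measurable_funM.
    apply: (measurableT_comp mnum); apply: measurable_fun_pair => //.
    exact: measurableT_comp.
  rewrite (_ : (fun x => _) = fun x => expR (- ln (wt x.1.1))); last first.
    by apply/funext => x; rewrite expRN lnK ?posrE.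
  apply: measurableT_comp => //; apply: measurableT_comp => //.
  apply: (measurableT_comp (@measurable_ln R)).
  by apply: (measurableT_comp mwt); exact: measurableT_comp.
have GminK x : 0 <= Gmin x <= K.
  have /andP[G0 G1] := GK (x.1.1, tuple_cons (x.1.2, x.2)).
  rewrite ge_min G1 andbT le_min; apply/andP; split => //.
  by rewrite addr_ge0// divr_ge0// ltW.
pose Zc (x : E * B) w := Z x.1 (tuple_cons (x.2, w)).
have ZGmin x w : Zc x w <= Gmin (x, w).
  rewrite le_min; apply/andP; split; first exact: ZG.
  rewrite -lerBlDl ler_pdivlMr//= /wt -RintegralZl//.
  apply: le_Rintegral => //.
  - by apply: integrable_scale; exact: intexp.
  - apply: (@itv_integrable _ _ _ _ _ K); first exact: (mnumie x.1 w).
    by move=> y; exact: numiK.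
  move=> y _; rewrite mulrC ler_wpM2l ?expR_ge0// lerBlDl addrC.
  apply: (@le_trans _ _ (Z x.1 (tuple_cons (y, w)) + 1)); last by rewrite lerD2r.
  apply: (dZ x.1 ord0) => j; case: (unliftP ord0 j) => [i ->|->]; last by rewrite eqxx.
  by move=> _; rewrite !(tnth_nth y).
have dZc x : unit_differences (Zc x).
  move=> i w w' ww'; apply: (dZ x.1 (lift ord0 i)) => j.
  case: (unliftP ord0 j) => [k ->|->]; last by rewrite !(tnth_nth x.2).
  rewrite (inj_eq (@lift_inj _ _)) => ki; have := ww' k ki.
  by rewrite !(tnth_nth x.2).
have [H [mH ZH HI]] := IH _ _ Gmin Zc mGmin GminK ZGmin dZc.
exists (fun x => H ((x.1, thead x.2), [tuple of behead x.2])); split.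
- apply: (measurableT_comp mH); apply: measurable_fun_pair => /=.
    apply: measurable_fun_pair => //.
    exact: (measurableT_comp (@measurable_tnth _ B n.+1 ord0)).
  exact: (measurableT_comp (@measurable_behead _ B n)).
- move=> e w.
  have -> : Z e w = Zc (e, thead w) [tuple of behead w].
    by congr Z; apply: val_inj; rewrite {1}(tuple_eta w).
  exact: ZH.
- move=> e.
  (* Integrating [num / wt] over the other coordinates gives the tilted mean [t] of [g]. Hence
     [Gmin] integrates to at most [min (g, 1 + t)], whose exponential moment is already bounded. *)
  pose t := (\int[Q]_y (expR (- g (e, y)) * g (e, y)))%R / wt e.
  have [_ leexp] := wgt e.
  have numE : (\int[iid_law Q n]_w num (e, w) =
      \int[Q]_y (expR (- g (e, y)) * g (e, y)))%R.
    have [||_ ->] := @Rintegral_fubini _ _ _ _ _ (iid_law Q n) Q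
      (fun x => expR (- g (e, x.2)) * Gc ((e, x.2), x.1)) K.
    - apply: (measurableT_comp mnumi (g := fun x => ((e, x.1), x.2))).
      by do 2 apply: measurable_fun_pair => //.
    - by move=> x; exact: numiK.
    apply: eq_Rintegral => y _; rewrite /= RintegralZl//.
    by apply: (@itv_integrable _ _ _ _ _ K) => // w; exact: GK.
  have Gmin_le x : (\int[iid_law Q n]_w Gmin ((e, x), w) <=
      Num.min (g (e, x)) (1 + t))%R.
    have iGmin : (iid_law Q n).-integrable setT (EFin \o (fun w => Gmin ((e, x), w))).
      exact: (itv_integrable (iid_law Q n) (measurable_section mGmin (e, x)) (fun w => GminK ((e, x), w))).
    have inum : (iid_law Q n).-integrable setT (EFin \o (fun w => num (e, w))).
      apply: (@itv_integrable _ _ _ _ _ K); first exact: (measurable_section mnum e).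
      by move=> w; apply: Rintegral_itv => // y; exact: numiK.
    rewrite le_min; apply/andP; split.
      apply: le_Rintegral => //; last by move=> w _; rewrite ge_min lexx.
      by apply: (@itv_integrable _ _ _ _ _ K) => // w; exact: GK.
    have -> : 1 + t = (\int[iid_law Q n]_w (1 + (wt e)^-1 * num (e, w)))%R.
      rewrite RintegralD//; last 2 first.
      - exact: integrable_cst.
      - exact: integrable_scale.
      by rewrite Rintegral_prob_cst RintegralZl// numE mulrC.
    apply: le_Rintegral => //.
      by apply: integrable_add; [exact: integrable_cst|exact: integrable_scale].
    by move=> w _; rewrite ge_min [(wt e)^-1 * _]mulrC lexx orbT.
  have gE : (\int[iid_law Q n.+1]_w G (e, w) = \int[Q]_x g (e, x))%R.
    rewrite /Rintegral (preserving_integral (preserving_cons Q n)); last 2 first.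
    - by apply/measurable_EFinP; exact: (measurable_section mG).
    - by move=> w; rewrite lee_fin; have /andP[] := GK (e, w).
    have [||] := @Rintegral_fubini _ _ _ _ _ Q (iid_law Q n)
      (fun x => Gc ((e, x.1), x.2)) K.
    - apply: (measurableT_comp mGc (g := fun x => ((e, x.1), x.2))).
      by do 2 apply: measurable_fun_pair => //.
    - by move=> x; exact: GK.
    by move=> + _.
  have H0 x : (0 <= H x)%E.
    by case: x => x w; apply: le_trans (ZH x w); rewrite lee_fin expR_ge0.
  have mHe : measurable_fun setT (fun x : B * n.-tuple B => H ((e, x.1), x.2)).
    apply: (measurableT_comp mH (g := fun x => ((e, x.1), x.2))).
    by do 2 apply: measurable_fun_pair => //.
  rewrite (preserving_integral (preserving_cons Q n))//; last first.
    apply: (measurableT_comp mHe (g := fun w => (thead w, [tuple of behead w]))).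
    by have [] := preserving_uncons Q n.
  rewrite (eq_integral (fun x => H ((e, x.1), x.2))); last first.
    move=> x _ /=; rewrite theadE; congr (H (_, _)); exact: val_inj.
  rewrite (fubini_tonelli1 _ mHe)//.
  have iexp : Q.-integrable setT
      (EFin \o (fun x => expR (lam * Num.min (g (e, x)) (1 + t)))).
    apply: (@itv_integrable _ _ _ _ _ (expR (lam * K))).
      apply: measurableT_comp => //; apply: (measurableT_comp (mulrl_measurable _)).
      by apply: measurable_minr => //; exact: mge.
    move=> x; rewrite expR_ge0 ler_expR ler_wpM2l// ge_min.
    by have /andP[_ ->] := gK (e, x).
  apply: (@le_trans _ _ (\int[Q]_x (expR (3 * lam ^+ 2 * n%:R) *
      expR (lam * Num.min (g (e, x)) (1 + t)))%:E)%E).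
    apply: ge0_le_integral => //.
    - by move=> x _; exact: integral_ge0.
    - exact: (measurable_fun_fubini_tonelli_F _ mHe).
    - by have /integrableP[] := integrable_scale (expR (3 * lam ^+ 2 * n%:R)) iexp.
    move=> x _; apply: le_trans (HI (e, x)) _.
    rewrite lee_fin -expRD ler_expR addrC lerD2l ler_wpM2l//.
  rewrite -EFin_Rintegral; last exact: integrable_scale.
  rewrite RintegralZl// lee_fin gE.
  apply: (@le_trans _ _ (expR (3 * lam ^+ 2 * n%:R) *
      expR (lam * (\int[Q]_x g (e, x))%R + 3 * lam ^+ 2))).
    by rewrite ler_pM2l ?expR_gt0.
  by rewrite -expRD ler_expR -natr1; lra.
Qed.

End bounded_differences.

(** * Deviations of block sums *)

Section square_sum.
Context {R : realType} {d : measure_display} {Z : measurableType d}.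
Variable P : probability Z R.

Lemma measurable_tuple_sum {U : Type} (f : U -> Z -> R) n u :
  measurable_fun setT (f u) ->
  measurable_fun setT (@tuple_sum R U Z f n u).
Proof.
move=> mf; apply: measurable_sum => i.
by apply: (measurableT_comp mf); exact: measurable_tnth.
Qed.

Lemma integral_sqr_shift (h : Z -> R) (c : R) :
  P.-integrable setT (EFin \o h) -> (\int[P]_z h z)%R = 0 ->
  (\int[P]_z (h z ^+ 2)%:E < +oo)%E ->
  (\int[P]_z ((h z + c) ^+ 2)%:E = \int[P]_z (h z ^+ 2)%:E + (c ^+ 2)%:E)%E.
Proof.
move=> ih h0 hV.
have /integrableP[/measurable_EFinP mh _] := ih.
have mh2 : measurable_fun setT (fun z => h z ^+ 2) by exact: measurable_funX.
have ih2 : P.-integrable setT (EFin \o (fun z => h z ^+ 2)).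
  apply/integrableP; split; first exact/measurable_EFinP.
  by under eq_integral do rewrite gee0_abs ?lee_fin ?sqr_ge0//.
have i1 : P.-integrable setT (EFin \o (fun z => (c *+ 2) * h z)).
  exact: integrable_scale.
have i2 : P.-integrable setT (EFin \o (fun z => (c *+ 2) * h z + c ^+ 2)).
  by apply: integrable_add => //; exact: integrable_cst.
rewrite (_ : (fun z => ((h z + c) ^+ 2)%:E) =
    EFin \o (fun z => h z ^+ 2 + ((c *+ 2) * h z + c ^+ 2))); last first.
  by apply/funext => z /=; congr EFin; ring.
rewrite -(EFin_Rintegral (integrable_add ih2 i2)) RintegralD//.
rewrite RintegralD//; last exact: integrable_cst.
by rewrite Rintegral_prob_cst RintegralZl// h0 mulr0 add0r EFinD EFin_Rintegral.
Qed.

Lemma integral_sqr_tuple_sum {U : Type} (f : U -> Z -> R) u (V : R) n :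
  P.-integrable setT (EFin \o f u) -> (\int[P]_z f u z)%R = 0 ->
  (\int[P]_z (f u z ^+ 2)%:E <= V%:E)%E ->
  (\int[iid_law P n]_w (tuple_sum f u w ^+ 2)%:E <= (n%:R * V)%:E)%E.
Proof.
move=> ih h0 hV.
have /integrableP[/measurable_EFinP mh _] := ih.
have ms k := @measurable_tuple_sum U f k u mh.
elim: n => [|n IH].
  rewrite (_ : (fun w => _) = fun=> 0%E); last first.
    by apply/funext => w; rewrite /tuple_sum big_ord0 expr0n.
  by rewrite integral_prob_cst mul0r.
rewrite (preserving_integral (preserving_cons P n)); last 2 first.
- by apply/measurable_EFinP; apply: measurable_funX; exact: ms.
- by move=> w; rewrite lee_fin sqr_ge0.
under eq_integral do rewrite tuple_sum_cons.
have mF : measurable_fun setT (fun x : Z * n.-tuple Z =>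
    ((f u x.1 + tuple_sum f u x.2) ^+ 2)%:E).
  apply/measurable_EFinP; apply: measurable_funX; apply: measurable_funD.
    exact: (measurableT_comp mh).
  exact: (measurableT_comp (ms n)).
rewrite (fubini_tonelli2 _ mF); last by move=> x; rewrite lee_fin sqr_ge0.
have mS : measurable_fun setT (fun w : n.-tuple Z => (tuple_sum f u w ^+ 2)%:E).
  by apply/measurable_EFinP; apply: measurable_funX; exact: ms.
have V0 : 0 <= V.
  rewrite -lee_fin; apply: le_trans hV; apply: integral_ge0 => z _.
  by rewrite lee_fin sqr_ge0.
apply: (@le_trans _ _
    (\int[iid_law P n]_w (V%:E + (tuple_sum f u w ^+ 2)%:E))%E).
  apply: ge0_le_integral => //.
  - by move=> w _; apply: integral_ge0 => z _; rewrite lee_fin sqr_ge0.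
  - apply: (measurable_fun_fubini_tonelli_G _ mF) => x.
    by rewrite lee_fin sqr_ge0.
  - exact: emeasurable_funD.
  - move=> w _; have hVy := le_lt_trans hV (ltry V).
    rewrite [leLHS](@integral_sqr_shift (f u) (tuple_sum f u w) ih h0 hVy).
    exact: leeD.
rewrite ge0_integralD//; last by move=> w _; rewrite lee_fin sqr_ge0.
rewrite integral_prob_cst -natr1 mulrDl mul1r addrC EFinD.
exact: leeD.
Qed.

End square_sum.

Section truncation.
Context {R : realType}.

(** A Lipschitz function between the indicators of [|t| >= 1] and [|t| > 1 / 2]. Lying above the
    first, it counts bad blocks; vanishing near zero, it is bounded by a multiple of [t^2], so that
    a variance controls its mean. *)
Definition ramp (t : R) : R := Num.min 1 (Num.max 0 (2 * `|t| - 1)).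

Lemma ramp_itv t : 0 <= ramp t <= 1.
Proof. by rewrite ge_min lexx le_min ler01 le_max lexx. Qed.

Lemma ramp0 : ramp 0 = 0.
Proof.
by rewrite /ramp normr0 mulr0 sub0r max_l ?min_r//; lra.
Qed.

Lemma ramp_ge1 t : 1 <= `|t| -> ramp t = 1.
Proof. by move=> t1; rewrite /ramp min_l// le_max; apply/orP; right; lra. Qed.

Lemma ramp_le_sqr t : ramp t <= 4 * t ^+ 2.
Proof.
rewrite /ramp ge_min ge_max; apply/orP.
rewrite -(real_normK (num_real t)).
have [h|h] := lerP `|t| (1 / 2).
  right; apply/andP; split; first by rewrite mulr_ge0 ?sqr_ge0.
  by have := sqr_ge0 `|t|; lra.
left; have : (1 / 2) ^+ 2 <= `|t| ^+ 2.
  by rewrite lerXn2r ?nnegrE//; lra.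
by rewrite expr_div_n; lra.
Qed.

Lemma min_lip (c x y : R) : `|Num.min c x - Num.min c y| <= `|x - y|.
Proof.
have := normr_ge0 (x - y); have := ler_norm (x - y); have := ler_norm (y - x).
rewrite distrC => h1 h2 h3; rewrite ler_norml.
by case: (leP c x) => hx; case: (leP c y) => hy; apply/andP; split; lra.
Qed.

Lemma max_lip (c x y : R) : `|Num.max c x - Num.max c y| <= `|x - y|.
Proof.
have := normr_ge0 (x - y); have := ler_norm (x - y); have := ler_norm (y - x).
rewrite distrC => h1 h2 h3; rewrite ler_norml.
by case: (leP c x) => hx; case: (leP c y) => hy; apply/andP; split; lra.
Qed.

Lemma ramp_lip s t : `|ramp s - ramp t| <= 2 * `|s - t|.
Proof.
apply: le_trans (min_lip _ _ _) _; apply: le_trans (max_lip _ _ _) _.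
have -> : 2 * `|s| - 1 - (2 * `|t| - 1) = 2 * (`|s| - `|t|) by ring.
by rewrite normrM ger0_norm// ler_wpM2l// ler_dist_dist.
Qed.

Lemma measurable_ramp : measurable_fun setT ramp.
Proof.
apply: measurable_minr => //; apply: measurable_maxr => //.
apply: measurable_funB => //.
by apply: (measurableT_comp (mulrl_measurable _)); exact: normr_measurable.
Qed.

End truncation.

Lemma markov_ge0 {R : realType} {d} {B : measurableType d}
    (Q : probability B R) (K : B -> \bar R) (a : R) :
  0 < a -> measurable_fun setT K -> (forall w, 0 <= K w)%E ->
  (a%:E * Q [set w | (a%:E <= K w)%E] <= \int[Q]_w K w)%E.
Proof.
move=> a0 mK K0; set A := [set w | _].
have mA : measurable A by rewrite -[A]setTI; exact: emeasurable_fun_c_infty.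
apply: (@le_trans _ _ (\int[Q]_(w in A) K w)%E); last first.
  exact: ge0_subset_integral.
rewrite -(integral_cst Q mA); apply: ge0_le_integral => //.
- by move=> w _; rewrite lee_fin ltW.
- exact: measurable_funTS.
Qed.

Section block_deviation.
Context {R : realType} {U : Type} (u0 : U).

Lemma dominated_signedN {d} {B : measurableType d} (Q : probability B R)
    (f : U -> B -> R) : (forall b, f u0 b = 0) ->
  dominated u0 (rademacher Q) (signed (fun u b => - f u b))
               (rademacher Q) (signed f).
Proof.
move=> f0 dE E A G A0 mG AG.
have G0 : forall e, (0 <= G e)%E.
  by apply: (@majorant_ge0 _ _ u0 _ _ _ _ A _ (signed f)) => // b;
    rewrite /signed f0 mulr0.
have mH : measurable_fun setT (fun x : E * (B * bool) =>
    if x.2.2 then G (x.1, (x.2.1, false)) else G (x.1, (x.2.1, true))).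
  exact: (measurable_funS_bool (measurable_fix_bool false mG)
    (measurable_fix_bool true mG)).
exists (fun x => if x.2.2 then G (x.1, (x.2.1, false))
                 else G (x.1, (x.2.1, true))); split => //.
- move=> e [b []] u /=.
    by have := AG e (b, false) u; rewrite /signed /= expr0 expr1 mul1r mulN1r opprK.
  by have := AG e (b, true) u; rewrite /signed /= expr0 expr1 mul1r mulN1r.
- move=> e; rewrite !integral_rademacher//=.
  + by rewrite addeC.
  + exact: measurable_section.
  + exact: (measurable_section mH).
  + by move=> [b []] /=; exact: G0.
Qed.

Lemma signed_scale {B : Type} (k : R) (f : U -> B -> R) :
  signed (fun u b => k * f u b) = (fun u w => k * signed f u w).
Proof. by apply/funext => u; apply/funext => w; rewrite /signed mulrCA. Qed.

(** Symmetrization followed by a comparison with a simpler process [g], possibly on another space: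
    for the truncated squares, [g] is linear and lives on the design alone. *)
Lemma dominated_centered {d d'} {Z : measurableType d} {S : measurableType d'}
    (P : probability Z R) (Q : probability S R)
    (f : U -> Z -> R) (g : U -> S -> R) (k : R) :
  0 < k -> (forall u, P.-integrable setT (EFin \o f u)) ->
  (forall z, f u0 z = 0) -> (forall s, g u0 s = 0) ->
  dominated u0 (rademacher P) (signed f) (rademacher Q) (signed g) ->
  dominated u0 P (fun u z => k * (f u z - \int[P]_x f u x)%R)
    (rademacher Q) (signed (fun u s => 2 * k * g u s)).
Proof.
move=> k0 intf f0 g0 dfg.
have c0 z : f u0 z - (\int[P]_x f u0 x)%R = 0.
  rewrite f0 sub0r; apply/eqP; rewrite oppr_eq0; apply/eqP.
  rewrite (_ : f u0 = fun=> 0) ?Rintegral_prob_cst//; exact/funext.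
have sg0 (B : Type) (h : U -> B -> R) w : (forall b, h u0 b = 0) -> signed h u0 w = 0.
  by move=> h0; rewrite /signed h0 mulr0.
have -> : signed (fun u s => 2 * k * g u s) = fun u w => k * (2 * signed g u w).
  by rewrite signed_scale; apply/funext => u; apply/funext => w; ring.
apply: dominated_scale => //.
  by move=> w; rewrite sg0// mulr0.
apply: dominated_trans (dominated_symmetrize intf f0) _.
rewrite signed_scale; apply: dominated_scale => // w; exact: sg0.
Qed.

Context {d d' : measure_display} {Z : measurableType d} {S : measurableType d'}.
Variables (P : probability Z R) (Q : probability S R).
Variables (f : U -> Z -> R) (g : U -> S -> R).
Hypothesis intf : forall u, P.-integrable setT (EFin \o f u).
Hypothesis f0 : forall z, f u0 z = 0.
Hypothesis g0 : forall s, g u0 s = 0.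
Hypothesis dfg : dominated u0 (rademacher P) (signed f) (rademacher Q) (signed g).

Let cf u z := f u z - (\int[P]_x f u x)%R.

Let cf0 z : cf u0 z = 0.
Proof.
rewrite /cf f0 sub0r; apply/eqP; rewrite oppr_eq0; apply/eqP.
rewrite (_ : f u0 = fun=> 0) ?Rintegral_prob_cst//; exact/funext.
Qed.

Let intcf u : P.-integrable setT (EFin \o cf u).
Proof.
by apply: integrable_add => //; exact: integrable_cst.
Qed.

Let cf_mean u : (\int[P]_z cf u z)%R = 0.
Proof.
rewrite /cf RintegralB//; last exact: integrable_cst.
by rewrite Rintegral_prob_cst subrr.
Qed.

(** The factor [8] collects three doublings: symmetrization over whole blocks, the slope [2] of the
    ramp, and symmetrization of the points inside a block. In between, the block signs go by
    [dominated_signed], both [h] and [- h] being dominated by the same process. *)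
Lemma dominated_ramp (m : nat) (k : R) : 0 < k ->
  dominated u0 (iid_law P m)
    (fun u b => ramp (k * tuple_sum cf u b) -
                (\int[iid_law P m]_b ramp (k * tuple_sum cf u b))%R)
    (iid_law (rademacher Q) m)
    (tuple_sum (signed (fun u s => 8 * k * g u s)) (n:=m)).
Proof.
move=> k0.
have k40 : 0 < 4 * k by rewrite mulr_gt0.
pose h u (b : m.-tuple Z) := tuple_sum (fun u z => 4 * k * cf u z) u b.
pose gk := signed (fun u s => 8 * k * g u s).
have gk0 w : gk u0 w = 0 by rewrite /gk /signed g0 !mulr0.
have h0 b : h u0 b = 0 by apply: tuple_sum0 => z; rewrite cf0 mulr0.
have sgk0 w : tuple_sum gk u0 (w : m.-tuple (S * bool)) = 0 by exact: tuple_sum0.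
have hE u b : h u b = 4 * (k * tuple_sum cf u b).
  rewrite /h /tuple_sum mulrA mulr_sumr.
  by apply: eq_bigr => i _.
have dp : dominated u0 P (fun u z => 4 * k * cf u z) (rademacher Q) gk.
  have := @dominated_centered _ _ _ _ P Q f g _ k40 intf f0 g0 dfg.
  by rewrite mulrA (_ : 2 * 4 = 8 :> R)//; ring.
have dn : dominated u0 P (fun u z => - (4 * k * cf u z)) (rademacher Q) gk.
  have := @dominated_centered _ _ _ _ P Q (fun u z => - f u z) g _ k40.
  rewrite mulrA (_ : 2 * 4 = 8 :> R); last by ring.
  rewrite (_ : (fun u z => 4 * k * (- f u z - _)%R) =
      fun u z => - (4 * k * cf u z)); last first.
    apply/funext => u; apply/funext => z; rewrite /cf.
    rewrite (_ : (fun x => - f u x) = fun x => (-1) * f u x).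
      by rewrite RintegralZl//; ring.
    by apply/funext => x; rewrite mulN1r.
  apply => //.
  - move=> u; rewrite (_ : _ \o _ = EFin \o (fun z => (-1) * f u z)).
      exact: integrable_scale.
    by apply/funext => z /=; rewrite mulN1r.
  - by move=> z; rewrite f0 oppr0.
  - by apply: dominated_trans (dominated_signedN P f0) _.
have dhp : dominated u0 (iid_law P m) h (iid_law (rademacher Q) m)
    (tuple_sum gk (n:=m)).
  by apply: dominated_iid => // z; rewrite cf0 mulr0.
have dhn : dominated u0 (iid_law P m) (fun u b => - h u b)
    (iid_law (rademacher Q) m) (tuple_sum gk (n:=m)).
  rewrite (_ : (fun u b => - h u b) =
      tuple_sum (fun u z => - (4 * k * cf u z)) (n:=m)).
    by apply: dominated_iid => // z; rewrite cf0 mulr0 oppr0.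
  by apply/funext => u; apply/funext => b; rewrite /h /tuple_sum sumrN.
have mcf u : measurable_fun setT (cf u).
  by have /integrableP[/measurable_EFinP] := intcf u.
pose r u (b : m.-tuple Z) := ramp (k * tuple_sum cf u b).
have mr u : measurable_fun setT (r u).
  apply: (measurableT_comp measurable_ramp).
  apply: (measurableT_comp (mulrl_measurable _)).
  exact: measurable_tuple_sum.
have intr u : (iid_law P m).-integrable setT (EFin \o r u).
  by apply: (itv_integrable _ (mr u)) => b; exact: ramp_itv.
have r0 b : r u0 b = 0 by rewrite /r (tuple_sum0 _ cf0) mulr0 ramp0.
apply: dominated_trans (dominated_symmetrize intr r0) _.
(* The division by [4] offsets the symmetrization factor and the slope of the ramp, making [phi]
   1-Lipschitz. *)
pose phi (x : R) := 2 * ramp (4^-1 * x).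
rewrite (_ : (fun u b => 2 * r u b) = fun u b => phi (h u b)); last first.
  apply/funext => u; apply/funext => b; rewrite /phi hE mulKf//.
have contr : dominated u0 (rademacher (iid_law P m))
    (signed (fun u b => phi (h u b))) (rademacher (iid_law P m)) (signed h).
  apply: dominated_contraction => //.
  - apply: (measurableT_comp (mulrl_measurable _)).
    apply: (measurableT_comp measurable_ramp).
    exact: mulrl_measurable.
  - move=> x y; rewrite /phi -mulrBr normrM ger0_norm//.
    have := ramp_lip (4^-1 * x) (4^-1 * y).
    rewrite -mulrBr normrM [`|4^-1|]ger0_norm ?invr_ge0//.
    by move: (`|_|) (`|x - y|) => a b; lra.
  - by rewrite /phi mulr0 ramp0 mulr0.
apply: dominated_trans contr _; exact: dominated_signed.
Qed.

(** Chebyshev's argument: by [ramp_le_sqr] the mean is at most [4 V / (m s^2)], and the factor [64]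
    turns this into [1 / 16]. *)
Lemma integral_ramp_le (m : nat) (s V : R) u : (0 < m)%N -> 0 < s ->
  (\int[P]_z (cf u z ^+ 2)%:E <= V%:E)%E -> 64 * V <= m%:R * s ^+ 2 ->
  (\int[iid_law P m]_b ramp ((m%:R * s)^-1 * tuple_sum cf u b) <= 1 / 16)%R.
Proof.
move=> m0 s0 hV Vms.
have mcf : measurable_fun setT (cf u).
  by have /integrableP[/measurable_EFinP] := intcf u.
have mS := @measurable_tuple_sum _ _ _ _ cf m u mcf.
have m0R : 0 < m%:R :> R by rewrite ltr0n.
have k0 : 0 < (m%:R * s)^-1 by rewrite invr_gt0 mulr_gt0.
have mr : measurable_fun setT
    (fun b : m.-tuple Z => ramp ((m%:R * s)^-1 * tuple_sum cf u b)).
  apply: (measurableT_comp measurable_ramp).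
  exact: (measurableT_comp (mulrl_measurable _)).
rewrite -lee_fin EFin_Rintegral; last first.
  by apply: (itv_integrable _ mr) => b; exact: ramp_itv.
have kk : 0 <= 4 * (m%:R * s)^-1 ^+ 2 by rewrite mulr_ge0// sqr_ge0.
have mS2 : measurable_fun setT (fun b : m.-tuple Z => (tuple_sum cf u b ^+ 2)%:E).
  by apply/measurable_EFinP; exact: measurable_funX.
apply: (@le_trans _ _ (\int[iid_law P m]_b
    ((4 * (m%:R * s)^-1 ^+ 2)%:E * (tuple_sum cf u b ^+ 2)%:E))%E).
  apply: ge0_le_integral => //.
  - by move=> b _; rewrite lee_fin; have /andP[] := ramp_itv ((m%:R * s)^-1 * tuple_sum cf u b).
  - exact/measurable_EFinP.
  - exact: measurable_funeM.
  - move=> b _; rewrite -EFinM lee_fin; apply: le_trans (ramp_le_sqr _) _.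
    by rewrite exprMn mulrA.
rewrite ge0_integralZl//; last by move=> b _; rewrite lee_fin sqr_ge0.
apply: (@le_trans _ _ ((4 * (m%:R * s)^-1 ^+ 2)%:E * (m%:R * V)%:E)%E).
  apply: lee_wpmul2l; first by rewrite lee_fin.
  exact: integral_sqr_tuple_sum.
rewrite -EFinM lee_fin.
have -> : 4 * (m%:R * s)^-1 ^+ 2 * (m%:R * V) = (64 * V) / (m%:R * s ^+ 2) / 16.
  by field; rewrite !gt_eqF.
by rewrite ler_wpM2r// ler_pdivrMr ?mul1r ?mulr_gt0 ?exprn_gt0.
Qed.

(** The number of bad blocks is at most the sum of the ramps: a centred part below [n / 8] on the
    event, plus means of total at most [n / 16]. Domination bounds the expected centred supremum by
    [8 t / (m s)], which the condition on [128 t] brings down to [n / 16], half of the level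
    [n / 8]. *)
Lemma block_deviation (N n m l : nat) (s V t : R)
    (G : N.-tuple (S * bool) -> \bar R) :
  (n * m + l)%N = N -> (0 < n)%N -> (0 < m)%N -> 0 < s ->
  (forall u, \int[P]_z (cf u z ^+ 2)%:E <= V%:E)%E ->
  64 * V <= m%:R * s ^+ 2 ->
  measurable_fun setT G ->
  (forall u w, ((tuple_sum (signed g) u w)%:E <= G w)%E) ->
  (\int[iid_law (rademacher Q) N]_w G w <= t%:E)%E ->
  128 * t <= n%:R * m%:R * s ->
  exists C : set (n.-tuple (m.-tuple Z)),
    [/\ measurable C,
        ((1 - expR (- (n%:R / 3072)))%:E <= iid_law (iid_law P m) n C)%E &
        forall b, C b -> forall u,
          (4 * #|[pred j : 'I_n | (m%:R * s <= `|tuple_sum cf u (tnth b j)|)%R]| < n)%N].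
Proof.
have arith (x y z w a : R) : 0 < a -> x < a / 8 -> z <= a * (1 / 16) -> w <= y -> y = x + z ->
    4 * w < a.
  by move=> ? ? ? ? ?; lra.
have arith2 (x y z : R) : 0 <= x <= 1 -> 0 <= y <= 1 -> x - z <= y - z + 1.
  by move=> /andP[? ?] /andP[? ?]; lra.
have arith4 (x y z : R) : x <= y + 1 -> x + z <= y + z + 1 by lra.
have arith3 (x y : R) : 0 <= x <= 1 / 16 -> 0 <= y <= 1 -> y - x <= 1.
  by move=> /andP[? ?] /andP[? ?]; lra.
move=> nmlN n0 m0 s0 hV Vms mG gG Gt tms.
have m0R : 0 < m%:R :> R by rewrite ltr0n.
have n0R : 0 < n%:R :> R by rewrite ltr0n.
have k0 : 0 < (m%:R * s)^-1 by rewrite invr_gt0 mulr_gt0.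
set k := (m%:R * s)^-1 in k0 *.
have k80 : 0 < 8 * k by rewrite mulr_gt0.
pose gk := signed (fun u x => 8 * k * g u x).
have gk0 w : gk u0 w = 0 by rewrite /gk /signed g0 !mulr0.
pose r u (b : m.-tuple Z) := ramp (k * tuple_sum cf u b).
pose er u := (\int[iid_law P m]_b r u b)%R.
pose dr u b := r u b - er u.
have r0 b : r u0 b = 0 by rewrite /r (tuple_sum0 _ cf0) mulr0 ramp0.
have er0 : er u0 = 0.
  by rewrite /er (_ : r u0 = fun=> 0) ?Rintegral_prob_cst//; exact/funext.
have dr0 b : dr u0 b = 0 by rewrite /dr r0 er0 subrr.
have er_le u : 0 <= er u <= 1 / 16.
  rewrite Rintegral_ge0/=; last by move=> b _; have /andP[] := ramp_itv (k * tuple_sum cf u b).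
  exact: integral_ramp_le.
have dom : dominated u0 (iid_law (iid_law P m) n) (tuple_sum dr (n:=n))
    (iid_law (rademacher Q) N) (tuple_sum gk (n:=N)).
  apply: dominated_trans (dominated_blocks nmlN gk0 _); last first.
    by apply: dominates0_signed => x; rewrite g0 mulr0.
  apply: dominated_iid => //; first by move=> w; exact: tuple_sum0.
  exact: dominated_ramp.
have [||e w u|H [mH drH HG]] := dom _ unit (fun _ _ => 0) (fun x => (8 * k)%:E * G x.2)%E.
- by [].
- by apply: measurable_funeM; exact: measurableT_comp.
- rewrite add0r /gk signed_scale.
  rewrite (_ : tuple_sum _ _ _ = 8 * k * tuple_sum (signed g) u w); last first.
    by rewrite /tuple_sum mulr_sumr.
  by rewrite EFinM; apply: lee_wpmul2l => //=; rewrite lee_fin ltW.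
have H0 w : (0 <= H (tt, w))%E.
  by apply: le_trans (drH tt w u0); rewrite add0r (tuple_sum0 _ dr0).
have dr1 u b : dr u b <= 1.
  move: (er_le u) (ramp_itv (k * tuple_sum cf u b)); rewrite /dr -/(r u b).
  exact: arith3.
have sum_le u w : tuple_sum dr u (w : n.-tuple _) <= n%:R.
  rewrite /tuple_sum -[leRHS]mulr1 mulrC mulr_natr -[in leRHS](card_ord n).
  by rewrite -sumr_const; apply: ler_sum.
(* The centred sums never exceed [n], so capping there keeps a majorant and makes it bounded, as
   [majorant_expR] requires. *)
pose Hr (x : unit * n.-tuple (m.-tuple Z)) := fine (mine (H x) n%:R%:E).
have HrE x : ((Hr x)%:E = mine (H x) n%:R%:E)%E.
  case: x => -[] w; rewrite fineK// ge0_fin_numE.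
    by rewrite gt_min ltry orbT.
  by rewrite le_min H0 lee_fin ler0n.
have mHr : measurable_fun setT Hr.
  apply/measurable_EFinP; rewrite (_ : _ \o _ = fun x => mine (H x) n%:R%:E)%E.
    exact: measurable_mine.
  by apply/funext => x; rewrite /= HrE.
have Hrn x : 0 <= Hr x <= n%:R.
  rewrite -!lee_fin HrE; case: x => -[] w.
  by rewrite le_min H0 lee_fin ler0n ge_min lexx orbT.
pose Z' (e : unit) (w : n.-tuple (m.-tuple Z)) := sup [set tuple_sum dr u w | u in [set: U]].
have supw (w : n.-tuple (m.-tuple Z)) : has_sup [set tuple_sum dr u w | u in [set: U]].
  split; first by exists (tuple_sum dr u0 w), u0.
  by exists n%:R => _ [u _ <-]; exact: sum_le.
have ZHr e w : Z' e w <= Hr (e, w).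
  apply: ge_sup; first by exists (tuple_sum dr u0 w), u0.
  move=> _ [u _ <-]; rewrite -lee_fin HrE le_min lee_fin sum_le andbT.
  by have := drH tt w u; rewrite add0r; case: e.
have dZ e : unit_differences (Z' e).
  move=> i w w' ww'; apply: ge_sup; first by exists (tuple_sum dr u0 w), u0.
  move=> _ [u _ <-].
  apply: (@le_trans _ _ (tuple_sum dr u w' + 1)); last first.
    by rewrite lerD2r; apply: ub_le_sup; [exact: (supw w').2|exists u].
  rewrite /tuple_sum (bigD1 i)//= [in leRHS](bigD1 i)//=.
  have -> : \sum_(j < n | j != i) dr u (tnth w j) =
      \sum_(j < n | j != i) dr u (tnth w' j).
    by apply: eq_bigr => j ji; rewrite ww'.
  suff : dr u (tnth w i) <= dr u (tnth w' i) + 1.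
    exact: arith4.
  by rewrite /dr; apply: arith2; exact: ramp_itv.
(* Minimizes [3 lam^2 - lam / 16], the exponent per block in Markov's inequality when the mean is
   [n / 16] and the level [n / 8]; the minimum is [- 1 / 3072]. *)
pose lam : R := 1 / 96.
have lam14 : 0 <= lam <= 1 / 4 by rewrite /lam; apply/andP; split; lra.
have [K [mK ZK KI]] := @majorant_expR R _ _ (iid_law P m) n%:R lam n lam14 _ unit
  Hr Z' mHr Hrn ZHr dZ.
have IHr : (\int[iid_law (iid_law P m) n]_w Hr (tt, w) <= n%:R / 16)%R.
  have mHrt : measurable_fun setT (fun w => Hr (tt, w)).
    exact: (measurable_section mHr).
  rewrite -lee_fin EFin_Rintegral; last exact: (itv_integrable _ mHrt).
  apply: (@le_trans _ _ (\int[iid_law (iid_law P m) n]_w H (tt, w))%E).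
    apply: ge0_le_integral => //.
    - by move=> w _; rewrite lee_fin; have /andP[] := Hrn (tt, w).
    - exact/measurable_EFinP.
    - exact: (measurable_section mH).
    - by move=> w _; rewrite HrE ge_min lexx.
  apply: le_trans (HG tt) _ => /=.
  have G0 w : (0 <= G w)%E.
    by apply: le_trans (gG u0 w); rewrite tuple_sum0// => x; rewrite /signed g0 mulr0.
  rewrite ge0_integralZl//; last by rewrite lee_fin ltW.
  apply: (@le_trans _ _ ((8 * k)%:E * t%:E)%E).
    by apply: lee_wpmul2l => //; rewrite lee_fin ltW.
  rewrite -EFinM lee_fin /k.
  have -> : 8 * (m%:R * s)^-1 * t = (128 * t) / (m%:R * s) / 16.
    by field; rewrite !gt_eqF.
  rewrite ler_wpM2r// ler_pdivrMr ?mulr_gt0//.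
  by rewrite mulrA.
pose a := lam * (n%:R / 8).
have mKt : measurable_fun setT (fun w => K (tt, w)) by exact: (measurable_section mK).
have K0 w : (0 <= K (tt, w))%E.
  by apply: le_trans (ZK tt w); rewrite lee_fin expR_ge0.
pose C : set (n.-tuple (m.-tuple Z)) := [set w | (K (tt, w) < (expR a)%:E)%E].
have mC : measurable C.
  by rewrite -[C]setTI; exact: emeasurable_fun_infty_o.
exists C; split => //.
- have CE : ~` C = [set w | ((expR a)%:E <= K (tt, w))%E].
    by apply/seteqP; split => w /=; rewrite /C /= leNgt => /negP.
  have PC : (iid_law (iid_law P m) n (~` C) <= (expR (- (n%:R / 3072)))%:E)%E.
    have := markov_ge0 (iid_law (iid_law P m) n) (expR_gt0 a) mKt K0.
    rewrite -CE => /le_trans /(_ (KI tt)).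
    rewrite muleC -lee_pdivlMr ?expR_gt0// => /le_trans; apply.
    rewrite -EFinM lee_fin -expRN -expRD ler_expR /a.
    by move: IHr; move: (\int[_]_w Hr _)%R => I; rewrite /lam; lra.
  rewrite -[C]setCK [leRHS](probability_setC (iid_law (iid_law P m) n)); last first.
    exact: measurableC.
  by rewrite EFinB leeB.
move=> b Cb u.
have Zb : Z' tt b < n%:R / 8.
  rewrite -(ltr_pM2l (_ : 0 < lam)); last by rewrite /lam; lra.
  by rewrite -ltr_expR -lte_fin; apply: le_lt_trans (ZK tt b) Cb.
have drb : tuple_sum dr u b < n%:R / 8.
  by apply: le_lt_trans Zb; apply: ub_le_sup; [exact: (supw b).2|exists u].
have : tuple_sum r u b = tuple_sum dr u b + n%:R * er u.
  rewrite /tuple_sum /dr sumrB sumr_const card_ord -mulr_natl; ring.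
have : (#|[pred j : 'I_n | (m%:R * s <= `|tuple_sum cf u (tnth b j)|)%R]|%:R <=
    tuple_sum r u b).
  rewrite /tuple_sum -sum1_card natr_sum big_mkcond /=.
  apply: ler_sum => j _; rewrite inE.
  case: ifP => [h|_]; last by have /andP[] := ramp_itv (k * tuple_sum cf u (tnth b j)).
  rewrite /r ramp_ge1// normrM gtr0_norm// /k.
  by rewrite mulrC ler_pdivlMr ?mulr_gt0// mul1r.
have /andP[_ eru] := er_le u.
have := ler_wpM2l (ltW n0R) eru.
rewrite -(ltr_nat R) natrM; move: drb.
exact: (arith _ _ _ _ _ n0R).
Qed.

End block_deviation.

(** * The regression model *)

Section norms.
Context {R : realType} {d : measure_display} {T : measurableType d}.
Variable mu : probability T R.
Implicit Types u : T -> R.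

Lemma Lqnorm_powR (q : R) u : q != 0 ->
  ((Lqnorm mu q u) `^ q = \int[mu]_x (`|u x| `^ q)%:E)%E.
Proof. by move=> q0; rewrite /Lqnorm poweR_Lnorm. Qed.

Lemma Lqnorm2_sqr u :
  ((Lqnorm mu 2 u) `^ 2 = \int[mu]_x (u x ^+ 2)%:E)%E.
Proof.
rewrite Lqnorm_powR ?pnatr_eq0//; apply: eq_integral => x _.
by rewrite powR_mulrn// real_normK// num_real.
Qed.

Lemma Lqnorm2_le u (a : R) : 0 <= a ->
  ((Lqnorm mu 2 u <= a%:E) = (\int[mu]_x (u x ^+ 2)%:E <= (a ^+ 2)%:E))%E.
Proof.
move=> a0; rewrite -Lqnorm2_sqr.
have : (0 <= Lqnorm mu 2 u)%E by exact: Lnorm_ge0.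
case: (Lqnorm mu 2 u) => [x x0| |//].
  by rewrite poweR_EFin powR_mulrn// !lee_fin ler_pXn2r.
by rewrite poweRyr// !leye_eq.
Qed.

Lemma Lqnorm2_ge u (a : R) : 0 <= a ->
  ((a%:E <= Lqnorm mu 2 u) = ((a ^+ 2)%:E <= \int[mu]_x (u x ^+ 2)%:E))%E.
Proof.
move=> a0; rewrite -Lqnorm2_sqr.
have : (0 <= Lqnorm mu 2 u)%E by exact: Lnorm_ge0.
case: (Lqnorm mu 2 u) => [x x0| |//].
  by rewrite poweR_EFin powR_mulrn// !lee_fin ler_pXn2r.
by rewrite poweRyr// !leey.
Qed.

Lemma integral_sqr_scale u (k : R) : measurable_fun setT u ->
  (\int[mu]_x ((k * u x) ^+ 2)%:E = (k ^+ 2)%:E * \int[mu]_x (u x ^+ 2)%:E)%E.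
Proof.
move=> mu_; rewrite -ge0_integralZl//.
- by apply: eq_integral => x _; rewrite exprMn EFinM.
- by apply/measurable_EFinP; exact: measurable_funX.
- by move=> x _; rewrite lee_fin sqr_ge0.
- by rewrite lee_fin sqr_ge0.
Qed.

Lemma Lfun2P u : u \in Lfun mu 2%:E ->
  measurable_fun setT u /\ (\int[mu]_x (u x ^+ 2)%:E < +oo)%E.
Proof.
rewrite inE => /andP[] /[!inE] mu_ fin; split => //.
by rewrite -Lqnorm2_sqr poweR_lty.
Qed.

(* Splitting [v ^+ 2] at the level [M * r], the part above it is controlled by
   the [q]-th moment. *)
Lemma small_ball (q L M r : R) (v : T -> R) :
  2 < q -> 0 < L -> 0 < r -> 0 < M -> M `^ (q - 2) = 2 * L `^ q ->
  measurable_fun setT v ->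
  (\int[mu]_x (v x ^+ 2)%:E = (r ^+ 2)%:E)%E ->
  (Lqnorm mu q v <= L%:E * Lqnorm mu 2 v)%E ->
  1 / 2 <= (\int[mu]_x Num.min ((v x / r) ^+ 2) (M ^+ 2))%R.
Proof.
move=> q2 L0 r0 M0 Mq mv v2 vq.
have q0 : 0 < q by lra.
have qn0 : q != 0 by rewrite gt_eqF.
have moment : (\int[mu]_x (`|v x| `^ q)%:E <= ((L * r) `^ q)%:E)%E.
  rewrite -Lqnorm_powR// -poweR_EFin; apply: gt0_ler_poweR => //.
  - exact: ltW.
  - by rewrite in_itv/= leey andbT; exact: Lnorm_ge0.
  - by rewrite in_itv/= leey andbT lee_fin mulr_ge0// ltW.
  - apply: le_trans vq _; rewrite EFinM; apply: lee_wpmul2l.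
      by rewrite lee_fin ltW.
    by rewrite Lqnorm2_le ?v2// ltW.
have mvr : measurable_fun setT (fun x => (v x / r) ^+ 2).
  by apply: measurable_funX; exact: measurable_funM.
have mmin : measurable_fun setT (fun x => Num.min ((v x / r) ^+ 2) (M ^+ 2)).
  exact: measurable_minr.
have min_itv x : 0 <= Num.min ((v x / r) ^+ 2) (M ^+ 2) <= M ^+ 2.
  by rewrite le_min !sqr_ge0 ge_min lexx orbT.
have mvq : measurable_fun setT (fun x => (`|v x| `^ q)%:E).
  apply/measurable_EFinP; apply: (measurableT_comp (@measurable_powR R q)).
  exact: measurableT_comp.
(* Where [y = |v| / r] is above [M], [y^2 <= y^q / M^(q - 2)], and this is [k |v|^q] by the choice
   of [M]. As the [q]-th moment of [v] is at most [(L r)^q], the part lost by truncation is at most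
   [1 / 2]. *)
pose k := (2 * (L * r) `^ q)^-1.
have Lrq : 0 < (L * r) `^ q by rewrite powR_gt0// mulr_gt0.
have k0 : 0 <= k by rewrite invr_ge0 mulr_ge0// ltW.
have split x : (v x / r) ^+ 2 <=
    Num.min ((v x / r) ^+ 2) (M ^+ 2) + k * (`|v x| `^ q).
  have [h|h] := leP ((v x / r) ^+ 2) (M ^+ 2).
    by rewrite lerDl mulr_ge0// powR_ge0.
  apply: (@le_trans _ _ (k * (`|v x| `^ q))); last by rewrite lerDr sqr_ge0.
  pose y := `|v x| / r.
  have y0 : 0 <= y by rewrite divr_ge0// ltW.
  have yE : (v x / r) ^+ 2 = y ^+ 2.
    by rewrite /y !exprMn real_normK// num_real.
  have My : M <= y.
    by rewrite -(@ler_pXn2r _ 2)// ?nnegrE ?(ltW M0)// -yE ltW.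
  have yp : 0 < y by exact: lt_le_trans My.
  have -> : k * (`|v x| `^ q) = y `^ q / M `^ (q - 2).
    have -> : `|v x| = y * r by rewrite /y divfK// gt_eqF.
    rewrite Mq /k (powRM _ (ltW L0) (ltW r0)) (powRM _ y0 (ltW r0)).
    by field; rewrite !gt_eqF ?powR_gt0.
  rewrite yE.
  have -> : y `^ q = y `^ (q - 2) * y ^+ 2.
    rewrite -powR_mulrn// -powRD; first by congr powR; lra.
    by rewrite [y == 0]gt_eqF ?implybT.
  rewrite -mulrA mulrCA -[leLHS]mulr1 ler_wpM2l ?sqr_ge0//.
  rewrite ler_pdivlMr ?powR_gt0// mul1r ge0_ler_powR ?nnegrE//; lra.
have int1 : (\int[mu]_x ((v x / r) ^+ 2)%:E = 1)%E.
  under eq_integral do rewrite mulrC.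
  rewrite integral_sqr_scale// v2 -EFinM -exprMn mulVf ?gt_eqF// expr1n//.
have : (1 <= (\int[mu]_x Num.min ((v x / r) ^+ 2) (M ^+ 2))%R%:E +
    (k * (L * r) `^ q)%:E)%E.
  rewrite -int1 EFin_Rintegral; last exact: (itv_integrable _ mmin).
  apply: (@le_trans _ _ (\int[mu]_x ((Num.min ((v x / r) ^+ 2) (M ^+ 2))%:E +
      k%:E * (`|v x| `^ q)%:E))%E).
    apply: ge0_le_integral => //.
    - by move=> x _; rewrite lee_fin sqr_ge0.
    - exact/measurable_EFinP.
    - apply: emeasurable_funD; first exact/measurable_EFinP.
      exact: measurable_funeM.
    - by move=> x _; rewrite -EFinM -EFinD lee_fin.
  rewrite ge0_integralD//.
  - apply: leeD => //; rewrite ge0_integralZl ?lee_fin//.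
    by rewrite EFinM; apply: lee_wpmul2l => //; rewrite lee_fin.
  - by move=> x _; rewrite lee_fin; have /andP[] := min_itv x.
  - exact/measurable_EFinP.
  - by move=> x _; rewrite mule_ge0// lee_fin ?powR_ge0.
  - exact: measurable_funeM.
have -> : k * (L * r) `^ q = 1 / 2 by rewrite /k; field; rewrite gt_eqF.
by rewrite -EFinD lee_fin; lra.
Qed.

End norms.

(** * Independence of design and noise *)

Section regression.
Context {R : realType}.

Lemma preserving_integrable {d1 d2} {T1 : measurableType d1}
    {T2 : measurableType d2} (P1 : probability T1 R) (P2 : probability T2 R)
    (f : T1 -> T2) (g : T2 -> R) :
  measure_preserving P1 P2 f -> measurable_fun [set: T2] g ->
  P1.-integrable setT (EFin \o (g \o f)) ->
  P2.-integrable setT (EFin \o g) /\ (\int[P2]_y g y = \int[P1]_x g (f x))%R.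
Proof.
move=> Pf mg intgf; have [mf fP] := Pf.
have intg : P2.-integrable setT (EFin \o g).
  apply/integrableP; split; first exact/measurable_EFinP.
  rewrite (preserving_integral Pf)//=; last first.
    by apply/measurable_EFinP; exact: measurableT_comp.
  by have /integrableP[] := intgf.
split=> //; pose F : {mfun T1 >-> T2} :=
  HB.pack f (isMeasurableFun.Build _ _ _ _ f mf).
rewrite /Rintegral; congr fine.
rewrite -[RHS](@integral_distribution _ _ _ _ _ P1 F (EFin \o g))//.
  by apply: eq_measure_integral => A mA _; apply/esym; exact: fP.
exact/measurable_EFinP.
Qed.

Lemma integrable_sqr {d} {T : measurableType d} (P : probability T R)
    (g : T -> R) :
  measurable_fun setT g -> (\int[P]_x (g x ^+ 2)%:E < +oo)%E ->
  P.-integrable setT (EFin \o g).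
Proof.
move=> mg g2.
have i2 : P.-integrable setT (EFin \o (fun x => 1 + g x ^+ 2)).
  apply: integrable_add; first exact: integrable_cst.
  apply/integrableP; split.
    by apply/measurable_EFinP; exact: measurable_funX.
  by under eq_integral do rewrite gee0_abs ?lee_fin ?sqr_ge0//.
apply: le_integrable i2 => //; first exact/measurable_EFinP.
move=> x _ /=; rewrite lee_fin [leRHS]ger0_norm ?addr_ge0 ?sqr_ge0//.
rewrite -(real_normK (num_real (g x))).
have := sqr_ge0 (`|g x| - 1); have := sqr_ge0 `|g x|; rewrite sqrrB1.
by move: `|g x| => y; rewrite -mulr_natl; lra.
Qed.

Context {dO d : measure_display} {Omega : measurableType dO}
  {T : measurableType d}.
Variables (P : probability Omega R) (X : {RV P >-> T}) (Y W : {RV P >-> R}).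
Variable f0 : T -> R.
Hypothesis mf0 : measurable_fun setT f0.
Hypothesis YE : forall w, Y w = f0 (X w) + W w.
Hypothesis EW : 'E_P[W]%E = 0%E.
Hypothesis XW : independent X W.
Variable sigma : R.
Hypothesis sigma0 : 0 <= sigma.
Hypothesis W2 : (Lqnorm P 2 W <= sigma%:E)%E.

Let mu := distribution P X.
Let nu := distribution P W.
Let pXY := distribution P (RV_pair X Y).

Let preserving_W : measure_preserving P nu W.
Proof. by split. Qed.

Lemma noise_sqr : (\int[nu]_w (w ^+ 2)%:E <= (sigma ^+ 2)%:E)%E.
Proof.
rewrite (preserving_integral preserving_W).
- by rewrite -Lqnorm2_le.
- by apply/measurable_EFinP; exact: measurable_funX.
- by move=> w; rewrite lee_fin sqr_ge0.
Qed.

Let intnu : nu.-integrable setT (EFin \o id).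
Proof. by apply: integrable_sqr => //; exact: le_lt_trans noise_sqr (ltry _). Qed.

Let nu_mean : (\int[nu]_w w)%R = 0.
Proof.
have intW : P.-integrable setT (EFin \o (id \o W)).
  apply: integrable_sqr; first exact: measurable_funP.
  by apply: (@le_lt_trans _ _ (sigma ^+ 2)%:E); [rewrite -Lqnorm2_le|exact: ltry].
have [_ ->] := preserving_integrable preserving_W (@measurable_id _ _ setT) intW.
by move: EW; rewrite unlock /Rintegral => ->.
Qed.

Lemma preserving_design_noise :
  measure_preserving P (mu \x nu)%E (fun w => (X w, W w)).
Proof.
split=> [|A mA]; first by apply: measurable_fun_pair; exact: measurable_funP.
apply/esym.
apply: (@product_measure_unique _ _ _ _ R mu nu (distribution P (RV_pair X W))) => //.
Qed.

Let mPhi : measurable_fun setT (fun x : T * R => (x.1, f0 x.1 + x.2)).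
Proof.
apply: measurable_fun_pair => //; apply: measurable_funD => //.
exact: measurableT_comp.
Qed.

Lemma preserving_regression :
  measure_preserving (mu \x nu)%E pXY (fun x => (x.1, f0 x.1 + x.2)).
Proof.
split=> // A mA.
have [_ <-] := preserving_design_noise; last first.
  by rewrite -[X in measurable X]setTI; exact: mPhi.
rewrite /pXY /distribution /pushforward; congr (P _).
by apply/seteqP; split => w /=; rewrite /RV_pair YE.
Qed.

(** The cross term vanishes because the noise is centred and independent of the design. Consequently
    the risk bound of the theorem is its norm bound, and any risk minimizer agrees with [f0] almost
    everywhere. *)
Lemma risk_split (g : T -> R) : measurable_fun setT g ->
  (risk X Y g =
    \int[nu]_w (w ^+ 2)%:E + \int[mu]_x ((g x - f0 x) ^+ 2)%:E)%E.
Proof.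
move=> mg; rewrite /risk unlock.
have mF : measurable_fun setT
    (fun x : T * R => ((x.2 + (f0 x.1 - g x.1)) ^+ 2)%:E).
  apply/measurable_EFinP; apply: measurable_funX; apply: measurable_funD => //.
  by apply: measurable_funB; exact: measurableT_comp.
transitivity (\int[(mu \x nu)%E]_x ((x.2 + (f0 x.1 - g x.1)) ^+ 2)%:E)%E.
  rewrite (preserving_integral preserving_design_noise mF); last first.
    by move=> x; rewrite lee_fin sqr_ge0.
  by apply: eq_integral => w _ /=; rewrite YE; congr EFin; ring.
rewrite (fubini_tonelli1 _ mF); last by move=> x; rewrite lee_fin sqr_ge0.
have nu2y : (\int[nu]_w (w ^+ 2)%:E < +oo)%E by exact: le_lt_trans noise_sqr (ltry _).
under eq_integral => x _.
  rewrite [fubini_F _ _ _](@integral_sqr_shift _ _ _ nu id (f0 x - g x))//.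
  over.
rewrite ge0_integralD//=; last 3 first.
- by move=> x _; apply: integral_ge0 => w _; rewrite lee_fin sqr_ge0.
- by move=> x _; rewrite lee_fin sqr_ge0.
- by apply/measurable_EFinP; apply: measurable_funX; exact: measurable_funB.
rewrite integral_prob_cst; congr (_ + _)%E.
by apply: eq_integral => x _; congr EFin; ring.
Qed.

Lemma ae_eq_sqr_integral0 (g h : T -> R) :
  measurable_fun setT g -> measurable_fun setT h ->
  (\int[mu]_x ((g x - h x) ^+ 2)%:E <= 0)%E -> {ae mu, forall x, g x = h x}.
Proof.
move=> mg mh gh0.
have m2 : measurable_fun setT (fun x => ((g x - h x) ^+ 2)%:E).
  by apply/measurable_EFinP; apply: measurable_funX; exact: measurable_funB.
have : (\int[mu]_x `|((g x - h x) ^+ 2)%:E| = 0)%E.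
  apply/eqP; rewrite eq_le integral_ge0// andbT.
  by under eq_integral do rewrite gee0_abs ?lee_fin ?sqr_ge0//.
move/(ae_eq_integral_abs _ measurableT m2); apply: filterS => x /(_ I)[] /eqP.
by rewrite sqrf_eq0 subr_eq0 => /eqP.
Qed.

Section multiplier.
Variables (h v : T -> R).
Hypothesis mh : measurable_fun setT h.
Hypothesis mv : measurable_fun setT v.
Hypothesis hf0 : {ae mu, forall x, h x = f0 x}.
Hypothesis v2 : (\int[mu]_x (v x ^+ 2)%:E < +oo)%E.

Let zeta (z : T * R) := v z.1 * (h z.1 - z.2).
Let zetaPhi (x : T * R) := v x.1 * (h x.1 - (f0 x.1 + x.2)).

Let mzeta : measurable_fun setT zeta.
Proof.
apply: measurable_funM; first exact: measurableT_comp.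
by apply: measurable_funB => //; exact: measurableT_comp.
Qed.

Let mzetaPhi : measurable_fun setT zetaPhi.
Proof. exact: (measurableT_comp mzeta mPhi). Qed.

Let nu2y : (\int[nu]_w (w ^+ 2)%:E < +oo)%E.
Proof. exact: le_lt_trans noise_sqr (ltry _). Qed.

(** For almost every design point [zeta] is [- v(X) W], so its second moment factorizes. The
    identity is only almost everywhere because [h] stands for a risk minimizer, which may differ
    from [f0] on a null set. *)
Lemma multiplier_sqr :
  (\int[pXY]_z (zeta z ^+ 2)%:E <=
    \int[mu]_x (v x ^+ 2)%:E * (sigma ^+ 2)%:E)%E.
Proof.
have mF : measurable_fun setT (fun x => (zetaPhi x ^+ 2)%:E).
  by apply/measurable_EFinP; exact: measurable_funX.
have mv2 : measurable_fun setT (fun x => (v x ^+ 2)%:E).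
  by apply/measurable_EFinP; exact: measurable_funX.
rewrite (preserving_integral preserving_regression); last 2 first.
- by apply/measurable_EFinP; exact: measurable_funX.
- by move=> z; rewrite lee_fin sqr_ge0.
rewrite (fubini_tonelli1 _ mF); last by move=> x; rewrite lee_fin sqr_ge0.
rewrite -ge0_integralZr ?lee_fin ?sqr_ge0//; last first.
  by move=> x _; rewrite lee_fin sqr_ge0.
apply: ae_ge0_le_integral => //.
- by move=> x _; apply: integral_ge0 => w _; rewrite lee_fin sqr_ge0.
- apply: (measurable_fun_fubini_tonelli_F _ mF) => x.
  by rewrite lee_fin sqr_ge0.
- by move=> x _; rewrite mule_ge0// lee_fin sqr_ge0.
- exact: emeasurable_funM.
apply: filterS hf0 => x hx _; rewrite /fubini_F /zetaPhi /=.
rewrite (_ : (fun w => _) = fun w => ((v x ^+ 2)%:E * (w ^+ 2)%:E)%E).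
  rewrite ge0_integralZl//.
  - by apply: lee_wpmul2l noise_sqr; rewrite lee_fin sqr_ge0.
  - by apply/measurable_EFinP; exact: measurable_funX.
  - by move=> w _; rewrite lee_fin sqr_ge0.
  - by rewrite lee_fin sqr_ge0.
by apply/funext => w; rewrite hx -EFinM; congr EFin; ring.
Qed.

Lemma multiplier_integrable : pXY.-integrable setT (EFin \o zeta).
Proof.
apply: integrable_sqr => //; apply: le_lt_trans multiplier_sqr _.
have I0 : (0 <= \int[mu]_x (v x ^+ 2)%:E)%E.
  by apply: integral_ge0 => x _; rewrite lee_fin sqr_ge0.
by apply: lte_mul_pinfty; rewrite ?ltry ?ge0_fin_numE.
Qed.

Lemma multiplier_mean : (\int[pXY]_z zeta z)%R = 0.
Proof.
have intPhi : (mu \x nu)%E.-integrable setT (EFin \o zetaPhi).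
  apply/integrableP; split; first exact/measurable_EFinP.
  have /integrableP[_] := multiplier_integrable.
  rewrite (preserving_integral preserving_regression)//.
  by apply: measurableT_comp => //; exact/measurable_EFinP.
have [_ ->] := preserving_integrable preserving_regression mzeta intPhi.
rewrite /Rintegral -(integral12_prod_meas1 intPhi).
rewrite (ae_eq_integral (fun=> 0%E)) ?integral0//.
  exact: (measurable_fubini_F intPhi).
apply: filterS hf0 => x hx _; rewrite /fubini_F /=.
rewrite (_ : (fun w => (zetaPhi (x, w))%:E) = EFin \o (fun w => (- v x) * w)).
  rewrite -EFin_Rintegral; last exact: integrable_scale.
  by rewrite RintegralZl// nu_mean mulr0.
by apply/funext => w; rewrite /zetaPhi /= hx; congr EFin; ring.
Qed.

End multiplier.

End regression.

(** * Consequences of the complexity parameters *)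

Section complexity_bounds.
Context {R : realType}.

(* The factor [2] turns the outer expectation, an infimum, into the integral of
   a majorant; [a] passes from the radius at which the complexity is controlled
   to a larger one. *)
Lemma rademacher_majorant {d} {Z : measurableType d} (P : probability Z R)
    (N : nat) (H H' : set (Z -> R)) (a b : R) :
  (0 < N)%N -> 0 < a -> 0 < b ->
  (forall v, H v -> H' (fun z => a * v z)) ->
  (rademacher_sup N P H' <= b%:E)%E ->
  exists G : N.-tuple (Z * bool) -> \bar R,
    [/\ measurable_fun setT G,
        forall v (w : N.-tuple (Z * bool)), H v ->
          ((\sum_(i < N) (-1) ^+ (tnth w i).2 * v (tnth w i).1)%:E <= G w)%E &
        (\int[iid_law (rademacher P) N]_w G w <=
          (Num.sqrt N%:R / a * (2 * b))%:E)%E].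
Proof.
move=> N0 a0 b0 HH' Pb; have sN : 0 < Num.sqrt (N%:R : R) by rewrite sqrtr_gt0 ltr0n.
have : (rademacher_sup N P H' < (2 * b)%:E)%E.
  by apply: le_lt_trans Pb _; rewrite lte_fin; lra.
move=> /ereal_inf_lt[_ [g [mg gH] <-]] gb.
have g0 w : (0 <= g w)%E by have [] := gH w.
have sNE : (0 <= (Num.sqrt N%:R / a : R)%:E)%E.
  by rewrite lee_fin divr_ge0// ltW.
exists (fun w => (Num.sqrt N%:R / a)%:E * g w)%E; split.
- exact: measurable_funeM.
- move=> v w Hv; have [_ supg] := gH w.
  set S := \sum_(i < N) _.
  have Sg : (`|(Num.sqrt N%:R)^-1 * (a * S)|%:E <= g w)%E.
    apply: le_trans supg; apply: ereal_sup_ubound.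
    exists (fun z => a * v z); first exact: HH'.
    rewrite /S [a * _]mulr_sumr; congr (`|_ * _|%:E).
    by apply: eq_bigr => i _; rewrite mulrCA.
  apply: le_trans (lee_wpmul2l sNE Sg).
  have -> : (Num.sqrt N%:R)^-1 * (a * S) = (Num.sqrt N%:R / a)^-1 * S.
    by field; rewrite !gt_eqF.
  have sNa : 0 < Num.sqrt N%:R / a :> R by rewrite divr_gt0.
  move: sNa; move: (Num.sqrt N%:R / a) => k k0.
  rewrite -EFinM lee_fin normrM [`|_^-1|]ger0_norm ?invr_ge0 ?(ltW k0)//.
  by rewrite mulVKf ?gt_eqF// ler_norm.
- rewrite ge0_integralZl// (EFinM (_ / _)); apply: lee_wpmul2l => //.
  exact: ltW.
Qed.

Lemma ln2_ge_half : 1 / 2 <= ln (2 : R).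
Proof.
rewrite -[leLHS]expRK ler_ln ?posrE ?expR_gt0//.
have -> : 1 / 2 = 2%:R * (1 / 4) :> R by lra.
rewrite expRM_natl.
apply: (@le_trans _ _ ((1 + 1 / 4 + (1 / 4) ^+ 2) ^+ 2)); last by lra.
have q : expR (1 / 4 : R) <= 1 + 1 / 4 + (1 / 4) ^+ 2 by exact: expR_le_quadratic.
by rewrite lerXn2r ?nnegrE ?expR_ge0//; lra.
Qed.

Context {d : measure_display} {T : measurableType d}.
Variables (mu : probability T R) (F : set (T -> R)) (h : T -> R).

Lemma packing_ge2 (H : set (T -> R)) (e : R) (u v : T -> R) :
  H u -> H v -> 0 <= e ->
  ((e ^+ 2)%:E <= \int[mu]_x ((u x - v x) ^+ 2)%:E)%E ->
  (2%:E <= packing mu H e)%E.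
Proof.
move=> Hu Hv e0 uv; apply: ereal_sup_ubound; exists 2%N => //.
exists (fun i : 'I_2 => if i == ord0 then u else v); split.
  by move=> i; case: ifP.
move=> i j; rewrite Lqnorm2_ge//.
case: (i =P ord0) => [->|/eqP i0]; case: (j =P ord0) => [->|/eqP j0].
- by rewrite eqxx.
- by move=> _.
- move=> _; rewrite (eq_integral (fun x => ((u x - v x) ^+ 2)%:E))// => x _.
  by rewrite /= -sqrrN opprB.
- have ord1 (k : 'I_2) : k != ord0 -> k = ord_max.
    by case: k => -[|[|//]] // ? _; exact: val_inj.
  by rewrite (ord1 i)// (ord1 j)// eqxx.
Qed.

(** One separated pair gives a packing number of at least two, so an upper bound on the entropy,
    which is proportional to [N], turns into a lower bound on [N]. *)
Lemma lne_packing_ge (H : set (T -> R)) (e b : R) (u v : T -> R) :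
  H u -> H v -> 0 <= e ->
  ((e ^+ 2)%:E <= \int[mu]_x ((u x - v x) ^+ 2)%:E)%E ->
  (lne (packing mu H e) <= b%:E)%E -> 1 / 2 <= b.
Proof.
move=> Hu Hv e0 uv pb; apply: le_trans ln2_ge_half _.
rewrite -lee_fin -lne_EFin//; apply: le_trans pb.
have p2 := packing_ge2 Hu Hv e0 uv.
rewrite lee_lne// in_itv/= leey andbT ?lee_fin//.
by apply: le_trans p2; rewrite lee_fin.
Qed.

Hypothesis Fh : F h.
Hypothesis mF : forall f, F f -> measurable_fun setT f.

Lemma local_class0 (r : R) : 0 <= r -> local_class mu F h r (cst 0).
Proof.
move=> r0; split.
  exists 0, (h \- h); split; first by rewrite lexx ler01.
    by exists h.
  by apply/funext => x /=; rewrite mul0r mulr0 addr0.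
rewrite /= Lqnorm2_le//.
under eq_integral do rewrite expr0n.
by rewrite integral0 lee_fin sqr_ge0.
Qed.

Lemma local_class_sub (r : R) v : local_class mu F h r v ->
  exists l f, [/\ 0 <= l <= 1, F f & v = (fun x => l * (f x - h x))].
Proof.
move=> [[l [_ [l01 [f Ff <-] ->]]] _]; exists l, f; split => //.
by apply/funext => x /=; rewrite mulr0 addr0.
Qed.

Lemma local_classI (r l : R) f : 0 <= r -> 0 <= l <= 1 -> F f ->
  (\int[mu]_x ((l * (f x - h x)) ^+ 2)%:E <= (r ^+ 2)%:E)%E ->
  local_class mu F h r (fun x => l * (f x - h x)).
Proof.
move=> r0 l01 Ff lf; split; last by rewrite /= Lqnorm2_le.
exists l, (f \- h); split => //; first by exists f.
by apply/funext => x /=; rewrite mulr0 addr0.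
Qed.

Lemma measurable_local_class (r : R) v :
  local_class mu F h r v -> measurable_fun setT v.
Proof.
move=> /local_class_sub[l [f [_ Ff ->]]].
apply: (measurableT_comp (mulrl_measurable _)).
by apply: measurable_funB; exact: mF.
Qed.

(** Star-shape about zero: shrinking stays in the class, so a complexity bound known at some radius
    below [r] can be used for the class of radius [r]. *)
Lemma local_class_scale (r r' : R) v : 0 < r' -> r' <= r ->
  local_class mu F h r v -> local_class mu F h r' (fun x => r' / r * v x).
Proof.
move=> r'0 r'r Lv; have r0 : 0 < r by exact: lt_le_trans r'r.
have mv := measurable_local_class Lv.
have [_ /=] := Lv; rewrite (Lqnorm2_le _ _ (ltW r0)) => v2.
have [l [f [/andP[l0 l1] Ff vE]]] := local_class_sub Lv.
rewrite (_ : (fun x => _) = (fun x => (r' / r * l) * (f x - h x))); last first.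
  by apply/funext => x; rewrite vE mulrA.
apply: local_classI => //; first exact: ltW.
  have k0 : 0 <= r' / r by rewrite divr_ge0 ?(ltW r0) ?(ltW r'0).
  have k1 : r' / r <= 1 by rewrite ler_pdivrMr// mul1r.
  by rewrite mulr_ge0//= -[leRHS]mulr1 ler_pM.
rewrite (eq_integral (fun x => ((r' / r * v x) ^+ 2)%:E)); last first.
  by move=> x _; rewrite vE mulrA.
rewrite integral_sqr_scale//.
apply: (@le_trans _ _ (((r' / r) ^+ 2)%:E * (r ^+ 2)%:E)%E).
  by apply: lee_wpmul2l => //; rewrite lee_fin sqr_ge0.
by rewrite -EFinM lee_fin -exprMn divfK// gt_eqF.
Qed.

Lemma local_class_far (r rho : R) f : 0 < r -> r <= rho -> F f ->
  (\int[mu]_x ((f x - h x) ^+ 2)%:E = (rho ^+ 2)%:E)%E ->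
  local_class mu F h r (fun x => r / rho * (f x - h x)) /\
  (\int[mu]_x ((r / rho * (f x - h x)) ^+ 2)%:E = (r ^+ 2)%:E)%E.
Proof.
move=> r0 rrho Ff f2; have rho0 : 0 < rho by exact: lt_le_trans rrho.
have mfh : measurable_fun setT (fun x => f x - h x).
  by apply: measurable_funB; exact: mF.
have E : (\int[mu]_x ((r / rho * (f x - h x)) ^+ 2)%:E = (r ^+ 2)%:E)%E.
  by rewrite integral_sqr_scale// f2 -EFinM -exprMn divfK// gt_eqF.
split=> //; apply: local_classI => //; first exact: ltW.
  by rewrite divr_ge0 ?(ltW r0) ?(ltW rho0)//= ler_pdivrMr// mul1r.
by rewrite E.
Qed.

End complexity_bounds.

(** * Simultaneous control of the quadratic and multiplier sums *)

Section good_event.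
Context {R : realType}.

Lemma probability_setI_ge {dB} {B : measurableType dB} (Q : probability B R)
    (A1 A2 : set B) (a1 a2 : R) : measurable A1 -> measurable A2 ->
  ((1 - a1)%:E <= Q A1)%E -> ((1 - a2)%:E <= Q A2)%E ->
  ((1 - (a1 + a2))%:E <= Q (A1 `&` A2))%E.
Proof.
move=> mA1 mA2.
have finQ A : measurable A -> (Q A = (fine (Q A))%:E)%E.
  by move=> mA; rewrite fineK//; exact: fin_num_measure.
have QC A : measurable A -> fine (Q (~` A)) = 1 - fine (Q A).
  by move=> mA; rewrite probability_setC// {1}finQ.
have mI : measurable (A1 `&` A2) by exact: measurableI.
have : (Q (~` (A1 `&` A2)) <= Q (~` A1) + Q (~` A2))%E.
  by rewrite setCI; apply: measureU2; exact: measurableC.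
rewrite (finQ _ (measurableC mI)) (finQ _ (measurableC mA1)) (finQ _ (measurableC mA2)).
rewrite (finQ _ mI) (finQ _ mA1) (finQ _ mA2) -EFinD !lee_fin !QC//; lra.
Qed.

Definition sqr_trunc (M x : R) : R := Num.min (x ^+ 2) (M ^+ 2).

Lemma sqr_trunc_itv M x : 0 <= sqr_trunc M x <= M ^+ 2.
Proof. by rewrite le_min !sqr_ge0 ge_min lexx orbT. Qed.

(** The truncated square is the square of [min (M, |x|)], a 1-Lipschitz function with values in
    [[0, M]]. *)
Lemma sqr_trunc_lip M x y : 0 <= M ->
  `|sqr_trunc M x - sqr_trunc M y| <= 2 * M * `|x - y|.
Proof.
move=> M0.
have truncE (z : R) : sqr_trunc M z = (Num.min M `|z|) ^+ 2.
  rewrite /sqr_trunc -(real_normK (num_real z)); have [h|h] := leP M `|z|.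
    by rewrite min_r// ler_pXn2r ?nnegrE.
  by rewrite min_l// ler_pXn2r ?nnegrE// ltW.
have le_itv (z : R) : 0 <= Num.min M `|z| <= M by rewrite le_min M0/= normr_ge0 ge_min lexx.
rewrite !truncE subr_sqr normrM mulrC; apply: ler_pM => //.
  rewrite ger0_norm; last by have /andP[? _] := le_itv x; have /andP[? _] := le_itv y; rewrite addr_ge0.
  by have /andP[_] := le_itv x; have /andP[_] := le_itv y; lra.
by apply: le_trans (min_lip _ _ _) _; exact: ler_dist_dist.
Qed.

Lemma measurable_sqr_trunc M : measurable_fun setT (sqr_trunc M).
Proof. by apply: measurable_minr => //; exact: measurable_funX. Qed.

Context {d : measure_display} {T : measurableType d}.
Variables (mu : probability T R) (pXY : probability (T * R)%type R).
Variables (F : set (T -> R)) (h : T -> R) (r sigma M : R).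
Hypothesis mufst : measure_preserving pXY mu fst.
Hypothesis Fh : F h.
Hypothesis mF : forall f, F f -> measurable_fun setT f.
Hypotheses (r0 : 0 < r) (M0 : 0 < M).

Let LC := local_class mu F h r.
Definition truncated_sqr (v : T -> R) (z : T * R) : R := sqr_trunc M (v z.1 / r).
Definition multiplier (v : T -> R) (z : T * R) : R := v z.1 * (h z.1 - z.2).

Lemma measurable_truncated_sqr v :
  measurable_fun setT v -> measurable_fun setT (truncated_sqr v).
Proof.
move=> mv; apply: (measurableT_comp (measurable_sqr_trunc M)).
by apply: measurable_funM => //; exact: measurableT_comp.
Qed.

(** Domination is indexed by a type with a marked point; here the localized class and its zero
    function. *)
Let U := {v : T -> R | LC v}.
Let u0 : U := exist _ (cst 0) (local_class0 mu Fh (ltW r0)).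

Let quad (u : U) := truncated_sqr (sval u).
Let lin (u : U) (x : T) := 2 * M / r * sval u x.
Let mult (u : U) := multiplier (sval u).

Let mU (u : U) : measurable_fun setT (sval u).
Proof. exact: (measurable_local_class Fh mF (proj2_sig u)). Qed.

Let int_quad (u : U) : pXY.-integrable setT (EFin \o quad u).
Proof.
apply: (itv_integrable _ (measurable_truncated_sqr (mU u))) => z.
exact: sqr_trunc_itv.
Qed.

Let quad0 z : quad u0 z = 0.
Proof.
by rewrite /quad /truncated_sqr /sqr_trunc /= mul0r expr0n/= min_l// sqr_ge0.
Qed.

Let lin0 x : lin u0 x = 0. Proof. by rewrite /lin mulr0. Qed.

(** Contraction replaces truncated squares by linear functions, then projecting away the response
    leads to the process of [r_E], which involves [mu] only. *)
Let dom_quad : dominated u0 (rademacher pXY) (signed quad) (rademacher mu) (signed lin).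
Proof.
have M2 : 0 < 2 * M by rewrite mulr_gt0.
pose lin1 (u : U) (z : T * R) := lin u z.1.
pose phi (x : R) := sqr_trunc M ((2 * M)^-1 * x).
have contr : dominated u0 (rademacher pXY)
    (signed (fun u z => phi (lin1 u z))) (rademacher pXY) (signed lin1).
  apply: dominated_contraction.
  - apply: (measurableT_comp (measurable_sqr_trunc M)).
    exact: mulrl_measurable.
  - move=> x y; apply: le_trans (sqr_trunc_lip _ _ (ltW M0)) _.
    by rewrite -mulrBr normrM ger0_norm ?invr_ge0 ?(ltW M2)// mulVKf ?gt_eqF.
  - by rewrite /phi mulr0 /sqr_trunc expr0n/= min_l// sqr_ge0.
  - by move=> z; exact: lin0.
have -> : quad = fun u z => phi (lin1 u z).
  apply/funext => u; apply/funext => z; rewrite /quad /truncated_sqr.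
  by rewrite /phi /lin1 /lin; congr (sqr_trunc _ _); field; rewrite !gt_eqF.
apply: dominated_trans contr _.
have pid : measure_preserving (bernoulli_prob (2^-1 : R)) (bernoulli_prob 2^-1) id.
  by split.
have signed0 w : signed lin u0 w = 0 by rewrite /signed lin0 mulr0.
exact: (dominated_preserving signed0 (preserving_prod mufst pid)).
Qed.

(** Two uses of [block_deviation]: truncated squares with [s = 1 / 4] and [V = M^4], multipliers
    with [s = r^2 / 8] and [V = r^2 sigma^2]. The four numerical hypotheses are its conditions
    [64 V <= m s^2] and [128 t <= n m s] in these two cases. *)
Lemma good_event (N n m l : nat) (t1 t2 : R)
    (G1 : N.-tuple (T * bool) -> \bar R)
    (G2 : N.-tuple ((T * R) * bool) -> \bar R) :
  (n * m + l)%N = N -> (0 < n)%N -> (0 < m)%N ->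
  (forall v, LC v ->
    [/\ pXY.-integrable setT (EFin \o multiplier v),
        (\int[pXY]_z multiplier v z)%R = 0 &
        (\int[pXY]_z (multiplier v z ^+ 2)%:E <= (r ^+ 2 * sigma ^+ 2)%:E)%E]) ->
  measurable_fun setT G1 ->
  (forall v (w : N.-tuple (T * bool)), LC v ->
    ((\sum_(i < N) (-1) ^+ (tnth w i).2 * v (tnth w i).1)%:E <= G1 w)%E) ->
  (\int[iid_law (rademacher mu) N]_w G1 w <= t1%:E)%E ->
  measurable_fun setT G2 ->
  (forall v (w : N.-tuple ((T * R) * bool)), LC v ->
    ((\sum_(i < N) (-1) ^+ (tnth w i).2 * multiplier v (tnth w i).1)%:E <= G2 w)%E) ->
  (\int[iid_law (rademacher pXY) N]_w G2 w <= t2%:E)%E ->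
  1024 * M ^+ 4 <= m%:R -> 4096 * sigma ^+ 2 <= m%:R * r ^+ 2 ->
  1024 * M * t1 <= n%:R * m%:R * r -> 1024 * t2 <= n%:R * m%:R * r ^+ 2 ->
  exists C : set (n.-tuple (m.-tuple (T * R))),
    [/\ measurable C,
        ((1 - 2 * expR (- (n%:R / 3072)))%:E <= iid_law (iid_law pXY m) n C)%E &
        forall b v, C b -> LC v ->
          (4 * #|[pred j : 'I_n | (m%:R / 4 <= `|\sum_(i < m)
             (truncated_sqr v (tnth (tnth b j) i) -
              \int[pXY]_z truncated_sqr v z)%R|)%R]| < n)%N /\
          (4 * #|[pred j : 'I_n | (m%:R * (r ^+ 2 / 8) <=
             `|\sum_(i < m) multiplier v (tnth (tnth b j) i)|)%R]| < n)%N].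
Proof.
move=> nml n0 m0 hmult mG1 G1v G1t mG2 G2v G2t mM ms nt1 nt2.
have Mr0 : 0 < 2 * M / r by rewrite divr_gt0// mulr_gt0.
have r20 : 0 < r ^+ 2 / 8 by rewrite divr_gt0// exprn_gt0.
have lin_w u (w : N.-tuple (T * bool)) :
    ((tuple_sum (signed lin) u w)%:E <= (2 * M / r)%:E * G1 w)%E.
  rewrite (_ : tuple_sum _ _ _ = 2 * M / r *
      \sum_(i < N) (-1) ^+ (tnth w i).2 * sval u (tnth w i).1).
    rewrite (EFinM (2 * M / r)); apply: lee_wpmul2l; first by rewrite lee_fin ltW.
    exact: G1v (proj2_sig u).
  rewrite /tuple_sum mulr_sumr; apply: eq_bigr => i _.
  by rewrite /signed /lin mulrCA.
have G10 w : (0 <= G1 w)%E.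
  apply: le_trans (G1v _ w (proj2_sig u0)); rewrite big1// => i _.
  by rewrite mulr0.
have [C1 [mC1 PC1 C1P]] : exists C : set (n.-tuple (m.-tuple (T * R))),
    [/\ measurable C,
        ((1 - expR (- (n%:R / 3072)))%:E <= iid_law (iid_law pXY m) n C)%E &
        forall b, C b -> forall u : U,
          (4 * #|[pred j : 'I_n | (m%:R * 4^-1 <=
             `|tuple_sum (fun u z => quad u z - \int[pXY]_z quad u z)%R u (tnth b j)|)%R]| < n)%N].
  apply: (@block_deviation _ _ u0 _ _ _ _ pXY mu quad lin int_quad quad0 lin0 dom_quad
    N n m l 4^-1 (M ^+ 4) (2 * M / r * t1) (fun w => (2 * M / r)%:E * G1 w)%E) => //.
  - move=> u; rewrite -[leRHS](integral_prob_cst pXY).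
    apply: ge0_le_integral => //.
    + by move=> z _; rewrite lee_fin sqr_ge0.
    + apply/measurable_EFinP; apply: measurable_funX; apply: measurable_funB => //.
      exact: measurable_truncated_sqr.
    move=> z _; rewrite lee_fin -(real_normK (num_real (quad u z - _))).
    have -> : M ^+ 4 = (M ^+ 2) ^+ 2 by rewrite -exprM.
    rewrite lerXn2r ?nnegrE ?sqr_ge0//.
    have /andP[q0 q1] : 0 <= quad u z <= M ^+ 2 by exact: sqr_trunc_itv.
    have /andP[e0 e1] : 0 <= (\int[pXY]_z quad u z)%R <= M ^+ 2.
      apply: Rintegral_itv => [|z']; first exact: measurable_truncated_sqr.
      exact: sqr_trunc_itv.
    by rewrite ler_norml; apply/andP; split; lra.
  - by move: mM; rewrite exprVn; lra.
  - exact: measurable_funeM.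
  - rewrite ge0_integralZl ?lee_fin ?(ltW Mr0)// (EFinM _ t1).
    by apply: lee_wpmul2l => //; rewrite lee_fin ltW.
  - rewrite (_ : 128 * _ = (1024 * M * t1) / r / 4); last by field; rewrite gt_eqF.
    by rewrite ler_wpM2r// ler_pdivrMr.
have mult0 z : mult u0 z = 0 by rewrite /mult /multiplier mul0r.
have int_mult (u : U) : pXY.-integrable setT (EFin \o mult u).
  by have [] := hmult _ (proj2_sig u).
have mean_mult (u : U) : (\int[pXY]_z mult u z)%R = 0.
  by have [] := hmult _ (proj2_sig u).
have dom_mult : dominated u0 (rademacher pXY) (signed mult)
    (rademacher pXY) (signed mult).
  by move=> dE E A G A0 mG AG; exists G.
have [C2 [mC2 PC2 C2P]] : exists C : set (n.-tuple (m.-tuple (T * R))),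
    [/\ measurable C,
        ((1 - expR (- (n%:R / 3072)))%:E <= iid_law (iid_law pXY m) n C)%E &
        forall b, C b -> forall u : U,
          (4 * #|[pred j : 'I_n | (m%:R * (r ^+ 2 / 8) <=
             `|tuple_sum (fun u z => mult u z - \int[pXY]_z mult u z)%R u (tnth b j)|)%R]| < n)%N].
  apply: (@block_deviation _ _ u0 _ _ _ _ pXY pXY mult mult int_mult mult0 mult0 dom_mult
    N n m l (r ^+ 2 / 8) (r ^+ 2 * sigma ^+ 2) t2 G2) => //.
  - move=> u; under eq_integral do rewrite mean_mult subr0.
    by have [] := hmult _ (proj2_sig u).
  - rewrite (_ : m%:R * _ = r ^+ 2 / 64 * (m%:R * r ^+ 2)); last by field.
    rewrite (_ : 64 * _ = r ^+ 2 / 64 * (4096 * sigma ^+ 2)); last by field.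
    by rewrite ler_wpM2l// divr_ge0// sqr_ge0.
  - by move=> u w; exact: G2v (proj2_sig u).
  - by move: nt2; lra.
exists (C1 `&` C2); split; first exact: measurableI.
- have := probability_setI_ge mC1 mC2 PC1 PC2.
  by congr (_ <= _)%E; congr EFin; ring.
- move=> b v [Cb1 Cb2] Lv; split.
    exact: (C1P b Cb1 (exist _ v Lv)).
  have := C2P b Cb2 (exist _ v Lv).
  congr (_ * _ < _)%N; apply: eq_card => j; rewrite !inE.
  by congr (_ <= `|_|); apply: eq_bigr => i _; rewrite mean_mult subr0.
Qed.

End good_event.

(** * The tournament *)

Section selection.
Context {R : realType}.

Lemma card_lt_majority n (A1 A2 A3 : pred 'I_n) :
  (4 * #|A1| < n)%N -> (4 * #|A2| < n)%N ->
  (forall j, ~~ A1 j -> ~~ A2 j -> A3 j) -> (n < 2 * #|A3|)%N.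
Proof.
move=> h1 h2 A123.
suff : (n <= #|A1| + #|A2| + #|A3|)%N.
  by move: h1 h2; rewrite !mulnE; lia.
rewrite -[leqLHS](card_ord n) -!sum1_card.
rewrite (big_mkcond A1) (big_mkcond A2) (big_mkcond A3) -!big_split /=.
apply: leq_sum => j _.
by case: (boolP (A1 j)) => // n1; case: (boolP (A2 j)) => // n2; rewrite A123.
Qed.

Context {d : measure_display} {T : measurableType d}.

Definition block_loss m (f : T -> R) (b : m.-tuple (T * R)) : R :=
  \sum_(i < m) (f (tnth b i).1 - (tnth b i).2) ^+ 2.

Lemma block_lossB m (f h v : T -> R) (k : R) (b : m.-tuple (T * R)) :
  (forall x, f x - h x = k * v x) ->
  block_loss f b - block_loss h b =
  k ^+ 2 * (\sum_(i < m) v (tnth b i).1 ^+ 2) +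
  2 * k * \sum_(i < m) multiplier h v (tnth b i).
Proof.
move=> fhv; rewrite /block_loss -sumrB !mulr_sumr -big_split /=.
apply: eq_bigr => i _; rewrite /multiplier.
rewrite -(subrK (h (tnth b i).1) (f (tnth b i).1)) fhv; ring.
Qed.

Definition accepted (F : set (T -> R)) (thr : R) n m
    (b : n.-tuple (m.-tuple (T * R))) (f : T -> R) : Prop :=
  F f /\ forall g, F g ->
    (n < 2 * #|[pred j | (- thr <= block_loss g (tnth b j) -
                                   block_loss f (tnth b j))%R]|)%N.

Variables (mu : probability T R) (pXY : probability (T * R)%type R).
Variables (F : set (T -> R)) (h : T -> R) (r M : R) (n m : nat).
Variable b : n.-tuple (m.-tuple (T * R)).
Hypothesis mufst : measure_preserving pXY mu fst.
Hypothesis Fh : F h.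
Hypothesis mF : forall f, F f -> measurable_fun setT f.
Hypothesis F2 : forall f, F f -> (\int[mu]_x ((f x - h x) ^+ 2)%:E < +oo)%E.
Hypotheses (r0 : 0 < r) (m0 : (0 < m)%N).
Hypothesis ball : forall v, local_class mu F h r v ->
  (\int[mu]_x (v x ^+ 2)%:E = (r ^+ 2)%:E)%E ->
  1 / 2 <= (\int[mu]_x sqr_trunc M (v x / r))%R.
Hypothesis good : forall v, local_class mu F h r v ->
  (4 * #|[pred j : 'I_n | (m%:R / 4 <= `|\sum_(i < m)
     (truncated_sqr r M v (tnth (tnth b j) i) -
      \int[pXY]_z truncated_sqr r M v z)%R|)%R]| < n)%N /\
  (4 * #|[pred j : 'I_n | (m%:R * (r ^+ 2 / 8) <=
     `|\sum_(i < m) multiplier h v (tnth (tnth b j) i)|)%R]| < n)%N.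

Let thr := m%:R * r ^+ 2 / 4.

Let m0R : 0 < m%:R :> R. Proof. by rewrite ltr0n. Qed.

(** Write [f - h = k v] with [k = rho / r] and [v] of norm [r]. On a block good for both sums,
    [k^2 sum v^2] exceeds [k^2 thr], and the linear term exceeds [- 2 k m r^2 / 8 = - k thr]. *)
Lemma far_block_loss f (rho : R) : F f -> r <= rho ->
  (\int[mu]_x ((f x - h x) ^+ 2)%:E = (rho ^+ 2)%:E)%E ->
  (n < 2 * #|[pred j | (thr * (rho / r * (rho / r - 1)) <
     block_loss f (tnth b j) - block_loss h (tnth b j))%R]|)%N.
Proof.
move=> Ff rrho f2; have rho0 : 0 < rho by exact: lt_le_trans rrho.
pose v x := r / rho * (f x - h x).
have [Lv v2] := local_class_far Fh mF r0 rrho Ff f2.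
have [g1 g2] := good Lv.
apply: (card_lt_majority g1 g2) => j /=.
rewrite -!ltNge -/v => q1 q2; pose k := rho / r.
have k0 : 0 < k by rewrite divr_gt0.
rewrite (@block_lossB _ f h v k); last first.
  by move=> x; rewrite /v /k; field; rewrite !gt_eqF.
have mv : measurable_fun setT v by exact: measurable_local_class Fh mF _ _ Lv.
have mean : 1 / 2 <= (\int[pXY]_z truncated_sqr r M v z)%R.
  have mtr : measurable_fun setT (fun x => sqr_trunc M (v x / r)).
    apply: (measurableT_comp (measurable_sqr_trunc M)).
    by apply: measurable_funM.
  have [_ mp] := mufst.
  have := ball Lv v2.
  rewrite /Rintegral (preserving_integral mufst) //.
  - exact/measurable_EFinP.
  - by move=> x; rewrite lee_fin; have /andP[] := sqr_trunc_itv M (v x / r).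
have sumsq : m%:R * r ^+ 2 / 4 < \sum_(i < m) v (tnth (tnth b j) i).1 ^+ 2.
  have tr : m%:R / 4 < \sum_(i < m) truncated_sqr r M v (tnth (tnth b j) i).
    move: q1; rewrite sumrB sumr_const card_ord ltr_norml => /andP[q1 _].
    have := ler_wpM2l (ltW m0R) mean.
    move: q1; move: (\sum_(_ < _) _) (\int[_]_z _)%R => s E.
    rewrite -[E *+ m]mulr_natl => q1 mE.
    have arith (a p : R) : - (a / 4) < s - p -> a * (1 / 2) <= p -> a / 4 < s by lra.
    exact: arith q1 mE.
  apply: (@lt_le_trans _ _ (r ^+ 2 *
      \sum_(i < m) truncated_sqr r M v (tnth (tnth b j) i))).
    rewrite (_ : m%:R * r ^+ 2 / 4 = r ^+ 2 * (m%:R / 4)); last by field.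
    by rewrite ltr_pM2l ?exprn_gt0.
  rewrite mulr_sumr; apply: ler_sum => i _.
  rewrite -ler_pdivlMl ?exprn_gt0// /truncated_sqr /sqr_trunc ge_min.
  by rewrite exprMn exprVn mulrC lexx.
move: q2 sumsq; rewrite ltr_norml => /andP[q2 _] sumsq.
have : k ^+ 2 * (m%:R * r ^+ 2 / 4) <
    k ^+ 2 * \sum_(i < m) v (tnth (tnth b j) i).1 ^+ 2.
  by rewrite ltr_pM2l ?exprn_gt0.
have : 2 * k * - (m%:R * (r ^+ 2 / 8)) <
    2 * k * \sum_(i < m) multiplier h v (tnth (tnth b j) i).
  by rewrite (ltr_pM2l (mulr_gt0 (ltr0Sn R 1) k0)).
rewrite -/k /thr.
move: (k ^+ 2 * \sum_(_ < _) _) (2 * k * \sum_(_ < _) _) => s1 s2.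
have -> : m%:R * r ^+ 2 / 4 * (k * (k - 1)) =
  k ^+ 2 * (m%:R * r ^+ 2 / 4) + 2 * k * - (m%:R * (r ^+ 2 / 8)) by field.
by move: (k ^+ 2 * _) (2 * k * _) => a1 a2; lra.
Qed.

Lemma rho_exists f : F f -> exists2 rho : R, 0 <= rho &
  (\int[mu]_x ((f x - h x) ^+ 2)%:E = (rho ^+ 2)%:E)%E.
Proof.
move=> Ff; have I0 : (0 <= \int[mu]_x ((f x - h x) ^+ 2)%:E)%E.
  by apply: integral_ge0 => x _; rewrite lee_fin sqr_ge0.
exists (Num.sqrt (fine (\int[mu]_x ((f x - h x) ^+ 2)%:E)%E)).
  exact: sqrtr_ge0.
by rewrite sqr_sqrtr ?fine_ge0// fineK// ge0_fin_numE// F2.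
Qed.

Lemma accepted_center : accepted F thr b h.
Proof.
split=> // g Fg; have [rho rho0 g2] := rho_exists Fg.
have thr0 : 0 <= thr by rewrite /thr divr_ge0// mulr_ge0 ?sqr_ge0// ltW.
have [rrho|rhor] := leP r rho.
  apply: leq_trans (far_block_loss Fg rrho g2) _; rewrite leq_pmul2l//.
  apply: subset_leq_card; apply/fintype.subsetP => j; rewrite !inE => /ltW.
  apply: le_trans; apply: (@le_trans _ _ 0); first by rewrite oppr_le0.
  rewrite mulr_ge0// mulr_ge0 ?divr_ge0// ?(ltW r0)// subr_ge0.
  by rewrite ler_pdivlMr// mul1r.
(* Closer than [r] the quadratic term is only known to be nonnegative; the linear term alone stays
   above [- 2 m r^2 / 8], which is exactly the tolerance. *)
have Lv : local_class mu F h r (fun x => 1 * (g x - h x)).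
  apply: local_classI => //; [exact: ltW|by rewrite ler01 lexx|].
  rewrite (eq_integral (fun x => ((g x - h x) ^+ 2)%:E)); last first.
    by move=> x _; rewrite mul1r.
  by rewrite g2 lee_fin lerXn2r ?nnegrE// ltW.
have [_ g2'] := good Lv.
apply: (card_lt_majority g2' g2') => j /= + _.
rewrite -ltNge => q2.
rewrite (@block_lossB _ g h (fun x => 1 * (g x - h x)) 1); last first.
  by move=> x; rewrite !mul1r.
move: q2; rewrite ltr_norml => /andP[q2 _].
have : 0 <= \sum_(i < m) (1 * (g (tnth (tnth b j) i).1 - h (tnth (tnth b j) i).1)) ^+ 2.
  by apply: sumr_ge0 => i _; exact: sqr_ge0.
rewrite /thr; move: q2; move: (\sum_(_ < _) _) (\sum_(_ < _) _) => s1 s2.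
rewrite expr1n mul1r mulr1.
have -> : m%:R * (r ^+ 2 / 8) = m%:R * r ^+ 2 / 4 / 2 by field.
by move: (m%:R * r ^+ 2 / 4) => a; lra.
Qed.

(** [h] is itself a competitor, so on a majority of blocks the excess loss of [f] is at most [thr].
    Beyond [2 r] it would exceed [2 thr] on another majority, and two majorities share a block. *)
Lemma accepted_near f : accepted F thr b f ->
  (\int[mu]_x ((f x - h x) ^+ 2)%:E <= ((2 * r) ^+ 2)%:E)%E.
Proof.
move=> [Ff fh]; have [rho rho0 f2] := rho_exists Ff.
rewrite f2 lee_fin lerXn2r ?nnegrE ?mulr_ge0 ?(ltW r0)//.
rewrite leNgt; apply/negP => rrho.
have thr0 : 0 < thr by rewrite /thr divr_gt0// mulr_gt0 ?exprn_gt0.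
have far := far_block_loss Ff _ f2.
have /far {}far : r <= rho by lra.
have := fh h Fh.
set A := [pred j | _]; set A' := [pred j | _] in far.
have disj : (#|A| + #|A'| <= n)%N.
  rewrite -[leqRHS](card_ord n) -!sum1_card (big_mkcond A) (big_mkcond A').
  rewrite -!big_split /=; apply: leq_sum => j _.
  case: ifP => h1; case: ifP => h2 //; exfalso.
  have x2 : 2 < rho / r by rewrite ltr_pdivlMr.
  have : thr * 2 <= thr * (rho / r * (rho / r - 1)).
    rewrite ler_pM2l//; have : 2 * (rho / r - 1) <= rho / r * (rho / r - 1).
      by rewrite ler_wpM2r ?subr_ge0; lra.
    lra.
  move: h1 h2; rewrite /A /A' /=.
  move: (block_loss h _) (block_loss f _) (thr * (_ * _)) => s1 s2 a.
  by lra.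
by move: far disj; rewrite !mulnE; lia.
Qed.

End selection.

Lemma preserving_sample {R : realType} {dO d} {Omega : measurableType dO}
    {T : measurableType d} (P : probability Omega R) (X : {RV P >-> T})
    (Y : {RV P >-> R}) (N : nat) (D : 'I_N -> {RV P >-> (T * R)%type}) :
  iid_sample X Y D ->
  measure_preserving P (iid_law (distribution P (RV_pair X Y)) N)
    (sample_value D).
Proof.
move=> [lawD indepD]; apply: preserving_iid => [|B mB].
  apply/measurable_fun_tnthP => i; rewrite (_ : _ \o _ = D i).
    exact: measurable_funP.
  by apply/funext => w /=; rewrite tnth_mktuple.
(* The index [None], which stands for [(X, Y)], is given the full space and contributes a factor
   one. *)
pose B' (i : option 'I_N) := if i is Some j then B j else setT.
have mB' i : xpredT i -> measurable (B' i) by case: i => [i|] _; [exact: (mB i)|exact: measurableT].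
have := indepD xpredT B' mB'.
rewrite (_ : \bigcap_(i in [set i | xpredT i]) _ =
    [set w | forall i, B i (tnth (sample_value D w) i)]); last first.
  apply/seteqP; split => w /=.
    by move=> h i; rewrite tnth_mktuple; exact: (h (Some i)).
  by move=> h [i|] _ //=; have := h i; rewrite tnth_mktuple.
move=> ->; rewrite (bigD1 None)//= preimage_setT probability_setT mul1e.
rewrite (reindex_omap Some id)/=; last by case.
rewrite (eq_bigl xpredT); last by move=> i; rewrite /= eqxx.
by apply: eq_bigr => i _; exact: (lawD i _ (mB i)).
Qed.

Lemma ae_integral_sqrB {R : realType} {d} {T : measurableType d}
    (mu : probability T R) (g h f0 : T -> R) :
  measurable_fun setT g -> measurable_fun setT h -> measurable_fun setT f0 ->
  {ae mu, forall x, h x = f0 x} ->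
  (\int[mu]_x ((g x - h x) ^+ 2)%:E = \int[mu]_x ((g x - f0 x) ^+ 2)%:E)%E.
Proof.
move=> mg mh mf0 hf0.
have m2 (k : T -> R) : measurable_fun setT k ->
    measurable_fun setT (fun x => ((g x - k x) ^+ 2)%:E).
  by move=> mk; apply/measurable_EFinP; apply: measurable_funX; exact: measurable_funB.
apply: ge0_ae_eq_integral => //.
- exact: m2.
- exact: m2.
- by move=> x _; rewrite lee_fin sqr_ge0.
- by move=> x _; rewrite lee_fin sqr_ge0.
by apply: filterS hf0 => x hx _; rewrite hx.
Qed.

(** The factor [2] in [r >= 2 r_star] makes the inequality with the infimum strict. This provides a
    true radius at most [r] satisfying the condition, although the infimum need not be attained. *)
Lemma ereal_inf_radius_lt {R : realType} (S : set R) (a : \bar R) (r : R) :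
  0 < r -> (ereal_inf [set x%:E | x in [set x : R | (0 < x)%R /\ S x]] <= a)%E ->
  (2%:E * a <= r%:E)%E -> exists x, [/\ 0 < x, x <= r & S x].
Proof.
move=> r0 infa ar.
have ar' : (a < r%:E)%E.
  move: ar; case: (a) => [b| |].
  - by rewrite -EFinM lee_fin lte_fin; lra.
  - by rewrite gt0_muley// lte_fin.
  - by rewrite ltNyr.
have /ereal_inf_lt[_ [x [x0 Sx] <-]] := le_lt_trans infa ar'.
by rewrite lte_fin => xr; exists x; split => //; exact: ltW.
Qed.

Lemma ereal_inf_radius_ge0 {R : realType} (S : set R) :
  (0 <= ereal_inf [set x%:E | x in [set x : R | (0 < x)%R /\ S x]])%E.
Proof.
apply: le_ereal_inf_tmp => _ [x [x0 _] <-]; rewrite lee_fin; exact: ltW.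
Qed.

Lemma span_local_class {R : realType} {d} {T : measurableType d}
    (mu : probability T R) (F : set (T -> R)) (h : T -> R) (r : R) v :
  F h -> local_class mu F h r v -> linear_span F v.
Proof.
move=> Fh /local_class_sub[l [f [_ Ff ->]]].
exists 2%N, (fun i => if i == ord0 then l else - l),
  (fun i => if i == ord0 then f else h); split.
  by move=> i; case: ifP.
apply/funext => x; rewrite !big_ord_recl big_ord0 /=; ring.
Qed.

(** * Explicit constants and their arithmetic *)

Section constants.
Context {R : realType} (q L : R).

(* The truncation level [M] of [small_ball]: [M^(q-2) = 2 L^q]. *)
Definition trunc_level : R := (2 * L `^ q) `^ (q - 2)^-1.
(** [good_event] asks for [m >= 1024 M^4] and [m >= 4096 sigma^2 / r^2]; as [M >= 1], this constant
    times [aspect] meets both. *)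
Definition block_const : R := 4096 * trunc_level ^+ 4.

(** With [C = block_const] there are at least [N / (4 C K)] blocks, so the failure exponent
    [n / 3072] is at least twice [N / (K sample_const)]. One half of it pays for the factor [2]
    before the exponential, the other is the final rate. *)
Definition sample_const : R := 24 * 1024 * block_const.

Hypotheses (hq : 2 < q) (hL : 1 < L).

Let Lq1 : 1 <= L `^ q.
Proof.
have h1 := hL; have h2 := hq.
rewrite -[leLHS](powRr0 L); apply: ler_powR; lra.
Qed.

Lemma trunc_level_powR : trunc_level `^ (q - 2) = 2 * L `^ q.
Proof.
rewrite /trunc_level -powRrM mulVf; last by rewrite gt_eqF// subr_gt0.
by rewrite powRr1// mulr_ge0// powR_ge0.
Qed.

Lemma trunc_level_ge1 : 1 <= trunc_level.
Proof.
have h1 := Lq1; have h2 := hq.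
rewrite /trunc_level -[leLHS](powRr0 (2 * L `^ q)); apply: ler_powR; first by lra.
by rewrite invr_ge0; lra.
Qed.

Lemma block_const_ge : 4096 * trunc_level <= block_const.
Proof.
have M1 := trunc_level_ge1; rewrite /block_const.
have M4 : trunc_level <= trunc_level ^+ 4.
  rewrite exprS ler_peMr//; first exact: le_trans ler01 M1.
  exact: exprn_ege1.
lra.
Qed.

Lemma block_const_ge1 : 1 <= block_const.
Proof.
by have h1 := block_const_ge; have h2 := trunc_level_ge1; lra.
Qed.

Lemma sample_const_gt0 : 0 < sample_const.
Proof. by have h1 := block_const_ge1; rewrite /sample_const; lra. Qed.

Lemma block_count (N : nat) (K : R) (m := (Num.truncn (block_const * K)).+1)
    (n := (N %/ m)%N) :
  1 <= K -> sample_const <= N%:R / K ->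
  [/\ block_const * K <= m%:R, (0 < n)%N, N%:R <= 2 * (n%:R * m%:R) :> R &
      2 * expR (- (n%:R / 3072)) <= expR (- (N%:R / K / sample_const))].
Proof.
move=> K1; rewrite /sample_const; have := block_const_ge1.
rewrite {}/n {}/m; move: block_const => C C1 CN.
set m := (Num.truncn _).+1; set n := (N %/ m)%N.
have CK0 : 0 <= C * K by apply: mulr_ge0; lra.
have mgt : C * K < m%:R by rewrite /m truncnS_gt.
have mle : m%:R <= 2 * (C * K).
  have : (Num.truncn (C * K))%:R <= C * K by rewrite truncn_le.
  have : 1 <= C * K by rewrite -[1]mul1r; apply: ler_pM.
  by rewrite /m -natr1; lra.
have K0 : 0 < K by lra.
have m0 : (0 < m)%N by [].
have NCK : (24 * 1024) * C * K <= N%:R by rewrite -ler_pdivlMr.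
have mN : (m <= N)%N.
  rewrite -(ler_nat R); apply: le_trans mle _; apply: le_trans NCK.
  by rewrite -mulrA ler_wpM2r//; lra.
have n0 : (0 < n)%N by rewrite /n divn_gt0.
have Nnm : (N <= 2 * (n * m))%N.
  apply: leq_trans (ltnW (ltn_ceil N m0)) _.
  by rewrite -/n mulSn mul2n -addnn leq_add2r leq_pmull.
have NnmR : N%:R <= 2 * (n%:R * m%:R) :> R.
  by rewrite -natrM -natrM ler_nat.
split => //; first exact: ltW.
have n0R : 0 <= n%:R :> R by rewrite ler0n.
pose x := N%:R / K / ((24 * 1024) * C).
have C0 : 0 < (24 * 1024) * C by lra.
have x1 : 1 <= x by rewrite /x ler_pdivlMr// mul1r.
have xn : 2 * x <= n%:R / 3072.
  have : n%:R * m%:R <= n%:R * (2 * (C * K)) by rewrite ler_wpM2l.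
  move=> nm; have NCKn : N%:R <= 4 * (n%:R * (C * K)) by lra.
  have -> : 2 * x = N%:R / ((12 * 1024) * (C * K)).
    by rewrite /x; field; rewrite !gt_eqF//; lra.
  rewrite ler_pdivrMr; last by apply: mulr_gt0; [lra|apply: mulr_gt0; lra].
  have -> : n%:R / 3072 * (12 * 1024 * (C * K)) = 4 * (n%:R * (C * K)) by field.
  exact: NCKn.
apply: (@le_trans _ _ (expR x * expR (- (2 * x)))).
  apply: ler_pM; rewrite ?expR_ge0//.
    by have := expR_ge1Dx x; lra.
  by rewrite ler_expR lerN2.
by rewrite -expRD ler_expR /x; lra.
Qed.

End constants.

Section complexity_arithmetic.
Context {R : realType}.
Variables (M S r s : R) (N n m : nat).
Hypotheses (M0 : 0 < M) (S0 : 0 < S) (r0 : 0 < r) (s0 : 0 < s).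
Hypothesis MS : 2048 * M <= S.
Hypothesis Nnm : N%:R <= 2 * (n%:R * m%:R) :> R.

Let NS : 1024 * M * (S^-1 * N%:R) <= n%:R * m%:R.
Proof.
rewrite mulrCA mulrC ler_pdivrMr//.
have nm0 : 0 <= n%:R * m%:R :> R by rewrite mulr_ge0.
move: nm0 Nnm MS; move: (n%:R * m%:R) (N%:R) => a b a0 ba MS'.
apply: (@le_trans _ _ (1024 * M * (2 * a))).
  by apply: ler_wpM2l ba; rewrite mulr_ge0 ?ler0n// ltW.
rewrite (_ : _ * (2 * _) = a * (2048 * M)); last by ring.
exact: ler_wpM2l MS'.
Qed.

Let sqrtN : Num.sqrt (N%:R : R) * Num.sqrt N%:R = N%:R.
Proof. by rewrite -expr2 sqr_sqrtr. Qed.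

(** The inner expression is the bound of [rademacher_majorant] for a complexity known at radius [s]
    with [c1 = 1 / (2 S)]. The radius [s] cancels, leaving [N r / S]; at least half of the sample
    lies in blocks, so [S >= 2048 M] is enough. *)
Lemma quad_complexity_le : 1024 * M * (Num.sqrt N%:R / (s / r) *
  (2 * ((2 * S)^-1 * Num.sqrt N%:R * s))) <= n%:R * m%:R * r.
Proof.
rewrite [X in _ * X](_ : _ = S^-1 * N%:R * r); last first.
  by rewrite -[in RHS]sqrtN; field; rewrite !gt_eqF.
by rewrite mulrA ler_wpM2r// ltW.
Qed.

Lemma mult_complexity_le : 1 <= M -> s <= r ->
  1024 * (Num.sqrt N%:R / (s / r) *
    (2 * ((2 * S)^-1 * Num.sqrt N%:R * s ^+ 2))) <= n%:R * m%:R * r ^+ 2.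
Proof.
move=> M1 sr; rewrite [X in _ * X](_ : _ = S^-1 * N%:R * (s * r)); last first.
  by rewrite -[in RHS]sqrtN; field; rewrite !gt_eqF.
have SN0 : 0 <= S^-1 * N%:R by rewrite mulr_ge0 ?invr_ge0// ltW.
apply: (@le_trans _ _ (1024 * M * (S^-1 * N%:R) * (r * r))); last first.
  by rewrite -expr2 ler_wpM2r// sqr_ge0.
move: NS SN0; move: (S^-1 * N%:R) => a _ a0.
rewrite -!mulrA; apply: ler_wpM2l; first exact: ler0n.
rewrite -[leLHS]mul1r; apply: ler_pM => //.
  by rewrite !mulr_ge0// ltW.
by apply: ler_wpM2l => //; rewrite ler_wpM2r// ltW.
Qed.

End complexity_arithmetic.

Section tournament.
Context {R : realType} (q L : R).
Hypotheses (hq : 2 < q) (hL : 1 < L).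

Let M := trunc_level q L.
Let C := block_const q L.
Let S := sample_const q L.

Definition aspect (sigma r : R) : R := Num.max 1 (sigma ^+ 2 / r ^+ 2).
Definition block_size (sigma r : R) : nat :=
  (Num.truncn (block_const q L * aspect sigma r)).+1.

Context {d : measure_display} {T : measurableType d}.

Definition sample_blocks (N : nat) (sigma r : R) (z : N.-tuple (T * R)) :
    (N %/ block_size sigma r).-tuple ((block_size sigma r).-tuple (T * R)) :=
  blocks (esym (divn_eq N (block_size sigma r))) z.

(* The last [N %% block_size] sample points are discarded by [blocks]. *)
Definition winner (N : nat) (F : set (T -> R)) (sigma r : R)
    (z : N.-tuple (T * R)) : (T -> R) -> Prop :=
  accepted F ((block_size sigma r)%:R * r ^+ 2 / 4) (sample_blocks sigma r z).

Variables (mu : probability T R) (pXY : probability (T * R)%type R).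
Variables (N : nat) (F : set (T -> R)) (h : T -> R) (sigma r : R).
Hypothesis mufst : measure_preserving pXY mu fst.
Hypothesis Fh : F h.
Hypothesis mF : forall f, F f -> measurable_fun setT f.
Hypothesis F2 : forall f, F f -> (\int[mu]_x ((f x - h x) ^+ 2)%:E < +oo)%E.
Hypotheses (sigma0 : 0 < sigma) (r0 : 0 < r).
Hypothesis Fq : forall f, linear_span F f ->
  (Lqnorm mu q f <= L%:E * Lqnorm mu 2 f)%E.
Hypothesis hmult : forall v, local_class mu F h r v ->
  [/\ pXY.-integrable setT (EFin \o multiplier h v),
      (\int[pXY]_z multiplier h v z)%R = 0 &
      (\int[pXY]_z (multiplier h v z ^+ 2)%:E <= (r ^+ 2 * sigma ^+ 2)%:E)%E].
Hypothesis rstar :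
  (2%:E * r_star mu N F pXY (2 * S)^-1 1 sigma h <= r%:E)%E.

Let K := aspect sigma r.
Let m := block_size sigma r.
Let n := (N %/ m)%N.
Let c1 := (2 * S)^-1.

Let c10 : 0 < c1. Proof. by rewrite invr_gt0 mulr_gt0// sample_const_gt0. Qed.
Let M1 : 1 <= M. Proof. exact: trunc_level_ge1. Qed.
Let C1 : 1 <= C. Proof. exact: block_const_ge1. Qed.
Let S0 : 0 < S.
Proof. exact: sample_const_gt0. Qed.
Let C4096 : 4096 <= C.
Proof.
move: (block_const_ge hq hL) (trunc_level_ge1 hq hL); rewrite /C.
by move: (trunc_level q L) (block_const q L) => a b; lra.
Qed.
Let S2048 : 2048 * M <= S.
Proof.
move: (block_const_ge hq hL) (trunc_level_ge1 hq hL).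
rewrite /S /sample_const /M.
by move: (trunc_level q L) (block_const q L) => a b; lra.
Qed.
Let K1 : 1 <= K. Proof. by rewrite /K /aspect le_max lexx. Qed.

Let radius (Q : set R) :
  (ereal_inf [set x%:E | x in [set x : R | (0 < x)%R /\ Q x]] <=
    r_star mu N F pXY c1 1 sigma h)%E ->
  exists x, [/\ 0 < x, x <= r & Q x].
Proof. by move=> infQ; exact: ereal_inf_radius_lt r0 infQ rstar. Qed.

Let radius_Q : exists x, [/\ 0 < x, x <= r &
  (lne (packing mu (local_class mu F h x) (1 * x)) <= (c1 ^+ 2 * N%:R)%:E)%E].
Proof. by apply: radius; rewrite /r_star !le_max lexx. Qed.

Let radius_M : exists x, [/\ 0 < x, x <= r &
  (lne (packing mu (local_class mu F h x) (1 * x)) <=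
    ((c1 / sigma) ^+ 2 * N%:R * x ^+ 2)%:E)%E].
Proof. by apply: radius; rewrite /r_star !le_max lexx !orbT. Qed.

Let radius_E : exists x, [/\ 0 < x, x <= r &
  (rademacher_sup N mu (local_class mu F h x) <=
    (c1 * Num.sqrt N%:R * x)%:E)%E].
Proof. by apply: radius; rewrite /r_star !le_max lexx !orbT. Qed.

Let radius_mult : exists x, [/\ 0 < x, x <= r &
  (rademacher_sup N pXY [set multiplier h u | u in local_class mu F h x] <=
    (c1 * Num.sqrt N%:R * x ^+ 2)%:E)%E].
Proof. by apply: radius; rewrite /r_star !le_max lexx !orbT. Qed.

Let far_sep (s : R) f : F f -> 0 < s -> s <= r ->
  (((2 * r) ^+ 2)%:E < \int[mu]_x ((f x - h x) ^+ 2)%:E)%E ->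
  exists v, local_class mu F h s v /\
    (((1 * s) ^+ 2)%:E <= \int[mu]_x ((v x - cst 0 x) ^+ 2)%:E)%E.
Proof.
move=> Ff s0 sr far; have [rho rho0 f2] := rho_exists F2 Ff.
have rrho : s <= rho.
  move: far; rewrite f2 lte_fin => far; apply: (le_trans sr).
  rewrite leNgt; apply/negP => rhor; move: far; rewrite ltNge => /negP; apply.
  have r2 : 0 <= 2 * r by rewrite mulr_ge0// ltW.
  have rho2 : rho <= 2 * r by move: rhor (r0); lra.
  by rewrite lerXn2r ?nnegrE//.
have [Lv v2] := local_class_far Fh mF s0 rrho Ff f2.
exists (fun x => s / rho * (f x - h x)); split => //.
rewrite mul1r -v2 le_eqVlt; apply/orP; left; apply/eqP.
by apply: eq_integral => x _; rewrite subr0.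
Qed.

(* A far point scales to a point of norm [s] of the localized class of radius
   [s], which with [0] makes a separated pair, so both packing numbers are at
   least [2]. *)
Let sample_large f : F f ->
  (((2 * r) ^+ 2)%:E < \int[mu]_x ((f x - h x) ^+ 2)%:E)%E ->
  S <= N%:R / K.
Proof.
move=> Ff far.
have [r1 [r10 r1r p1]] := radius_Q; have [r2 [r20 r2r p2]] := radius_M.
have [v1 [Lv1 v1far]] := far_sep Ff r10 r1r far.
have [v2 [Lv2 v2far]] := far_sep Ff r20 r2r far.
have h1 := lne_packing_ge Lv1 (local_class0 mu Fh (ltW r10))
  (mulr_ge0 ler01 (ltW r10)) v1far p1.
have h2 := lne_packing_ge Lv2 (local_class0 mu Fh (ltW r20))
  (mulr_ge0 ler01 (ltW r20)) v2far p2.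
(* The entropy level of [lambda_M] increases with the radius, so [r2 <= r] allows reading it at [r].
   It then bounds [N r^2 / sigma^2] from below, as [lambda_Q] does for [N]; the smaller of the two
   is [N / K]. *)
have h3 : 1 / 2 <= c1 ^+ 2 * (N%:R / (sigma ^+ 2 / r ^+ 2)).
  have -> : c1 ^+ 2 * (N%:R / (sigma ^+ 2 / r ^+ 2)) =
      (c1 / sigma) ^+ 2 * N%:R * r ^+ 2 by field; rewrite !gt_eqF.
  apply: (le_trans h2); apply: ler_wpM2l; first by rewrite mulr_ge0 ?sqr_ge0.
  by rewrite lerXn2r ?nnegrE ?(ltW r0) ?(ltW r20).
have h4 : 1 / 2 <= c1 ^+ 2 * (N%:R / K).
  rewrite /K /aspect; case: (leP 1 (sigma ^+ 2 / r ^+ 2)) => _ //.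
  by rewrite divr1.
have S1 : 1 <= S.
  by have := C1; rewrite /S /sample_const -/C; lra.
have -> : N%:R / K = (2 * S) ^+ 2 * (c1 ^+ 2 * (N%:R / K)).
  rewrite [RHS]mulrA -exprMn /c1 divff ?expr1n ?mul1r//.
  by rewrite gt_eqF// mulr_gt0.
apply: (@le_trans _ _ ((2 * S) ^+ 2 * (1 / 2))); last first.
  by rewrite ler_wpM2l// sqr_ge0.
have -> : (2 * S) ^+ 2 * (1 / 2) = 2 * (S * S) by field.
have : S * 1 <= S * S by rewrite ler_wpM2l// ltW.
by rewrite mulr1; lra.
Qed.

Lemma winner_near :
  (forall f, F f -> \int[mu]_x ((f x - h x) ^+ 2)%:E <= ((2 * r) ^+ 2)%:E)%E \/
  exists A : set (N.-tuple (T * R)),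
    [/\ measurable A,
        ((1 - expR (- (N%:R / K / S)))%:E <= iid_law pXY N A)%E &
        forall z, A z -> (exists f, winner F sigma r z f) /\
          (forall f, winner F sigma r z f ->
            \int[mu]_x ((f x - h x) ^+ 2)%:E <= ((2 * r) ^+ 2)%:E)%E].
Proof.
have [near|/existsNP[f /not_implyP[Ff /negP]]] := pselect (forall f, F f ->
  \int[mu]_x ((f x - h x) ^+ 2)%:E <= ((2 * r) ^+ 2)%:E)%E; first by left.
rewrite -ltNge => far; right.
have SN := sample_large Ff far.
have [CKm n0 Nnm fail] := block_count hq hL K1 SN.
have m0 : (0 < m)%N by [].
have eN : (n * m + N %% m)%N = N by rewrite -divn_eq.
have N0 : (0 < N)%N by rewrite lt0n; apply: contraTneq n0 => ->; rewrite div0n.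
have sN : 0 < Num.sqrt (N%:R : R) by rewrite sqrtr_gt0 ltr0n.
have [r3 [r30 r3r p3]] := radius_E.
have [r4 [r40 r4r p4]] := radius_mult.
have b3 : 0 < c1 * Num.sqrt N%:R * r3 by rewrite !mulr_gt0.
have b4 : 0 < c1 * Num.sqrt N%:R * r4 ^+ 2 by rewrite !mulr_gt0 ?exprn_gt0.
have [G1 [mG1 G1v G1t]] := rademacher_majorant N0 (divr_gt0 r30 r0) b3
  (fun v => @local_class_scale _ _ _ mu F h Fh mF r r3 v r30 r3r) p3.
have mult_scale v : [set multiplier h u | u in local_class mu F h r] v ->
    [set multiplier h u | u in local_class mu F h r4] (fun z => r4 / r * v z).
  move=> [u Lu <-]; exists (fun x => r4 / r * u x).
    exact: local_class_scale Lu.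
  by apply/funext => z; rewrite /multiplier mulrA.
have [G2 [mG2 G2v G2t]] := rademacher_majorant N0 (divr_gt0 r40 r0) b4
  mult_scale p4.
have M0 : 0 < M by exact: lt_le_trans M1.
have quad_moment : 1024 * M ^+ 4 <= m%:R.
  apply: le_trans CKm; apply: (@le_trans _ _ C).
    by rewrite /C /block_const -/M ler_wpM2r ?exprn_ge0 ?(ltW M0)// ler_nat.
  by rewrite ler_peMr// (le_trans ler01).
have mult_moment : 4096 * sigma ^+ 2 <= m%:R * r ^+ 2.
  rewrite -ler_pdivrMr ?exprn_gt0// -mulrA; apply: le_trans CKm.
  apply: ler_pM; [exact: ler0n|by rewrite divr_ge0// sqr_ge0|exact: C4096|].
  by rewrite /K /aspect le_max lexx orbT.
have quad_complexity := quad_complexity_le M0 S0 r0 r30 S2048 Nnm.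
have mult_complexity := mult_complexity_le M0 S0 r0 r40 S2048 Nnm M1 r4r.
have [Cset [mC PC good]] := good_event mufst Fh mF r0 M0 eN n0 m0 hmult
  mG1 G1v G1t mG2 (fun v w Lv => G2v _ w (ex_intro2 _ _ v Lv erefl)) G2t
  quad_moment mult_moment quad_complexity mult_complexity.
have ball v : local_class mu F h r v ->
    (\int[mu]_x (v x ^+ 2)%:E = (r ^+ 2)%:E)%E ->
    1 / 2 <= (\int[mu]_x sqr_trunc M (v x / r))%R.
  move=> Lv v2; apply: (small_ball hq (lt_trans ltr01 hL) r0 M0) v2 _.
  - exact: trunc_level_powR.
  - exact: measurable_local_class Lv.
  - exact: Fq (span_local_class Fh Lv).
have [mB PB] := preserving_blocks pXY (esym (divn_eq N m)).
exists (@sample_blocks N sigma r @^-1` Cset); split.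
- by rewrite -[X in measurable X]setTI; exact: mB.
- rewrite [leRHS](PB _ mC); apply: le_trans PC.
  by rewrite lee_fin lerD2l lerN2.
- move=> z Cz; have gz v := good _ v Cz.
  split; first by exists h; exact: (accepted_center mufst Fh mF F2 r0 m0 ball gz).
  by move=> g; exact: (accepted_near mufst Fh mF F2 r0 m0 ball gz).
Qed.

End tournament.

Lemma sqr_integralB_lty {R : realType} {d} {T : measurableType d}
    (mu : probability T R) (f g : T -> R) :
  f \in Lfun mu 2%:E -> g \in Lfun mu 2%:E ->
  (\int[mu]_x ((f x - g x) ^+ 2)%:E < +oo)%E.
Proof.
move=> /Lfun2P[mf f2] /Lfun2P[mg g2].
apply: (@le_lt_trans _ _ (\int[mu]_x (2%:E * (f x ^+ 2)%:E + 2%:E * (g x ^+ 2)%:E))%E).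
  apply: ge0_le_integral => //.
  - by move=> x _; rewrite lee_fin sqr_ge0.
  - by apply/measurable_EFinP; apply: measurable_funX; exact: measurable_funB.
  - by apply: emeasurable_funD; apply: measurable_funeM;
      apply/measurable_EFinP; exact: measurable_funX.
  - move=> x _; rewrite -!EFinM -EFinD lee_fin.
    by have := sqr_ge0 (f x + g x); rewrite sqrrB sqrrD; lra.
have sqrE (u : T -> R) : measurable_fun setT u ->
    measurable_fun [set: T] (fun x => (u x ^+ 2)%:E).
  by move=> mu'; apply/measurable_EFinP; exact: measurable_funX.
have sq0 (u : T -> R) x : (0 <= (u x ^+ 2)%:E)%E by rewrite lee_fin sqr_ge0.
rewrite ge0_integralD//; last 4 first.
- by move=> x _; rewrite mule_ge0.
- exact/measurable_funeM/sqrE.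
- by move=> x _; rewrite mule_ge0.
- exact/measurable_funeM/sqrE.
rewrite !ge0_integralZl//; try exact: sqrE.
by rewrite lte_add_pinfty// lte_mul_pinfty.
Qed.

Section aspect.
Context {R : realType}.
Implicit Types sigma r : R.

Lemma aspect_inv sigma r : 0 < sigma -> 0 < r ->
  Num.min 1 (sigma ^- 2 * r ^+ 2) = (aspect sigma r)^-1.
Proof.
move=> s0 r0; rewrite /aspect.
have k0 : 0 < sigma ^+ 2 / r ^+ 2 by rewrite divr_gt0 ?exprn_gt0.
have -> : sigma ^- 2 * r ^+ 2 = (sigma ^+ 2 / r ^+ 2)^-1.
  by rewrite invf_div mulrC.
move: (sigma ^+ 2 / r ^+ 2) k0 => k k0.
have [k1|k1] := leP k 1.
  by rewrite invr1 min_l// invf_ge1.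
by rewrite min_r// invf_le1// ltW.
Qed.

End aspect.

Lemma r_star_ge0 {R : realType} {d} {T : measurableType d}
    (mu : probability T R) (N : nat) (F : set (T -> R))
    (pXY : probability (T * R)%type R) (c1 c2 sigma : R) (h : T -> R) :
  (0 <= r_star mu N F pXY c1 c2 sigma h)%E.
Proof. by rewrite /r_star !le_max ereal_inf_radius_ge0. Qed.

(** * The selection map and the theorem *)

Section selection.
Context {R : realType} (q L : R).
Context {d : measure_display} {T : measurableType d}.
Variables (N : nat) (F : set (T -> R)) (sigma r : R).

(** A classical choice, with an arbitrary member of [F] when nothing is accepted. Such a map may
    fail to be measurable, which is why the guarantee is stated on a measurable event contained in
    the set where it holds. *)
Definition select (F0 : F !=set0) (z : N.-tuple (T * R)) : T -> R :=
  if pselect (exists f, winner q L F sigma r z f) is left w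
  then projT1 (cid w) else projT1 (cid F0).

Lemma select_mem F0 z : F (select F0 z).
Proof.
rewrite /select; case: pselect => [w|_]; last by case: cid.
by case: cid => f [].
Qed.

Lemma select_winner F0 z : (exists f, winner q L F sigma r z f) ->
  winner q L F sigma r z (select F0 z).
Proof. by rewrite /select; case: pselect => // w _; case: cid. Qed.

End selection.

Theorem theorem2p11 (R : realType) (q L : R) (hq : 2 < q) (hL : 1 < L) :
  exists c c0 c1 c2 : R, [/\ 0 < c, 0 < c0, 0 < c1 & 0 < c2] /\
  forall (d : measure_display) (T : measurableType d) (N : nat)
    (F : set (T -> R)) (sigma r : R),
    F !=set0 -> 0 < sigma ->
  exists procedure : N.-tuple (T * R)%type -> T -> R,
    (forall z, F (procedure z)) /\
    forall (dO : measure_display) (Omega : measurableType dO)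
      (P : probability Omega R)
      (X : {RV P >-> T}) (Y W : {RV P >-> R})
      (D : 'I_N -> {RV P >-> (T * R)%type}) (f0 : T -> R),
    let mu := distribution P X in
    iid_sample X Y D ->
    (forall f, F f -> f \in Lfun mu 2%:E) ->
    L2_locally_compact mu F ->
    (forall f, linear_span F f -> (Lqnorm mu q f <= L%:E * Lqnorm mu 2 f)%E) ->
    F f0 ->
    (forall w, Y w = f0 (X w) + W w) ->
    'E_P[W]%E = 0%E ->
    independent X W ->
    (Lqnorm P 2 W <= sigma%:E)%E ->
    risk_minimizer X Y F f0 /\
    forall fstar : T -> R, risk_minimizer X Y F fstar ->
      (2%:E * r_star mu N F (distribution P (RV_pair X Y)) c1 c2 sigma fstar
         <= r%:E)%E ->
      exists A : set Omega,
        [/\ measurable A,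
            ((1 - expR (- (c0 * N%:R * Num.min 1 (sigma ^- 2 * r ^+ 2))))%:E
               <= P A)%E &
            forall w, A w ->
              (Lqnorm mu 2 (procedure (sample_value D w) \- f0)
                 <= (c * r)%:E)%E /\
              (risk X Y (procedure (sample_value D w))
                 <= risk X Y f0 + ((c * r) ^+ 2)%:E)%E].
Proof.
have const_gt0 (s : R) : 0 < s ->
    [/\ 0 < 2 :> R, 0 < s^-1, 0 < (2 * s)^-1 & 0 < 1 :> R].
  by move=> s0; split; rewrite ?invr_gt0 ?mulr_gt0.
(* In order: the distance from [accepted_near]; the rate from [block_count]; the level for which
   [quad_complexity_le] and [mult_complexity_le] hold; and [1], because the pair in [sample_large]
   is separated by exactly the radius. *)
exists 2, (sample_const q L)^-1, (2 * sample_const q L)^-1, 1; split.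
  exact: const_gt0 (sample_const_gt0 hq hL).
move=> d T N F sigma r F0 sigma0; exists (select q L sigma r F0).
split=> [z|dO Omega P X Y W D f0 mu iidD FL2 _ Fq Ff0 YE EW XW W2].
  exact: select_mem.
have mF f (Ff : F f) : measurable_fun setT f by have [] := Lfun2P (FL2 f Ff).
have riskE f (Ff : F f) := risk_split (mF _ Ff0) YE EW XW (ltW sigma0) W2 (mF _ Ff).
have risk0 : risk X Y f0 = (\int[distribution P W]_w (w ^+ 2)%:E)%E.
  rewrite riskE// [X in (_ + X)%E]integral0_eq ?adde0//.
  by move=> x _; rewrite subrr expr0n.
have sqr_int0 (f : T -> R) : (0 <= \int[mu]_x ((f x - f0 x) ^+ 2)%:E)%E.
  by apply: integral_ge0 => x _; rewrite lee_fin sqr_ge0.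
split; first by split=> // g Fg; rewrite risk0 riskE// leeDl.
move=> h [Fh hmin] rstar.
(* By minimality the risk of [h] is at most the noise variance, which is finite and cancels from
   [risk_split], leaving distance zero. *)
have hf0 : {ae mu, forall x, h x = f0 x}.
  apply: (ae_eq_sqr_integral0 (mF _ Fh) (mF _ Ff0)).
  have := hmin f0 Ff0; rewrite risk0 riskE//.
  have fin : (\int[distribution P W]_w (w ^+ 2)%:E)%E \is a fin_num.
    rewrite ge0_fin_numE; last by apply: integral_ge0 => w _; rewrite lee_fin sqr_ge0.
    exact: le_lt_trans (noise_sqr (ltW sigma0) W2) (ltry _).
  by rewrite -[leRHS]adde0 leeD2lE.
have r_ge0 : 0 <= r.
  by rewrite -lee_fin; apply: le_trans rstar; rewrite mule_ge0// r_star_ge0.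
have guarantee g : F g -> (\int[mu]_x ((g x - h x) ^+ 2)%:E <= ((2 * r) ^+ 2)%:E)%E ->
    (Lqnorm mu 2 (g \- f0) <= (2 * r)%:E)%E /\
    (risk X Y g <= risk X Y f0 + ((2 * r) ^+ 2)%:E)%E.
  move=> Fg; rewrite (ae_integral_sqrB (mF _ Fg) (mF _ Fh) (mF _ Ff0) hf0) => gf0.
  by rewrite Lqnorm2_le ?mulr_ge0// risk0 riskE//; split=> //; exact: leeD2l.
(* For [r = 0] the required probability is [1 - exp 0 = 0] and the empty event serves; the rest of
   the argument divides by [r]. *)
move: r_ge0; rewrite le_eqVlt => /predU1P[r0|r0].
  exists set0; split=> //.
  by rewrite -r0 expr0n mulr0 min_r// mulr0 oppr0 expR0 subrr.
have mufst : measure_preserving (distribution P (RV_pair X Y)) mu fst.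
  by split.
have F2 f : F f -> (\int[mu]_x ((f x - h x) ^+ 2)%:E < +oo)%E.
  by move=> Ff; apply: sqr_integralB_lty; exact: FL2.
have hmult v : local_class mu F h r v ->
    [/\ (distribution P (RV_pair X Y)).-integrable setT (EFin \o multiplier h v),
        (\int[distribution P (RV_pair X Y)]_z multiplier h v z)%R = 0 &
        (\int[distribution P (RV_pair X Y)]_z (multiplier h v z ^+ 2)%:E <=
          (r ^+ 2 * sigma ^+ 2)%:E)%E].
  move=> Lv; have mv := measurable_local_class Fh mF Lv.
  have [_ /=] := Lv; rewrite Lqnorm2_le ?(ltW r0)// => v2.
  have v2y := le_lt_trans v2 (ltry _).
  split.
  - exact: (multiplier_integrable (mF _ Ff0) YE XW (ltW sigma0) W2 (mF _ Fh) mv hf0 v2y).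
  - exact: (multiplier_mean (mF _ Ff0) YE EW XW (ltW sigma0) W2 (mF _ Fh) mv hf0 v2y).
  - apply: le_trans (multiplier_sqr (mF _ Ff0) YE XW (ltW sigma0) W2 (mF _ Fh) mv hf0) _.
    by rewrite (EFinM (r ^+ 2)) lee_wpmul2r// lee_fin sqr_ge0.
have [near|[A [mA PA Anear]]] :=
    winner_near hq hL mufst Fh mF F2 sigma0 r0 Fq hmult rstar.
  exists setT; split=> //; first by rewrite probability_setT lee_fin gerBl// expR_ge0.
  by move=> w _; apply: guarantee; [exact: select_mem|apply: near; exact: select_mem].
have [mD PD] := preserving_sample iidD.
exists (sample_value D @^-1` A); split.
- by rewrite -[X in measurable X]setTI; exact: mD.
- rewrite [leRHS](PD _ mA); move: PA.
  by rewrite aspect_inv// [_ / _ / _]mulrC mulrA.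
- move=> w /Anear[win near]; apply: guarantee; first exact: select_mem.
  exact: near (select_winner F0 win).
Qed.
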